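(* Let $\|\cdot\|=\|\cdot\|_p$ on $\mathbb R^d$ with $1\le p\le2$. Let $F:\mathcal X\to\mathcal Y$ be an operator with $F(x)=\mathbb E_\pi[F(x,Z)]$, accessible only through the noisy oracle $F(x,Z)$, and consider the variational inequality: find $x^*\in\mathcal X$ with $\langle F(x^* ),x-x^*\rangle\ge0$ for all $x\in\mathcal X$. Assume: (i) $\{Z_t\}_{t\ge0}$ is a stationary Markov chain on $\mathsf Z$ with unique invariant distribution $\pi$, uniformly geometrically ergodic with mixing time $\tau_{\text{mix}}$, i.e. $|\mathbb P\{Z_t=z\mid Z_0=z_0\}-\pi_z|\lesssim(1/2)^{t/\tau_{\text{mix}}}$ for all $t>0$ and $z_0,z\in\mathsf Z$; (ii) $F$ is $L$-Lipschitz: $\|F(x)-F(y)\|_*\le L\|x-y\|$ for all $x,y\in\mathcal X$; (iii) $F$ is monotone: $\langle F(x)-F(y),x-y\rangle\ge0$ for all $x,y\in\mathcal X$; (iv) for all $x\in\mathbb R^d$, $\mathbb E_\pi[F(x,Z)]=F(x)$, and $\|F(x,Z)-F(x)\|_*^2\le\sigma^2$ for all $Z\in\mathsf Z$ and $x\in\mathbb R^d$. Let the problem be solved by the batched Markovian Mirror-Prox method (described in the context) with batch size $B$, batch size limit $M$ and stepsize $\gamma>0$ chosen such that $\gamma\le1/(2L)$, and let $\widehat x^T=\frac1T\sum_{t=0}^{T-1}x^{t+1/2}$. Then for all $T\ge1$, $$\mathbb E\big[\mathrm{Err}_{\mathrm{VI}}(\widehat x^T)\big]=\widetilde{\mathcal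 O}\Big(\frac{D^2}{\gamma T}+\gamma\tau_{\text{mix}}B^{-1}\big(TM^{-1}+\log M\big)\sigma^2\Big),\qquad \mathrm{Err}_{\mathrm{VI}}(x):=\max_{u\in\mathcal X}\langle F(u),x-u\rangle .$$
   Context: Geometry. $\mathcal Y=\mathbb R^d$ is a Euclidean space and $\mathcal X\subset\mathcal Y$ is a compact convex set; $\|y\|_*=\max_{\|z\|\le1}\langle y,z\rangle$ is the conjugate norm. $\omega$ is a proper convex lower semicontinuous function, $1$-strongly convex with respect to $\|\cdot\|$ on $\mathcal X$; the Bregman divergence is $V(x,y)=\omega(y)-\omega(x)-\langle\omega'(x),y-x\rangle$ with $\omega'(x)\in\partial\omega(x)$; it is assumed to exist on $\mathcal X$. $D^2:=\max_{x,y\in\mathcal X}V(x,y)$. Prox mapping: $P_x(\xi):=\arg\min_{y\in\mathcal X}\{V(x,y)+\langle\xi,y\rangle\}$. $\mathsf Z$ is the state space of the chain; $\pi_z$ is the mass of $\pi$ at $z$. Batched Markovian Mirror-Prox. Start from $x^0\in\mathcal X$, $N_0=0$. For $t=0,1,2,\dots,T$: $g^{t+1/2}=B^{-1}\sum_{i=1}^BF(x^t,Z_{N_t+i})$; $x^{t+1/2}=P_{x^t}(\gamma g^{t+1/2})$; $N_{t+1/2}=N_t+B$; sample $J_t\sim\mathrm{Geom}(1/2)$ (so $\mathbb P\{J_t=i\}=2^{-i}$, $i\ge1$); with $g_j^t=2^{-j}B^{-1}\sum_{i=1}^{2^jB}F(x^{t+1/2},Z_{N_{t+1/2}+i})$ set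 $g^t=g_0^t+2^{J_t}(g^t_{J_t}-g^t_{J_t-1})$ if $2^{J_t}\le M$ and $g^t=g_0^t$ otherwise; $x^{t+1}=P_{x^t}(\gamma g^t)$; $N_{t+1}=N_{t+1/2}+2^{J_t}B$. Asymptotic notation. $a\lesssim b$ means $a\le Cb$ for a constant $C>0$. $a(T)=\widetilde{\mathcal O}(b(T))$ means there is $C>0$ with $a(T)\le C\log(T)\,b(T)$ for all integers $T\ge2$. A factor of order $\log d$, arising from passing from the Euclidean norm to $\|\cdot\|_p$ with $1\le p\le2$, is omitted from the bound by convention.
   Formalization: The selection ω'(x) ∈ ∂ω(x) is assumed continuous on X (for an arbitrary selection at a kink of ω the iterates can stall and the bound fails); also the state space is countable, τ_mix ≥ 1, and the omitted log d factor is written as 1 + log d. *)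

(* Defs.v *)
From HB Require Import structures.
From mathcomp Require Import all_boot all_order all_algebra.
From mathcomp Require Import all_classical all_reals all_analysis.

Set Implicit Arguments.
Unset Strict Implicit.
Unset Printing Implicit Defensive.

Import Order.TTheory GRing.Theory Num.Theory.
Import numFieldNormedType.Exports.

Local Open Scope classical_set_scope.
Local Open Scope ring_scope.

Definition dotp (R : realType) (d : nat) (x y : 'rV[R]_d) : R :=
  \sum_(i < d) x ord0 i * y ord0 i.

Definition pnorm (R : realType) (d : nat) (p : R) (x : 'rV[R]_d) : R :=
  (\sum_(i < d) `|x ord0 i| `^ p) `^ p^-1.

Definition dual_pnorm (R : realType) (d : nat) (p : R) (y : 'rV[R]_d) : R :=
  sup [set dotp y z | z in [set z | pnorm p z <= 1]].

(* Extended-valued functions w : R^d -> R u {+oo}.  In [convex_ext] the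
   endpoints t = 0, 1 are harmless because 0 * +oo = 0. *)
Definition proper_ext (R : realType) (d : nat) (w : 'rV[R]_d -> \bar R) :=
  (exists x, (w x < +oo)%E) /\ (forall x, (-oo < w x)%E).

Definition convex_ext (R : realType) (d : nat) (w : 'rV[R]_d -> \bar R) :=
  forall (x y : 'rV[R]_d) (t : R), 0 <= t <= 1 ->
    (w (t *: x + (1 - t) *: y)%R <= t%:E * w x + (1 - t)%:E * w y)%E.

Definition strongly_convex_on (R : realType) (d : nat) (mu p : R)
    (X : set 'rV[R]_d) (w : 'rV[R]_d -> \bar R) :=
  forall (x y : 'rV[R]_d) (t : R), X x -> X y -> 0 <= t <= 1 ->
    (w (t *: x + (1 - t) *: y)%R
       + (mu / 2 * (t * (1 - t)) * pnorm p (x - y) ^+ 2)%:E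
     <= t%:E * w x + (1 - t)%:E * w y)%E.

Definition subdifferential (R : realType) (d : nat) (w : 'rV[R]_d -> \bar R)
    (x : 'rV[R]_d) : set 'rV[R]_d :=
  [set s | w x \is a fin_num /\
           forall y, (w x + (dotp s (y - x)%R)%:E <= w y)%E].

(* [dw x] stands for the selected subgradient w'(x).  The selection is taken
   continuous on X (this includes every w differentiable at the points of X):
   at a kink of w an arbitrary selection does not satisfy the three-point
   inequality, and prox steps may then stall away from a solution. *)
Definition distance_generating (R : realType) (d : nat) (p : R)
    (X : set 'rV[R]_d) (w : 'rV[R]_d -> \bar R) (dw : 'rV[R]_d -> 'rV[R]_d) :=
  [/\ proper_ext w, convex_ext w, lower_semicontinuous w &
      [/\ strongly_convex_on 1 p X w,
          forall x, X x -> subdifferential w x (dw x) &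
          {within X, continuous dw}]].

Definition bregman (R : realType) (d : nat) (w : 'rV[R]_d -> \bar R)
    (dw : 'rV[R]_d -> 'rV[R]_d) (x y : 'rV[R]_d) : R :=
  fine (w y) - fine (w x) - dotp (dw x) (y - x).

(* This is D^2, already squared. *)
Definition bregman_diam2 (R : realType) (d : nat) (X : set 'rV[R]_d)
    (w : 'rV[R]_d -> \bar R) (dw : 'rV[R]_d -> 'rV[R]_d) : R :=
  sup [set bregman w dw xy.1 xy.2 | xy in X `*` X].

(* The argmin over X; the default value x of [xget] is never used when X is
   compact and w is a distance-generating function. *)
Definition prox (R : realType) (d : nat) (X : set 'rV[R]_d)
    (w : 'rV[R]_d -> \bar R) (dw : 'rV[R]_d -> 'rV[R]_d)
    (x xi : 'rV[R]_d) : 'rV[R]_d :=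
  xget x [set y | X y /\ forall y', X y' ->
    bregman w dw x y + dotp xi y <= bregman w dw x y' + dotp xi y'].

Definition err_vi (R : realType) (d : nat) (X : set 'rV[R]_d)
    (F : 'rV[R]_d -> 'rV[R]_d) (x : 'rV[R]_d) : R :=
  sup [set dotp (F u) (x - u) | u in X].

Definition lipschitz_pnorm_on (R : realType) (d : nat) (p L : R)
    (X : set 'rV[R]_d) (F : 'rV[R]_d -> 'rV[R]_d) :=
  forall x y, X x -> X y -> dual_pnorm p (F x - F y) <= L * pnorm p (x - y).

Definition monotone_on (R : realType) (d : nat)
    (X : set 'rV[R]_d) (F : 'rV[R]_d -> 'rV[R]_d) :=
  forall x y, X x -> X y -> 0 <= dotp (F x - F y) (x - y).

Definition unbiased_bounded_oracle (R : realType) (d : nat) (p sigma : R)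
    (dZ : measure_display) (S : measurableType dZ) (pi : probability S R)
    (F : 'rV[R]_d -> 'rV[R]_d) (Fo : 'rV[R]_d -> S -> 'rV[R]_d) :=
  (forall x i, 'E_pi[fun z => Fo x z ord0 i] = (F x ord0 i)%:E)%E /\
  (forall x z, dual_pnorm p (Fo x z - F x) ^+ 2 <= sigma ^+ 2).

Fixpoint tstep (R : realType) (dZ : measure_display) (S : measurableType dZ)
    (Q : R.-pker S ~> S) (t : nat) (z : S) (A : set S) : \bar R :=
  if t is t'.+1 then (\int[Q z]_y tstep Q t' y A)%E else (\d_z A)%E.

Definition invariant_distribution (R : realType) (dZ : measure_display)
    (S : measurableType dZ) (Q : R.-pker S ~> S) (mu : probability S R) :=
  forall A, measurable A -> (\int[mu]_z Q z A)%E = mu A.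

Definition unique_invariant_distribution (R : realType) (dZ : measure_display)
    (S : measurableType dZ) (Q : R.-pker S ~> S) (pi : probability S R) :=
  invariant_distribution Q pi /\
  forall mu : probability S R, invariant_distribution Q mu ->
    forall A, measurable A -> mu A = pi A.

(* C0 is the multiplicative constant of the bound on the transition masses. *)
Definition geometrically_ergodic (R : realType) (dZ : measure_display)
    (S : measurableType dZ) (Q : R.-pker S ~> S) (pi : probability S R)
    (C0 tau : R) :=
  forall (t : nat) (z0 z : S), (0 < t)%N ->
    `|fine (tstep Q t z0 [set z]) - fine (pi [set z])|
      <= C0 * 2^-1 `^ (t%:R / tau).

(* Time-homogeneous Markov property on a countable state space, written without
   division by the probability of the past. *)
Definition markov_chain (R : realType) (dZ : measure_display)
    (S : measurableType dZ) (dO : measure_display) (Omega : measurableType dO)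
    (P : probability Omega R) (Q : R.-pker S ~> S)
    (Z : nat -> {RV P >-> S}) :=
  forall (n : nat) (z : nat -> S),
    P [set o | forall i, (i <= n.+1)%N -> Z i o = z i]
    = (P [set o | forall i, (i <= n)%N -> Z i o = z i]
         * Q (z n) [set z n.+1])%E.

Definition stationary_markov_chain (R : realType) (dZ : measure_display)
    (S : measurableType dZ) (dO : measure_display) (Omega : measurableType dO)
    (P : probability Omega R) (Q : R.-pker S ~> S) (pi : probability S R)
    (Z : nat -> {RV P >-> S}) :=
  markov_chain Q Z /\
  forall t A, measurable A -> distribution P (Z t) A = pi A.

Definition geometric_half (R : realType) (dO : measure_display)
    (Omega : measurableType dO) (P : probability Omega R)
    (J : nat -> {RV P >-> nat}) :=
  forall t i : nat, (0 < i)%N ->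
    distribution P (J t) [set i] = (2^-1 ^+ i)%:E.

(* J_0, J_1, ... are mutually independent and jointly independent of the whole
   process (Z_t). *)
Definition independent_levels (R : realType) (dZ : measure_display)
    (S : measurableType dZ) (dO : measure_display) (Omega : measurableType dO)
    (P : probability Omega R) (Z : nat -> {RV P >-> S})
    (J : nat -> {RV P >-> nat}) :=
  forall (n : nat) (A : nat -> set S) (K : nat -> set nat),
    (forall i, measurable (A i)) ->
    P [set o | forall i, (i < n)%N -> A i (Z i o) /\ K i (J i o)]
    = (P [set o | forall i, (i < n)%N -> A i (Z i o)]
         * \prod_(i < n) P [set o | K i (J i o)])%E.

Definition batch (R : realType) (d : nat) (S : Type)
    (Fo : 'rV[R]_d -> S -> 'rV[R]_d) (zs : nat -> S)
    (x : 'rV[R]_d) (N n : nat) : 'rV[R]_d :=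
  n%:R^-1 *: \sum_(1 <= i < n.+1) Fo x (zs (N + i)%N).

Section method.
Context (R : realType) (d : nat) (S : Type).
Context (X : set 'rV[R]_d) (w : 'rV[R]_d -> \bar R).
Context (dw : 'rV[R]_d -> 'rV[R]_d) (Fo : 'rV[R]_d -> S -> 'rV[R]_d).
Context (gamma : R) (B M : nat).

Definition half_step (zs : nat -> S) (s : 'rV[R]_d * nat) : 'rV[R]_d :=
  prox X w dw s.1 (gamma *: batch Fo zs s.1 s.2 B).

Definition level_batch (zs : nat -> S) (s : 'rV[R]_d * nat) (j : nat) :=
  batch Fo zs (half_step zs s) (s.2 + B) (2 ^ j * B).

Definition mlmc_estimator (zs : nat -> S) (s : 'rV[R]_d * nat) (j : nat) :=
  if (2 ^ j <= M)%N then
    level_batch zs s 0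
      + 2 ^+ j *: (level_batch zs s j - level_batch zs s j.-1)
  else level_batch zs s 0.

Definition mirror_prox_step (zs : nat -> S) (s : 'rV[R]_d * nat) (j : nat) :
    'rV[R]_d * nat :=
  (prox X w dw s.1 (gamma *: mlmc_estimator zs s j),
   (s.2 + B + 2 ^ j * B)%N).

(* The pair (x^t, N_t) along the realization zs of the chain and js of the
   levels J_0, J_1, ... *)
Fixpoint mirror_prox (x0 : 'rV[R]_d) (zs : nat -> S) (js : nat -> nat)
    (t : nat) : 'rV[R]_d * nat :=
  if t is t'.+1 then mirror_prox_step zs (mirror_prox x0 zs js t') (js t')
  else (x0, 0%N).

Definition mirror_prox_average (x0 : 'rV[R]_d) (zs : nat -> S)
    (js : nat -> nat) (T : nat) : 'rV[R]_d :=
  T%:R^-1 *: \sum_(t < T) half_step zs (mirror_prox x0 zs js t).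

End method.

(* Main.v *)
Require Import Defs.
From HB Require Import structures.
From mathcomp Require Import all_boot all_order all_algebra.
From mathcomp Require Import all_classical all_reals all_analysis.
From mathcomp Require Import measurable_realfun.
From mathcomp Require Import ring lra.

Set Implicit Arguments.
Unset Strict Implicit.
Unset Printing Implicit Defensive.

Import Order.TTheory GRing.Theory Num.Theory.
Import numFieldNormedType.Exports.

Local Open Scope classical_set_scope.
Local Open Scope ring_scope.

(** The proof separates what holds along every trajectory of the method from
what holds on average.

Along a trajectory, the three-point inequality for the prox steps
([prox_three_point]) gives the regret bound of mirror-prox, with the errors of
the stochastic estimators as perturbations; strong convexity and gamma L <= 1/2
absorb the Lipschitz term. The error function maximizes over a point u that
depends on the noise, so that the product of the noise with u is not centered.
The noise of the estimator used in the second prox step is therefore split at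
the mean over the largest admissible batch, of size 2^m B with M/2 < 2^m <= M.

- The deviation of the estimator from this mean, [level_noise], averages to zero
  over the random level because the weighted corrections telescope
  ([level_noise_mean]). The point u is traded for an auxiliary mirror-descent
  sequence [ghost] driven by this noise alone: the price is the square of the
  noise, and the remaining linear term has zero mean, since the auxiliary
  sequence is known before the level is drawn ([noise_direction_mean]).
- The error of the largest batch itself, [top_noise], is biased; Young's
  inequality with weight T charges D^2/T to each step, and T times the square of
  the error.

The outcome is [err_vi_trajectory]: the regret is at most 3 D^2 plus a sum of
squares of noises and centered terms.

On average, everything rests on the mean square of a batch error. The dual norm
is first replaced by a q-norm with 2 <= q <= 2 + 2 log d ([smooth_surrogate]),
whose square is 2-smooth with a constant linear in q ([pnorm_sqr_smooth]). Uniform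
ergodicity bounds the transition masses of the chain one point at a time; since
all but a small part of the mass of pi lies on a finite set, b steps of the chain
halve the supremum of every centered function, with b of order tau
([ergodic_contraction]). A sum of l samples is cut by residue modulo b; along each
residue class a truncated Poisson equation turns the sum into a martingale with
increments of order s, and 2-smoothness adds up their squares. This yields a mean
square of order q b l s^2 from every starting history ([chain_variance]).

The batches of a step start at a random index determined by the previous levels.
Expectations are therefore taken on the events [history] that prescribe finitely
many levels and samples. There are countably many of them; the laws of the next
sample and of the next level on such an event are explicit ([later_sample],
[level_average]), and all quantities of the method are functions of a history.

For the level noise, level a has probability 2^-a, while its correction multiplies
by 2^a batch errors of mean square of order 1 / (2^a B): each of the m levels
contributes 1 / B, whence the term log M ([level_noise_variance]). The largest
batch contributes T / (2^m B), whence the term T / M. *)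

(** * The p-norms and their smoothness *)

Lemma ln_nat_ge0 (R : realType) n : 0 <= (ln n%:R : R).
Proof. by case: n => [|n]; [rewrite ln0|rewrite ln_ge0 // ler1n]. Qed.

Lemma ln2_ge_half (R : realType) : 1 / 2 <= (ln 2 : R).
Proof.
rewrite -[leLHS]expRK ler_ln ?posrE ?expR_gt0 //.
rewrite -[expR _]invrK -expRN -[leRHS]invrK lef_pV2 ?posrE ?invr_gt0 ?expR_gt0//.
by apply: le_trans (expR_ge1Dx _); lra.
Qed.

Section PNorm.
Context (R : realType) (d : nat).
Implicit Types (x y z s : 'rV[R]_d) (p q r : R).

Lemma dotpC x y : dotp x y = dotp y x.
Proof. by apply: eq_bigr => i _; rewrite mulrC. Qed.

Lemma dotpDl x y z : dotp (x + y) z = dotp x z + dotp y z.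
Proof. by rewrite /dotp -big_split; apply: eq_bigr => i _; rewrite mxE mulrDl. Qed.

Lemma dotpDr x y z : dotp z (x + y) = dotp z x + dotp z y.
Proof. by rewrite dotpC dotpDl !(dotpC z). Qed.

Lemma dotpZl (a : R) x y : dotp (a *: x) y = a * dotp x y.
Proof. by rewrite /dotp mulr_sumr; apply: eq_bigr => i _; rewrite mxE mulrA. Qed.

Lemma dotpZr (a : R) x y : dotp y (a *: x) = a * dotp y x.
Proof. by rewrite dotpC dotpZl dotpC. Qed.

Lemma dotpNl x y : dotp (- x) y = - dotp x y.
Proof. by rewrite -scaleN1r dotpZl mulN1r. Qed.

Lemma dotpNr x y : dotp y (- x) = - dotp y x.
Proof. by rewrite dotpC dotpNl dotpC. Qed.

Lemma dotpBl x y z : dotp (x - y) z = dotp x z - dotp y z.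
Proof. by rewrite dotpDl dotpNl. Qed.

Lemma dotpBr x y z : dotp z (x - y) = dotp z x - dotp z y.
Proof. by rewrite dotpDr dotpNr. Qed.

Lemma dotp0l y : dotp 0 y = 0.
Proof. by rewrite /dotp big1 // => i _; rewrite mxE mul0r. Qed.

Lemma dotp_suml (I : Type) (l : seq I) (P : pred I) (f : I -> 'rV[R]_d) y :
  dotp (\sum_(i <- l | P i) f i) y = \sum_(i <- l | P i) dotp (f i) y.
Proof.
by elim/big_rec2: _ => [|i u v _ <-]; rewrite ?dotp0l// dotpDl.
Qed.

Lemma pnormE p x : pnorm p x = (\sum_(i < d) `|x ord0 i| `^ p) `^ p^-1.
Proof. by []. Qed.

#[local] Opaque pnorm.

Lemma pnorm_ge0 p x : 0 <= pnorm p x.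
Proof. rewrite pnormE; exact: powR_ge0. Qed.

Lemma psum_ge0 p x : 0 <= \sum_(i < d) `|x ord0 i| `^ p.
Proof. by apply: sumr_ge0 => i _; exact: powR_ge0. Qed.

Lemma pnorm_powR p x : 0 < p -> pnorm p x `^ p = \sum_(i < d) `|x ord0 i| `^ p.
Proof.
move=> p0; rewrite !pnormE -powRrM mulVf ?gt_eqF// powRr1//; exact: psum_ge0.
Qed.

Lemma pnorm_le p x (c : R) : 0 < p -> 0 <= c ->
  \sum_(i < d) `|x ord0 i| `^ p <= c `^ p -> pnorm p x <= c.
Proof.
move=> p0 c0 h; rewrite !pnormE -[leRHS](powRr1 c0) -(mulfV (lt0r_neq0 p0)) powRrM.
apply: ge0_ler_powR => //; first by rewrite invr_ge0 ltW.
- by rewrite nnegrE psum_ge0.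
- by rewrite nnegrE powR_ge0.
Qed.

Lemma abs_le_pnorm p x i : 0 < p -> `|x ord0 i| <= pnorm p x.
Proof.
move=> p0; rewrite -[leLHS](powRr1 (normr_ge0 _)) -(mulfV (lt0r_neq0 p0)) powRrM.
apply: ge0_ler_powR => //; first by rewrite invr_ge0 ltW.
- by rewrite nnegrE powR_ge0.
- by rewrite nnegrE psum_ge0.
- by rewrite (bigD1 i) //= lerDl sumr_ge0 // => j _; exact: powR_ge0.
Qed.

Lemma pnorm_eq0 p x : 0 < p -> pnorm p x = 0 -> x = 0.
Proof.
move=> p0 h; apply/rowP => i; rewrite mxE; apply/eqP.
by rewrite -normr_eq0 eq_le normr_ge0 andbT -h abs_le_pnorm.
Qed.

Lemma pnorm0 p : 0 < p -> pnorm p (0 : 'rV[R]_d) = 0.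
Proof.
move=> p0; apply/eqP; rewrite eq_le pnorm_ge0 andbT; apply: pnorm_le => //.
by rewrite big1 ?powR_ge0 // => i _; rewrite mxE normr0 powR0 ?gt_eqF.
Qed.

Lemma pnormZ p (a : R) x : 0 < p -> pnorm p (a *: x) = `|a| * pnorm p x.
Proof.
move=> p0; rewrite !pnormE.
under eq_bigr do rewrite mxE normrM powRM//.
rewrite -mulr_sumr powRM ?powR_ge0 ?psum_ge0// -powRrM mulfV ?gt_eqF// powRr1//.
Qed.

Lemma pnormN p x : pnorm p (- x) = pnorm p x.
Proof. by rewrite !pnormE; under eq_bigr do rewrite mxE normrN. Qed.

Lemma pnormC p x y : pnorm p (x - y) = pnorm p (y - x).
Proof. by rewrite -pnormN opprB. Qed.

Lemma pnorm_normalized p x : 0 < p -> pnorm p x != 0 ->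
  \sum_(i < d) (`|x ord0 i| / pnorm p x) `^ p = 1.
Proof.
move=> p0 x0.
under eq_bigr do rewrite powRM ?invr_ge0 ?pnorm_ge0//.
rewrite -mulr_suml -pnorm_powR// -powRM ?pnorm_ge0 ?invr_ge0 ?pnorm_ge0//.
by rewrite mulfV// powR1.
Qed.

Lemma powR_convex r (a u v : R) : 1 <= r -> 0 <= a <= 1 -> 0 <= u -> 0 <= v ->
  (a * u + (1 - a) * v) `^ r <= a * u `^ r + (1 - a) * v `^ r.
Proof.
move=> r1 a01 u0 v0.
have /andP[a0 a1] := a01.
have := @convex_powR R r r1 (Itv01 a0 a1) u v.
rewrite !inE /= !in_itv /= !andbT => /(_ u0 v0).
by rewrite !convRE /=; exact.
Qed.

Lemma pnorm_triangle r x y : 1 <= r ->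
  pnorm r (x + y) <= pnorm r x + pnorm r y.
Proof.
move=> r1; have r0 : 0 < r by apply: lt_le_trans r1.
have [/(pnorm_eq0 r0) ->|A0] := eqVneq (pnorm r x) 0.
  by rewrite pnorm0 // !add0r.
have [/(pnorm_eq0 r0) ->|B0] := eqVneq (pnorm r y) 0.
  by rewrite pnorm0 // !addr0.
have Ap : 0 < pnorm r x by rewrite lt0r A0 pnorm_ge0.
have Bp : 0 < pnorm r y by rewrite lt0r B0 pnorm_ge0.
have hx := pnorm_normalized r0 A0; have hy := pnorm_normalized r0 B0.
move: (pnorm r x) (pnorm r y) A0 B0 Ap Bp hx hy => A B A0 B0 Ap Bp hx hy.
have s0 : 0 < A + B by exact: addr_gt0.
pose a := A / (A + B).
have a0 : 0 <= a by rewrite divr_ge0 ?ltW.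
have a1 : a <= 1 by rewrite /a ler_pdivrMr // mul1r lerDl ltW.
have aA : (A + B) * a = A by rewrite /a mulrC divfK // gt_eqF.
have aB : (A + B) * (1 - a) = B by rewrite mulrBr mulr1 aA addrC addKr.
clearbody a.
apply: pnorm_le => //; first exact: ltW.
apply: (@le_trans _ _ (\sum_(i < d) (A + B) `^ r *
  (a * (`|x ord0 i| / A) `^ r + (1 - a) * (`|y ord0 i| / B) `^ r))).
  apply: ler_sum => i _; rewrite mxE.
  have u0 : 0 <= `|x ord0 i| / A by rewrite divr_ge0 ?normr_ge0 ?ltW.
  have v0 : 0 <= `|y ord0 i| / B by rewrite divr_ge0 ?normr_ge0 ?ltW.
  have w0 : 0 <= a * (`|x ord0 i| / A) + (1 - a) * (`|y ord0 i| / B).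
    by apply: addr_ge0; apply: mulr_ge0; rewrite ?subr_ge0.
  apply: (@le_trans _ _ (((A + B) *
     (a * (`|x ord0 i| / A) + (1 - a) * (`|y ord0 i| / B))) `^ r)).
    apply: ge0_ler_powR; rewrite ?nnegrE ?normr_ge0 ?(ltW r0) //.
      by rewrite mulr_ge0 // ltW.
    apply: (le_trans (ler_normD _ _)); rewrite le_eqVlt; apply/orP; left.
    rewrite mulrDr (mulrA _ a) (mulrA _ (1 - a)) aA aB.
    by apply/eqP; field; rewrite A0 B0.
  rewrite powRM // ?(ltW s0)// ler_wpM2l ?powR_ge0 //.
  by apply: powR_convex => //; rewrite a0 a1.
by rewrite -mulr_sumr big_split /= -!mulr_sumr hx hy !mulr1 subrKC mulr1.
Qed.

Lemma hoelder_dotp p q y z : 0 < p -> 0 < q -> p^-1 + q^-1 = 1 ->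
  dotp y z <= pnorm q y * pnorm p z.
Proof.
move=> p0 q0 pq.
have [/(pnorm_eq0 q0) ->|A0] := eqVneq (pnorm q y) 0.
  by rewrite pnorm0 // mul0r dotp0l.
have [/(pnorm_eq0 p0) ->|B0] := eqVneq (pnorm p z) 0.
  by rewrite pnorm0 // mulr0 dotpC dotp0l.
have Ap : 0 < pnorm q y by rewrite lt0r A0 pnorm_ge0.
have Bp : 0 < pnorm p z by rewrite lt0r B0 pnorm_ge0.
have hy := pnorm_normalized q0 A0; have hz := pnorm_normalized p0 B0.
move: (pnorm q y) (pnorm p z) A0 B0 Ap Bp hy hz => A B A0 B0 Ap Bp hy hz.
apply: (@le_trans _ _ (\sum_(i < d) A * B *
   ((`|z ord0 i| / B) `^ p / p + (`|y ord0 i| / A) `^ q / q))).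
  apply: ler_sum => i _; apply: (le_trans (ler_norm _)); rewrite normrM.
  have := @conjugate_powR R (`|z ord0 i| / B) (`|y ord0 i| / A) p q.
  move=> /(_ _ _ p0 q0 pq) h.
  apply: (@le_trans _ _ (A * B * (`|z ord0 i| / B * (`|y ord0 i| / A)))).
    rewrite le_eqVlt; apply/orP; left; apply/eqP; field.
    by rewrite A0 B0.
  rewrite ler_wpM2l // ?mulr_ge0 ?(ltW Ap) ?(ltW Bp)//.
  by apply: h; rewrite divr_ge0 ?normr_ge0 ?ltW.
by rewrite -mulr_sumr big_split /= -!mulr_suml hy hz !mul1r pq mulr1.
Qed.

(** The equality case of Hoelder's inequality. *)
Lemma norming_functional p q y : 1 < q -> p^-1 + q^-1 = 1 ->
  exists s, pnorm p s <= 1 /\ dotp s y = pnorm q y.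
Proof.
move=> q1 pq; have q0 : 0 < q by apply: lt_trans q1.
have qN0 : q != 0 by rewrite gt_eqF.
have pE : p = q / (q - 1).
  have q10 : q - 1 != 0 by rewrite gt_eqF // subr_gt0.
  have -> : p = (p^-1)^-1 by rewrite invrK.
  have -> : p^-1 = 1 - q^-1 by rewrite -pq addrK.
  by field; rewrite qN0 q10.
have p0 : 0 < p by rewrite pE divr_gt0 // subr_gt0.
have [/(pnorm_eq0 q0) ->|A0] := eqVneq (pnorm q y) 0.
  by exists 0; rewrite !pnorm0 ?ler01 // dotp0l.
have Ap : 0 < pnorm q y by rewrite lt0r A0 pnorm_ge0.
have hy := pnorm_normalized q0 A0.
move: (pnorm q y) A0 Ap hy => A A0 Ap hy.
pose s : 'rV[R]_d := \row_i (Num.sg (y ord0 i) * (`|y ord0 i| / A) `^ (q - 1)).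
have q10 : q - 1 != 0 by rewrite gt_eqF // subr_gt0.
exists s; split.
  apply: pnorm_le => //; rewrite powR1 -hy; apply: ler_sum => i _.
  have qE : q = (q - 1) * p by rewrite pE; field.
  rewrite [X in _ <= _ `^ X]qE powRrM mxE; apply: ge0_ler_powR; rewrite ?nnegrE ?powR_ge0 ?(ltW p0)//.
  rewrite normrM (ger0_norm (powR_ge0 _ _)) normr_sg.
  by case: eqP => /= _; rewrite ?mul0r ?mul1r ?powR_ge0.
rewrite -[RHS]mulr1 -hy mulr_sumr; apply: eq_bigr => i _; rewrite mxE.
rewrite -(@mulr_powRB1 _ _ q) ?divr_ge0 ?normr_ge0 ?(ltW Ap)//.
rewrite mulrAC -normrEsg mulrA.
by congr (_ * _); field.
Qed.

Lemma pnorm_nincr p q z : 0 < p -> p <= q -> pnorm q z <= pnorm p z.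
Proof.
move=> p0 pq; have q0 : 0 < q by apply: lt_le_trans pq.
have [/(pnorm_eq0 p0) ->|A0] := eqVneq (pnorm p z) 0; first by rewrite !pnorm0.
have Ap : 0 < pnorm p z by rewrite lt0r A0 pnorm_ge0.
have hz := pnorm_normalized p0 A0.
have zA i : `|z ord0 i| <= pnorm p z by exact: abs_le_pnorm.
move: (pnorm p z) A0 Ap hz zA => A A0 Ap hz zA.
apply: pnorm_le => //; first exact: ltW.
have -> : A `^ q = \sum_(i < d) A `^ q * (`|z ord0 i| / A) `^ p.
  by rewrite -mulr_sumr hz mulr1.
apply: ler_sum => i _.
have {1}-> : `|z ord0 i| = A * (`|z ord0 i| / A) by field.
rewrite powRM ?(ltW Ap) ?divr_ge0 ?normr_ge0 ?(ltW Ap)//.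
rewrite ler_wpM2l ?powR_ge0 //.
have [->|z0] := eqVneq `|z ord0 i| 0.
  by rewrite mul0r !powR0 ?gt_eqF.
have u0 : 0 < `|z ord0 i| / A by apply: divr_gt0 => //; rewrite lt0r z0 normr_ge0.
have u1 : `|z ord0 i| / A <= 1 by rewrite ler_pdivrMr // mul1r.
by apply: ger_powR => //; rewrite u0 u1.
Qed.

(** Two-point inequality behind the 2-smoothness of the q-norm, with a constant
linear in q. When b is small against a, compare both sides with the exponential
after dividing by a; otherwise the square of a + b and that of a - b are both
dominated by the right-hand base. *)
Lemma two_point q (a b : R) : 2 <= q ->
  (`|a + b| `^ q + `|a - b| `^ q) / 2 <= (a ^+ 2 + 9 * q * b ^+ 2) `^ (q / 2).
Proof.
move=> q2; have q0 : 0 < q by apply: lt_le_trans q2.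
have q20 : 0 <= q / 2 by rewrite divr_ge0 // ltW.
have sqE (u : R) : `|u| `^ q = (u ^+ 2) `^ (q / 2).
  rewrite -real_normK ?num_real// -powR_mulrn// -powRrM.
  by congr (_ `^ _); field.
have b20 : 0 <= b ^+ 2 by exact: sqr_ge0.
have c0 : 0 <= a ^+ 2 + 9 * q * b ^+ 2.
  by rewrite addr_ge0 ?sqr_ge0// mulr_ge0// mulr_ge0// ltW.
(* 8 makes the exponent 4 q t^2 below at most 1/2, where t = b / a *)
have [big|small] := leP (a ^+ 2) (8 * (q * b ^+ 2)).
  have qb : 2 * b ^+ 2 <= q * b ^+ 2 by rewrite ler_wpM2r.
  have h (u : R) : u ^+ 2 <= a ^+ 2 + 9 * q * b ^+ 2 ->
      `|u| `^ q <= (a ^+ 2 + 9 * q * b ^+ 2) `^ (q / 2).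
    by move=> hu; rewrite sqE ge0_ler_powR ?nnegrE ?sqr_ge0.
  have h1 : `|a + b| `^ q <= (a ^+ 2 + 9 * q * b ^+ 2) `^ (q / 2).
    by apply: h; have := sqr_ge0 (a - b); rewrite !expr2 in big qb *; nra.
  have h2 : `|a - b| `^ q <= (a ^+ 2 + 9 * q * b ^+ 2) `^ (q / 2).
    by apply: h; have := sqr_ge0 (a + b); rewrite !expr2 in big qb *; nra.
  by rewrite ler_pdivrMr // mulr_natr mulr2n lerD.
have a0 : a != 0.
  apply: contraTneq small => ->; rewrite -leNgt expr0n /=.
  by rewrite mulr_ge0// mulr_ge0// ltW.
pose t := b / a.
have bE : b = a * t by rewrite /t mulrC divfK.
clearbody t.
have a2 : 0 < a ^+ 2 by rewrite exprn_even_gt0.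
have tq : 8 * (q * t ^+ 2) < 1.
  rewrite -(ltr_pM2l a2) mulr1; apply: le_lt_trans small.
  by rewrite [in leRHS]bE exprMn le_eqVlt; apply/orP; left; apply/eqP; ring.
have t20 : 0 <= t ^+ 2 by exact: sqr_ge0.
have qt : 2 * t ^+ 2 <= q * t ^+ 2 by rewrite ler_wpM2r.
have [t1 t1'] : 0 <= 1 + t /\ 0 <= 1 - t.
  by split; rewrite !expr2 in tq qt t20; nra.
have fac (u : R) : 0 <= u -> `|a * u| `^ q = `|a| `^ q * u `^ q.
  by move=> u0; rewrite normrM powRM ?normr_ge0// (ger0_norm u0).
have -> : a + b = a * (1 + t) by rewrite bE; ring.
have -> : a - b = a * (1 - t) by rewrite bE; ring.
have -> : a ^+ 2 + 9 * q * b ^+ 2 = a ^+ 2 * (1 + 9 * q * t ^+ 2).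
  by rewrite bE exprMn; ring.
have v0 : 0 <= 1 + 9 * q * t ^+ 2.
  by rewrite addr_ge0// mulr_ge0// mulr_ge0// ltW.
rewrite !fac// -mulrDr -mulrA (powRM _ (sqr_ge0 _) v0) -sqE.
rewrite ler_wpM2l ?powR_ge0//.
have up (u : R) : 0 <= 1 + u -> (1 + u) `^ q <= expR (q * u).
  by move=> u0; rewrite mulrC expRM ge0_ler_powR ?nnegrE ?expR_ge0 ?expR_ge1Dx// ltW.
(* hyperbolic cosine against a Gaussian, by exp u <= 1 / (1 - u) near zero *)
have coshb (s : R) : (expR s + expR (- s)) / 2 <= expR (2 * s ^+ 2).
  have inv (u : R) : u < 1 -> expR u <= (1 - u)^-1.
    move=> u1; have u1' : 0 < 1 - u by rewrite subr_gt0.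
    rewrite -[expR u]invrK -expRN lef_pV2 ?posrE ?expR_gt0//.
    exact: expR_ge1Dx.
  have [hs|hs] := lerP `|s| (1 / 2).
    have [s1 s2] : s <= 1 / 2 /\ - s <= 1 / 2.
      by split; apply: le_trans hs; [|rewrite -normrN]; exact: ler_norm.
    have h1 := inv s ltac:(lra); have h2 := inv (- s) ltac:(lra).
    apply: le_trans (expR_ge1Dx _).
    apply: (@le_trans _ _ (((1 - s)^-1 + (1 - - s)^-1) / 2)).
      by rewrite ler_pM2r ?invr_gt0// lerD.
    have -> : ((1 - s)^-1 + (1 - - s)^-1) / 2 = (1 - s ^+ 2)^-1.
      by field; rewrite !expr2; apply/and3P; split; apply: lt0r_neq0; nra.
    have ss : 0 < 1 - s ^+ 2 by rewrite expr2; nra.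
    rewrite -[leLHS]mul1r ler_pdivrMr //.
    have : 0 <= s ^+ 2 by exact: sqr_ge0.
    have : s ^+ 2 <= 1 / 2 by rewrite expr2; nra.
    by move: (s ^+ 2) => w w1 w2; nra.
  have s2 : `|s| <= 2 * s ^+ 2.
    rewrite -(real_normK (num_real s)); move: `|s| hs => w hw.
    by rewrite expr2; nra.
  have h1 : expR s <= expR (2 * s ^+ 2).
    by rewrite ler_expR; apply: le_trans s2; exact: ler_norm.
  have h2 : expR (- s) <= expR (2 * s ^+ 2).
    by rewrite ler_expR; apply: le_trans s2; rewrite -normrN ler_norm.
  by rewrite ler_pdivrMr // mulr_natr mulr2n lerD.
apply: (@le_trans _ _ (expR (2 * (q * t) ^+ 2))).
  apply: le_trans (coshb _); rewrite ler_pM2r ?invr_gt0//.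
  by apply: lerD; [exact: up|rewrite -mulrN; exact: up].
have -> : 2 * (q * t) ^+ 2 = (4 * (q * t ^+ 2)) * (q / 2) by field.
rewrite expRM; apply: ge0_ler_powR; rewrite ?nnegrE ?expR_ge0 //.
have : 4 * (q * t ^+ 2) <= 1 / 2 by lra.
have : 0 <= q * t ^+ 2 by rewrite mulr_ge0 // ltW.
rewrite -mulrA; move: (q * t ^+ 2) => w w0 w1.
rewrite -[expR _]invrK -expRN -[leRHS]invrK lef_pV2 ?posrE ?expR_gt0//; last first.
  by rewrite invr_gt0; nra.
apply: le_trans (expR_ge1Dx _).
by rewrite -[leLHS]mul1r ler_pdivrMr; nra.
Qed.

(** The two-point inequality is summed over coordinates; Minkowski's inequality
in exponent q / 2 for the vectors of squares turns the sum into norms. *)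
Lemma pnorm_two_smooth q x y : 2 <= q ->
  pnorm q (x + y) ^+ 2 + pnorm q (x - y) ^+ 2
    <= 2 * pnorm q x ^+ 2 + 18 * q * pnorm q y ^+ 2.
Proof.
move=> q2; have q0 : 0 < q by apply: lt_le_trans q2.
have r1 : 1 <= q / 2 by rewrite ler_pdivlMr // mul1r.
have r0 : 0 < q / 2 by apply: lt_le_trans r1.
have sqE (u : R) : 0 <= u -> u `^ q = (u ^+ 2) `^ (q / 2).
  by move=> u0; rewrite -powR_mulrn// -powRrM; congr (_ `^ _); field.
pose sq (u : 'rV[R]_d) : 'rV[R]_d := \row_i (u ord0 i ^+ 2).
have sqN u : pnorm (q / 2) (sq u) = pnorm q u ^+ 2.
  rewrite !pnormE.
  have -> : \sum_(i < d) `|sq u ord0 i| `^ (q / 2) = \sum_(i < d) `|u ord0 i| `^ q.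
    apply: eq_bigr => i _; rewrite mxE (ger0_norm (sqr_ge0 _)).
    by rewrite [RHS]sqE // real_normK ?num_real.
  rewrite -powR_mulrn ?powR_ge0// -powRrM; congr (_ `^ _).
  by field; rewrite gt_eqF.
have mink := pnorm_triangle (sq x) ((9 * q) *: sq y) r1.
rewrite pnormZ // !sqN ger0_norm ?mulr_ge0 ?(ltW q0)// in mink.
have P0 := pnorm_ge0 q (x + y); have M0 := pnorm_ge0 q (x - y).
have PE := pnorm_powR (x + y) q0; have ME := pnorm_powR (x - y) q0.
move: (pnorm q (x + y)) (pnorm q (x - y)) P0 M0 PE ME => P M P0 M0 PE ME.
suff key : (P ^+ 2 + M ^+ 2) / 2 <= pnorm (q / 2) (sq x + (9 * q) *: sq y).
  have := le_trans key mink; rewrite ler_pdivrMr // => /le_trans; apply.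
  clear; move: (pnorm q x) (pnorm q y) => X Y.
  by rewrite le_eqVlt; apply/orP; left; apply/eqP; ring.
have avg : ((P ^+ 2 + M ^+ 2) / 2) `^ (q / 2) <=
    pnorm (q / 2) (sq x + (9 * q) *: sq y) `^ (q / 2).
  rewrite pnorm_powR //.
  have cv := @powR_convex (q / 2) (1 / 2) (P ^+ 2) (M ^+ 2) r1.
  have h0 : 0 <= (1 / 2 : R) <= 1 by rewrite divr_ge0 //= ler_pdivrMr // mul1r ler1n.
  have {}cv := cv h0 (sqr_ge0 _) (sqr_ge0 _).
  apply: (@le_trans _ _ ((P `^ q + M `^ q) / 2)).
    have -> : (P ^+ 2 + M ^+ 2) / 2 = 1 / 2 * P ^+ 2 + (1 - 1 / 2) * M ^+ 2.
      by field.
    apply: (le_trans cv); rewrite -!sqE // le_eqVlt; apply/orP; left.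
    by apply/eqP; field.
  rewrite PE ME -big_split /= mulr_suml.
  apply: ler_sum => i _; rewrite !mxE.
  apply: (le_trans (two_point _ _ q2)).
  rewrite ger0_norm // addr_ge0 ?sqr_ge0// mulr_ge0 ?sqr_ge0// mulr_ge0// ltW//.
rewrite -(ler_pXn2r (n := 1)) ?nnegrE ?pnorm_ge0 ?divr_ge0 ?addr_ge0 ?sqr_ge0//.
rewrite !expr1 leNgt; apply/negP => lt.
have := @gt0_ltr_powR _ _ r0 _ _ _ _ lt.
rewrite !nnegrE ltNge avg => h; have := h (pnorm_ge0 _ _).
by rewrite divr_ge0 ?addr_ge0 ?sqr_ge0 // => /(_ isT).
Qed.

(** First-order form of 2-smoothness: x is the midpoint of x + y and x - y, and
the norming functional s of x bounds the norm of x - y from below. *)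
Lemma pnorm_sqr_smooth q x : 2 <= q -> exists s, [/\
  forall y, dotp s y <= pnorm q y, dotp s x = pnorm q x &
  forall y, pnorm q (x + y) ^+ 2 <=
     pnorm q x ^+ 2 + 2 * pnorm q x * dotp s y + 18 * q * pnorm q y ^+ 2].
Proof.
move=> q2; have q1 : 1 < q by apply: lt_le_trans q2; rewrite ltr1n.
have q0 : 0 < q by apply: lt_trans q1.
have pq : (q / (q - 1))^-1 + q^-1 = 1.
  by field; rewrite !gt_eqF // subr_gt0.
have p0 : 0 < q / (q - 1) by rewrite divr_gt0 // subr_gt0.
have [s [s1 sx]] := norming_functional x q1 pq.
have sN y : dotp s y <= pnorm q y.
  rewrite dotpC; apply: (le_trans (hoelder_dotp y s p0 q0 pq)).
  by rewrite ler_piMr ?pnorm_ge0.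
exists s; split=> // y.
have sm := pnorm_two_smooth x y q2.
have h := sN (x - y); rewrite dotpBr sx in h.
move: h sm (pnorm_ge0 q x) (pnorm_ge0 q (x - y)).
move: (pnorm q x) (pnorm q (x - y)) (pnorm q (x + y)) (dotp s y) => X' M P D.
move: (18 * q * _) => W h sm X0 M0.
have : 0 <= (M - X') ^+ 2 by exact: sqr_ge0.
have : X' * (X' - D) <= X' * M by rewrite ler_wpM2l.
clear -h sm X0 M0 => h1 h2.
by rewrite !expr2 in sm h2; lra.
Qed.

Lemma dual_pnorm_has_ubound p y : 0 < p ->
  has_ubound [set dotp y z | z in [set z | pnorm p z <= 1]].
Proof.
move=> p0; exists (\sum_(i < d) `|y ord0 i|) => _ [z /= z1 <-].
apply: ler_sum => i _; apply: (le_trans (ler_norm _)); rewrite normrM.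
by rewrite ler_piMr // (le_trans (abs_le_pnorm z i p0)).
Qed.

Lemma dotp_le_dual p y z : 0 < p -> dotp y z <= dual_pnorm p y * pnorm p z.
Proof.
move=> p0; have [/(pnorm_eq0 p0) ->|A0] := eqVneq (pnorm p z) 0.
  by rewrite pnorm0 // mulr0 dotpC dotp0l.
have Ap : 0 < pnorm p z by rewrite lt0r A0 pnorm_ge0.
rewrite -ler_pdivrMr // mulrC -dotpZr; apply: ub_le_sup.
  exact: dual_pnorm_has_ubound.
exists ((pnorm p z)^-1 *: z) => //=.
by rewrite pnormZ // ger0_norm ?invr_ge0 ?pnorm_ge0// mulVf.
Qed.

Lemma dual_pnorm_ge0 p y : 0 < p -> 0 <= dual_pnorm p y.
Proof.
move=> p0; apply: ub_le_sup; first exact: dual_pnorm_has_ubound.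
by exists 0; rewrite /= ?pnorm0 // dotpC dotp0l.
Qed.

Lemma abs_le_dual p y i : 0 < p -> `|y ord0 i| <= dual_pnorm p y.
Proof.
move=> p0.
pose z : 'rV[R]_d := \row_j (if j == i then Num.sg (y ord0 i) else 0).
have zE : \sum_(j < d) `|z ord0 j| `^ p <= 1.
  rewrite (bigD1 i) //= mxE eqxx big1 ?addr0 => [|j ji]; last first.
    by rewrite mxE (negPf ji) normr0 powR0 ?gt_eqF.
  rewrite normr_sg; case: (_ != 0); first by rewrite powR1.
  by rewrite powR0 ?gt_eqF.
have -> : `|y ord0 i| = dotp y z.
  rewrite /dotp (bigD1 i) //= mxE eqxx big1 ?addr0 => [|j ji]; last first.
    by rewrite mxE (negPf ji) mulr0.
  by rewrite normrEsg mulrC.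
apply: ub_le_sup; first exact: dual_pnorm_has_ubound.
by exists z => //=; apply: pnorm_le => //; rewrite powR1.
Qed.

(** Passage from the dual norm to a q-norm with q of order log d. If the
exponent conjugate to p is at most 2 + 2 log d, take it. Otherwise take
q = 2 + 2 log d: as d <= 2 ^ q, the q-norm is at most twice the maximum norm, which
is below the dual norm; and the exponent conjugate to q is at least p, so that its
norm is below the p-norm. *)
Lemma smooth_surrogate p : 1 <= p <= 2 -> exists q, [/\ 2 <= q,
  q <= 2 * (1 + ln d%:R),
  (forall y z, dotp y z <= pnorm q y * pnorm p z) &
  (forall y, pnorm q y <= 2 * dual_pnorm p y)].
Proof.
move=> /andP[p1 p2]; have p0 : 0 < p by apply: lt_le_trans p1.
have ld := ln_nat_ge0 R d.
pose q0 : R := 2 * (1 + ln d%:R).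
have q02 : 2 <= q0 by rewrite /q0; lra.
have [pq|pq] := leP (1 - q0^-1) p^-1; last first.
  (* here p > 1 and the conjugate exponent of p is at most q0 *)
  have q0p : 0 < q0 by apply: lt_le_trans q02.
  have vq0 : 0 < q0^-1 by rewrite invr_gt0.
  have pV1 : 0 < 1 - p^-1 by lra.
  have p1' : 1 < p.
    rewrite lt_neqAle p1 andbT eq_sym; apply: contraTneq pV1 => ->.
    by rewrite invr1 subrr ltxx.
  exists (1 - p^-1)^-1.
  have conj : p^-1 + ((1 - p^-1)^-1)^-1 = 1 by rewrite invrK; ring.
  have pV2 : 1 / 2 <= p^-1 by rewrite div1r lef_pV2 ?posrE.
  have q2 : 2 <= (1 - p^-1)^-1.
    by rewrite -[leLHS]invrK lef_pV2 ?posrE ?invr_gt0 //; lra.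
  have qp : 0 < (1 - p^-1)^-1 by rewrite invr_gt0.
  split => //.
  - by rewrite -[leRHS]invrK lef_pV2 ?posrE //; rewrite -/q0; lra.
  - by move=> y z; apply: hoelder_dotp.
  - move=> y; have q1 : 1 < (1 - p^-1)^-1 by apply: lt_le_trans q2; rewrite ltr1n.
    have [s [s1 <-]] := norming_functional y q1 conj.
    have h : dotp s y <= dual_pnorm p y.
      rewrite dotpC; apply: (le_trans (dotp_le_dual _ _ p0)).
      by rewrite ler_piMr // dual_pnorm_ge0.
    by have := dual_pnorm_ge0 y p0; lra.
have q0p : 0 < q0 by apply: lt_le_trans q02.
have vq0 : q0^-1 <= 1 / 2 by rewrite div1r lef_pV2 ?posrE.
exists q0; split => //.
  move=> y z; have r0 : 0 < (1 - q0^-1)^-1 by rewrite invr_gt0; lra.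
  apply: (@le_trans _ _ (pnorm q0 y * pnorm (1 - q0^-1)^-1 z)).
    by apply: hoelder_dotp => //; rewrite invrK; ring.
  apply: ler_wpM2l; first exact: pnorm_ge0.
  apply: pnorm_nincr; first exact: p0.
  by rewrite -[leLHS]invrK lef_pV2 ?posrE ?invr_gt0 //; lra.
move=> y; have D0 := dual_pnorm_ge0 y p0.
apply: pnorm_le => //; first by rewrite mulr_ge0.
apply: (@le_trans _ _ (\sum_(i < d) dual_pnorm p y `^ q0)).
  by apply: ler_sum => i _; rewrite ge0_ler_powR ?nnegrE ?(ltW q0p)// abs_le_dual.
rewrite sumr_const card_ord powRM // -[leLHS]mulr_natl ler_wpM2r ?powR_ge0 //.
have [->|d0] := eqVneq d 0%N; first exact: powR_ge0.
have d1 : 0 < (d%:R : R) by rewrite ltr0n lt0n.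
have p2q : 0 < (2 : R) `^ q0 by exact: powR_gt0.
rewrite -ler_ln ?posrE // ln_powR.
by have l2 := ln2_ge_half R; rewrite /q0; nra.
Qed.

End PNorm.

(** * Compact convex sets of row vectors *)

Section NormedRows.
Context (R : realType) (d : nat).
Implicit Types (a b x y : 'rV[R]_d) (X : set 'rV[R]_d).

Lemma coord_le_norm x i : `|x ord0 i| <= `|x|.
Proof.
rewrite [leRHS]mx_normrE.
by apply: (@le_trans _ _ `|x (ord0, i).1 (ord0, i).2|) => //; exact: le_bigmax.
Qed.

Lemma abs_dotp_le a b : `|dotp a b| <= d%:R * (`|a| * `|b|).
Proof.
apply: (le_trans (ler_norm_sum _ _ _)).
have -> : d%:R * (`|a| * `|b|) = \sum_(i < d) `|a| * `|b|.
  by rewrite sumr_const card_ord mulr_natl.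
apply: ler_sum => i _.
by rewrite normrM ler_pM ?coord_le_norm.
Qed.

Lemma lipschitz_within_continuous X (f : 'rV[R]_d -> R) (k : R) : 0 <= k ->
  (forall x y, X x -> X y -> `|f x - f y| <= k * `|x - y|) ->
  {within X, continuous f}.
Proof.
move=> k0 lip; apply/subspace_continuousP => x Xx.
apply/cvgrPdist_lt => e e0; rewrite near_withinE.
have d0 : 0 < e / (k + 1) by rewrite divr_gt0 // ltr_wpDl.
apply/nbhs_ballP; exists (e / (k + 1)) => //= y; rewrite -ball_normE /= => xy Xy.
apply: (le_lt_trans (lip _ _ Xx Xy)).
have k1 : 0 < k + 1 by rewrite ltr_wpDl.
rewrite ltr_pdivlMr // in xy; apply: le_lt_trans xy.
by rewrite mulrC ler_wpM2l // lerDl.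
Qed.

Lemma within_continuous_delta X (f : 'rV[R]_d -> 'rV[R]_d) x (e : R) :
  {within X, continuous f} -> X x -> 0 < e -> exists2 r : R, 0 < r &
    forall y, X y -> `|x - y| < r -> `|f x - f y| < e.
Proof.
move=> /subspace_continuousP cf Xx e0.
have /cvgrPdist_lt/(_ _ e0) := cf _ Xx; rewrite near_withinE.
move=> /nbhs_ballP[r /= r0 h]; exists r => // y Xy xy.
by apply: h => //; rewrite -ball_normE.
Qed.

Lemma compact_norm_bounded X : compact X -> exists2 k : R, 0 <= k &
  forall x, X x -> `|x| <= k.
Proof.
move=> /compact_bounded[k [_ h]]; exists (`|k| + 1); first by rewrite addr_ge0.
by move=> x Xx; apply: h => //; rewrite (le_lt_trans (ler_norm k)) // ltrDl.
Qed.

Lemma convex_set_mem X x y (t : R) : @convex_set R _ X -> X x -> X y ->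
  0 <= t <= 1 -> X (t *: x + (1 - t) *: y).
Proof.
move=> cX Xx Xy /andP[t0 t1].
by have := cX x y (Itv01 t0 t1); rewrite !inE => /(_ Xx Xy).
Qed.

End NormedRows.

(** * Bregman divergences and prox steps *)

Section Prox.
Context (R : realType) (d : nat) (p : R).
Context (X : set 'rV[R]_d) (w : 'rV[R]_d -> \bar R) (dw : 'rV[R]_d -> 'rV[R]_d).
Hypotheses (hXcompact : compact X) (hXconvex : @convex_set R _ X).
Hypothesis (hw : distance_generating p X w dw).
Implicit Types (x y u xi : 'rV[R]_d).

Local Notation W := (fun x => fine (w x)).
Local Notation V := (bregman w dw).

Lemma dgf_fineK x : X x -> w x = (W x)%:E.
Proof.
by have [_ _ _ [_ sd _]] := hw; move=> /sd[wx _]; rewrite fineK.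
Qed.

Lemma dgf_subgradient x y : X x -> X y -> W x + dotp (dw x) (y - x) <= W y.
Proof.
move=> Xx Xy; have [_ _ _ [_ sd _]] := hw; have [_ /(_ y)] := sd _ Xx.
by rewrite (dgf_fineK Xx) (dgf_fineK Xy) /= -EFinD lee_fin.
Qed.

(** Strong convexity along the segment from x to y, with the subgradient
inequality at x, gives the bound up to a factor 1 - t for every t > 0. *)
Lemma bregman_ge x y : X x -> X y -> pnorm p (x - y) ^+ 2 / 2 <= V x y.
Proof.
move=> Xx Xy; have [_ _ _ [sc _ _]] := hw.
pose n := pnorm p (x - y) ^+ 2; have n0 : 0 <= n by exact: sqr_ge0.
have key (t : R) : 0 < t <= 1 -> (1 - t) * (n / 2) <= V x y.
  move=> /andP[t0 t1]; have t01 : 0 <= t <= 1 by rewrite ltW.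
  have := sc y x t Xy Xx t01; have Xm := convex_set_mem hXconvex Xy Xx t01.
  rewrite (dgf_fineK Xx) (dgf_fineK Xy) (dgf_fineK Xm).
  rewrite -!EFinM -!EFinD lee_fin pnormC -/n => h.
  have sg := dgf_subgradient Xx Xm.
  have mE : t *: y + (1 - t) *: x - x = t *: (y - x).
    by rewrite scalerBl scale1r scalerBr -addrA addrAC subrr add0r.
  rewrite mE dotpZr in sg; rewrite /bregman -(ler_pM2l t0).
  move: h sg; clear.
  move: (W _) (W x) (W y) (dotp _ _) n => a b c e n h sg; lra.
rewrite -/n; apply/ler_addgt0Pr => e e0.
have [n1|n1] := eqVneq n 0.
  have := key 1; rewrite n1 ltr01 lexx subrr !mul0r => /(_ isT) h.
  by rewrite ler_wpDl // ?ltW // addr_ge0 // ltW.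
pose t := Num.min 1 (e / n); have n2 : 0 < n by rewrite lt0r n1.
have t0 : 0 < t by rewrite lt_min ltr01 divr_gt0.
have t1 : t <= 1 by rewrite ge_min lexx.
have tn : t * n <= e by rewrite -ler_pdivlMr // ge_min lexx orbT.
have := key t; rewrite t0 t1 => /(_ isT).
move=> h; apply: (@le_trans _ _ (n / 2)) => //.
have -> : n / 2 = (1 - t) * (n / 2) + t * n / 2 by field.
apply: lerD => //; apply: le_trans tn; rewrite ler_pdivrMr // ler_peMr ?ler1n //.
by rewrite mulr_ge0 // ltW.
Qed.

Lemma bregman_ge0 x y : X x -> X y -> 0 <= V x y.
Proof.
by move=> Xx Xy; apply: le_trans (bregman_ge Xx Xy); rewrite divr_ge0 ?sqr_ge0.
Qed.

Lemma dgf_gradient_bounded : exists2 k : R, 0 <= k & forall x, X x -> `|dw x| <= k.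
Proof.
have [_ _ _ [_ _ cdw]] := hw.
have [k k0 h] := compact_norm_bounded (continuous_compact cdw hXcompact).
by exists k => // x Xx; apply: h; exists x.
Qed.

(** Adding the subgradient inequality at the other endpoint bounds V by a pairing
with a difference of subgradients, which are bounded as a continuous image of a
compact set. *)
Lemma bregman_has_ubound : has_ubound [set V xy.1 xy.2 | xy in X `*` X].
Proof.
have [k k0 hk] := dgf_gradient_bounded.
have [r r0 hr] := compact_norm_bounded hXcompact.
exists (d%:R * ((k + k) * (r + r))) => _ [[x y] /= [Xx Xy] <-].
have sg := dgf_subgradient Xy Xx.
apply: (@le_trans _ _ (dotp (dw y - dw x) (y - x))).
  rewrite /bregman; move: sg; rewrite -(opprB y x) dotpNr dotpBl; clear.
  by move: (W x) (W y) (dotp _ _) (dotp _ _) => *; lra.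
apply: (le_trans (ler_norm _)); apply: (le_trans (abs_dotp_le _ _)).
rewrite ler_wpM2l // ler_pM //.
  by apply: (le_trans (ler_normB _ _)); rewrite lerD // hk.
by apply: (le_trans (ler_normB _ _)); rewrite lerD // hr.
Qed.

Lemma bregman_le_diam2 x y : X x -> X y -> V x y <= bregman_diam2 X w dw.
Proof.
move=> Xx Xy; apply: ub_le_sup; first exact: bregman_has_ubound.
by exists (x, y).
Qed.

(** The subgradients being bounded on X, the objective is Lipschitz there, and
compactness provides a minimizer. *)
Lemma prox_minimizes x xi : X x -> X (prox X w dw x xi) /\
  forall y, X y -> V x (prox X w dw x xi) + dotp xi (prox X w dw x xi)
                     <= V x y + dotp xi y.
Proof.
move=> Xx; have [k k0 hk] := dgf_gradient_bounded.
have Wlip y z : X y -> X z -> W y - W z <= d%:R * (k * `|y - z|).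
  move=> Xy Xz; apply: (@le_trans _ _ (dotp (dw y) (y - z))).
    have := dgf_subgradient Xy Xz; rewrite -(opprB y z) dotpNr; clear.
    by move: (W y) (W z) (dotp _ _) => *; lra.
  apply: (le_trans (ler_norm _)); apply: (le_trans (abs_dotp_le _ _)).
  by rewrite ler_wpM2l // ler_wpM2r // hk.
pose f y := V x y + dotp xi y.
have fc : {within X, continuous f}.
  have K0 : 0 <= d%:R * (k + (k + `|xi|)).
    by rewrite mulr_ge0 // addr_ge0 // addr_ge0.
  apply: (lipschitz_within_continuous K0) => y z Xy Xz.
  have -> : f y - f z = (W y - W z) + dotp (xi - dw x) (y - z).
    by rewrite /f /bregman dotpBl !dotpBr; ring.
  apply: (le_trans (ler_normD _ _)).
  rewrite -mulrA mulrDl mulrDr; apply: lerD.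
    rewrite ler_norml; apply/andP; split; last exact: Wlip.
    by rewrite lerNl opprB distrC Wlip.
  apply: (le_trans (abs_dotp_le _ _)).
  rewrite ler_wpM2l // ler_wpM2r // [leRHS]addrC.
  by apply: (le_trans (ler_normB _ _)); rewrite lerD2l hk.
have X0 : X !=set0 by exists x.
have [c cX cmin] := EVT_min_rV X0 hXcompact fc.
have ex : [set y | X y /\ forall y', X y' ->
    V x y + dotp xi y <= V x y' + dotp xi y'] c.
  split; first by rewrite inE in cX.
  by move=> y Xy; apply: cmin; rewrite inE.
by rewrite /prox; case: (xgetPex x (ex_intro _ c ex)).
Qed.

Lemma prox_in x xi : X x -> X (prox X w dw x xi).
Proof. by move=> Xx; have [] := prox_minimizes xi Xx. Qed.

(** First-order optimality of the prox step. Moving from the minimizer y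
towards u and using the subgradient at the displaced point gives the inequality
with the gradient there; continuity of the selection moves it back to y. *)
Lemma prox_first_order x xi u y : X x -> X u -> y = prox X w dw x xi ->
  0 <= dotp (xi - dw x + dw y) (u - y).
Proof.
move=> Xx Xu yE; have [Xy ymin] := prox_minimizes xi Xx; rewrite -yE in Xy ymin.
have [_ _ _ [_ _ cdw]] := hw.
have key (s : R) : 0 < s <= 1 ->
    0 <= dotp (xi - dw x + dw (s *: u + (1 - s) *: y)) (u - y).
  move=> /andP[s0 s1]; have s01 : 0 <= s <= 1 by rewrite ltW.
  have Xs := convex_set_mem hXconvex Xu Xy s01.
  have h1 := ymin _ Xs; have h2 := dgf_subgradient Xs Xy.
  have sE : s *: u + (1 - s) *: y = y + s *: (u - y).
    by rewrite scalerBl scale1r scalerBr addrCA.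
  rewrite sE in h1 h2 *; rewrite -(pmulr_rge0 _ s0) -dotpZr.
  have e1 : y - (y + s *: (u - y)) = - (s *: (u - y)) by rewrite opprD addNKr.
  rewrite e1 dotpNr in h2; rewrite dotpDl dotpBl.
  move: h1 h2; rewrite /bregman !dotpBr !dotpDr; clear.
  move: (W _) (W _) (W _) (dotp _ (_ *: _)) (dotp _ (_ *: _)) (dotp _ (_ *: _)).
  by move: (dotp _ _) (dotp _ _) (dotp _ _) => *; lra.
rewrite leNgt; apply/negP => neg.
pose c := - dotp (xi - dw x + dw y) (u - y).
have c0 : 0 < c by rewrite /c oppr_gt0.
pose m := `|u - y|; have m0 : 0 <= m by exact: normr_ge0.
pose e := c / (d%:R * m + 1).
have dm0 : 0 < d%:R * m + 1 by rewrite ltr_wpDl // mulr_ge0.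
have e0 : 0 < e by rewrite divr_gt0.
have [r r0 hr] := within_continuous_delta cdw Xy e0.
pose s := Num.min 1 (r / (m + 1)).
have m1 : 0 < m + 1 by rewrite ltr_wpDl.
have s0 : 0 < s by rewrite lt_min ltr01 divr_gt0.
have s1 : s <= 1 by rewrite ge_min lexx.
have sr : s * m < r.
  have : s * (m + 1) <= r by rewrite -ler_pdivlMr // ge_min lexx orbT.
  by apply: lt_le_trans; rewrite ltr_pM2l // ltrDl ltr01.
have s01 : 0 <= s <= 1 by rewrite ltW.
have Xs := convex_set_mem hXconvex Xu Xy s01.
have := hr _ Xs; rewrite scalerBl scale1r.
have -> : y - (s *: u + (y - s *: y)) = - (s *: (u - y)).
  by rewrite scalerBr addrCA opprD addNKr.
rewrite normrN normrZ gtr0_norm // => /(_ sr) hdw.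
have := key s; rewrite s0 s1 => /(_ isT); rewrite scalerBl scale1r leNgt.
move/negP; apply.
set z := s *: u + _ in hdw *.
have -> : xi - dw x + dw z = (xi - dw x + dw y) + (dw z - dw y).
  by rewrite -[RHS]addrA [dw y + _]addrC subrK.
rewrite dotpDl -[X in X + _]opprK -/c addrC subr_lt0.
apply: (le_lt_trans (ler_norm _)); apply: (le_lt_trans (abs_dotp_le _ _)).
rewrite -/m distrC.
apply: (@le_lt_trans _ _ (d%:R * m * e)).
  by rewrite -mulrA ler_wpM2l // mulrC ler_wpM2l // ltW.
by rewrite /e mulrA ltr_pdivrMr // mulrC ltr_pM2l // ltrDl ltr01.
Qed.

Lemma prox_three_point x xi u y : X x -> X u -> y = prox X w dw x xi ->
  dotp xi (y - u) <= V x u - V y u - V x y.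
Proof.
move=> Xx Xu yE; have := prox_first_order Xx Xu yE.
rewrite /bregman !dotpDl !dotpNl !dotpBr; clear.
move: (W _) (W _) (W _) (dotp _ _) (dotp _ _) (dotp _ _) (dotp _ _).
by move: (dotp _ _) (dotp _ _) (dotp _ _)=> *; lra.
Qed.

End Prox.

(** * Regret along a trajectory *)

(** The reals a and c stand for the lengths of the two displacements of a step and
n for the norm of the noise; with g L <= 1/2, the Lipschitz error is absorbed by
half the squares of the displacements, hence by two Bregman divergences. *)
Lemma absorb_lipschitz (R : realType) (g L a c n : R) :
  0 <= g -> g * L <= 1 / 2 -> 0 <= a -> 0 <= c -> 0 <= n ->
  g * ((n + L * a) * c) <= g ^+ 2 * n ^+ 2 + a ^+ 2 / 2 + c ^+ 2 / 2.
Proof.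
move=> g0 gL a0 c0 n0.
have h1 : g * L * a * c <= 1 / 2 * a * c.
  by rewrite ler_wpM2r // ler_wpM2r.
have h2 : 0 <= (c - (g * n + a / 2)) ^+ 2 by exact: sqr_ge0.
have h3 : 0 <= (g * n - a / 2) ^+ 2 by exact: sqr_ge0.
have h4 : 0 <= a ^+ 2 by exact: sqr_ge0.
by rewrite !expr2 in h2 h3 h4 *; lra.
Qed.

Lemma sqr_sum3_le (R : realType) (a b c : R) :
  (a + b + c) ^+ 2 <= 3 * a ^+ 2 + 3 * b ^+ 2 + 3 * c ^+ 2.
Proof.
have h1 := sqr_ge0 (a - b); have h2 := sqr_ge0 (b - c).
have h3 := sqr_ge0 (a - c).
by rewrite !expr2 in h1 h2 h3 *; lra.
Qed.

Lemma mul_le_sqr_half (R : realType) (a b : R) : a * b <= a ^+ 2 / 2 + b ^+ 2 / 2.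
Proof. by have h := sqr_ge0 (a - b); rewrite !expr2 in h *; lra. Qed.

#[local] Opaque dotp pnorm dual_pnorm bregman prox bregman_diam2.

Lemma scaled_young_weighted (R : realType) (T g n c D : R) : 0 < T -> 0 <= g ->
  D <= n * c -> g * D <= T * (g ^+ 2 * n ^+ 2) / 2 + c ^+ 2 / 2 / T.
Proof.
move=> T0 g0 Dnc; apply: (le_trans (ler_wpM2l g0 Dnc)).
rewrite [leLHS]mulrA -(ler_pM2l T0) [leLHS]mulrA.
apply: (le_trans (mul_le_sqr_half (T * (g * n)) c)).
by rewrite le_eqVlt; apply/orP; left; apply/eqP; field; rewrite gt_eqF.
Qed.

Lemma scaled_young (R : realType) (g n c D : R) : 0 <= g ->
  D <= n * c -> g * D <= g ^+ 2 * n ^+ 2 / 2 + c ^+ 2 / 2.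
Proof.
move=> g0 Dnc; have := scaled_young_weighted ltr01 g0 Dnc.
by rewrite mul1r divr1.
Qed.

Lemma step_arith (R : realType) (fu a1 a2 a3 a4 a5 a6 a7 g2 S nx nb ne T : R)
    (vxu vpu vyu vqu vxp vhp vxh vyq r3 w1 w2 c1 c2 c3 : R) :
  fu <= a1 + a2 + a3 + a4 + a5 + a6 + a7 ->
  a1 <= vxu - vpu - vxp -> a2 <= vxp - vhp - vxh -> a4 <= vyu - vqu - vyq ->
  a3 <= r3 -> r3 <= g2 * S + c1 / 2 + c2 / 2 ->
  a5 <= g2 * nx / 2 + c3 / 2 -> a7 <= T * (g2 * nb) / 2 + w1 -> w1 <= w2 ->
  g2 * S <= 3 * g2 * nx + 3 * g2 * nb + 3 * g2 * ne ->
  c1 / 2 <= vxh -> c2 / 2 <= vhp -> c3 / 2 <= vyq -> 0 <= g2 * nx ->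
  fu <= (vxu - vpu) + (vyu - vqu) + w2 +
    (4 * g2 * nx + (3 + T / 2) * g2 * nb + 3 * g2 * ne + a6).
Proof. by move=> *; lra. Qed.

Section Path.
Context (R : realType) (d : nat) (p q : R).
Hypothesis hp : 1 <= p <= 2.
Hypothesis q1 : 1 <= q.
Hypothesis hpq : forall y z : 'rV[R]_d, dotp y z <= pnorm q y * pnorm p z.
Context (X : set 'rV[R]_d) (w : 'rV[R]_d -> \bar R) (dw : 'rV[R]_d -> 'rV[R]_d).
Hypotheses (hXcompact : compact X) (hXconvex : @convex_set R _ X).
Hypothesis (hw : distance_generating p X w dw).
Context (F : 'rV[R]_d -> 'rV[R]_d) (L gamma : R).
Hypotheses (hL : 0 < L) (hlip : lipschitz_pnorm_on p L X F).
Hypothesis hmono : monotone_on X F.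
Hypotheses (hgamma : 0 < gamma) (hgammaL : gamma <= 1 / (2 * L)).
Local Notation V := (bregman w dw).
Local Notation D2 := (bregman_diam2 X w dw).
Local Notation N := (pnorm q).

Let p0 : 0 < p. Proof. by have /andP[p1 _] := hp; apply: lt_le_trans p1. Qed.

Let gL : gamma * L <= 1 / 2.
Proof.
have L2 : 0 < 2 * L by rewrite mulr_gt0.
have := hgammaL; rewrite ler_pdivlMr // mulrCA => h.
by rewrite ler_pdivlMr // mulrC.
Qed.

(** One step of the method runs in parallel with one step of the auxiliary
sequence y, driven by the opposite of xi. Replacing u by y in the product with xi
removes its dependence on u; the price is the telescoping divergence of y and a
square of xi. The remaining error gm - F h keeps its product with u, which Young's
inequality with weight T bounds by a divergence over T. *)
Lemma mirror_prox_step_bound (x y gh g gm u h xi xp yp : 'rV[R]_d) (T : R) :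
  X x -> X y -> X u -> 0 < T ->
  h = prox X w dw x (gamma *: gh) -> xi = g - gm ->
  xp = prox X w dw x (gamma *: g) -> yp = prox X w dw y (- gamma *: xi) ->
  gamma * dotp (F u) (h - u) <=
    (V x u - V xp u) + (V y u - V yp u)
    + D2 / T
    + (4 * gamma ^+ 2 * N xi ^+ 2
       + (3 + T / 2) * gamma ^+ 2 * N (gm - F h) ^+ 2
       + 3 * gamma ^+ 2 * N (gh - F x) ^+ 2
       + gamma * dotp xi (y - h)).
Proof.
move=> Xx Xy Xu T0 hE xiE xpE ypE.
have Xh : X h by rewrite hE; exact: (prox_in hXcompact hw).
have Xp : X xp by rewrite xpE; exact: (prox_in hXcompact hw).
have Yp : X yp by rewrite ypE; exact: (prox_in hXcompact hw).
have tp := prox_three_point hXcompact hXconvex hw.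
have r1 : gamma * dotp g (xp - u) <= V x u - V xp u - V x xp.
  by rewrite -dotpZl; exact: tp.
have r2 : gamma * dotp gh (h - xp) <= V x xp - V h xp - V x h.
  by rewrite -dotpZl; exact: tp.
have r3 : - gamma * dotp xi (yp - u) <= V y u - V yp u - V y yp.
  by rewrite -dotpZl; exact: tp.
have vge := bregman_ge hXconvex hw.
have v1 := vge _ _ Xx Xh; have v2 := vge _ _ Xh Xp.
have v3 := vge _ _ Xy Yp; have v4 := vge _ _ Xh Xu.
have vd := bregman_le_diam2 hXcompact hw Xh Xu.
have mono : dotp (F u) (h - u) <= dotp (F h) (h - u).
  by rewrite -subr_ge0 -dotpBl; exact: hmono.
have [b bE] : exists b, b = gm - F h by exists (gm - F h).
have [e eE] : exists e, e = gh - F x by exists (gh - F x).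
rewrite -bE -eE.
have noise : N (xi + b - e) <= N xi + N b + N e.
  apply: (le_trans (pnorm_triangle _ _ q1)); rewrite pnormN lerD2r.
  exact: pnorm_triangle.
have r4 : gamma * dotp (g - gh) (h - xp) <=
    gamma * ((N xi + N b + N e + L * pnorm p (x - h)) * pnorm p (h - xp)).
  apply: ler_wpM2l; first exact: ltW.
  have -> : g - gh = (xi + b - e) + (F h - F x).
    rewrite xiE bE eE; apply/rowP => i; rewrite !mxE; clear.
    by move: (g _ _) (gh _ _) (gm _ _) (F h _ _) (F x _ _) => *; ring.
  rewrite dotpDl mulrDl; apply: lerD.
    by apply: (le_trans (hpq _ _)); rewrite ler_wpM2r ?pnorm_ge0.
  apply: (le_trans (dotp_le_dual _ _ p0)); apply: ler_wpM2r; first exact: pnorm_ge0.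
  by rewrite pnormC; exact: hlip.
have r5 := absorb_lipschitz (ltW hgamma) gL (pnorm_ge0 p (x - h))
  (pnorm_ge0 p (h - xp)) (addr_ge0 (addr_ge0 (pnorm_ge0 q xi) (pnorm_ge0 q b))
  (pnorm_ge0 q e)).
have r6 := sqr_sum3_le (N xi) (N b) (N e).
have d7 : dotp xi (yp - y) <= N xi * pnorm p (y - yp) by rewrite pnormC; exact: hpq.
have r7 := scaled_young (ltW hgamma) d7.
have d8 : dotp b (u - h) <= N b * pnorm p (h - u) by rewrite pnormC; exact: hpq.
have r8 := scaled_young_weighted T0 (ltW hgamma) d8.
have r9 : (pnorm p (h - u) ^+ 2 / 2) / T <= D2 / T.
  by rewrite ler_pM2r ?invr_gt0 //; exact: le_trans v4 vd.
have r10 : gamma ^+ 2 * (N xi + N b + N e) ^+ 2 <=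
    gamma ^+ 2 * (3 * N xi ^+ 2 + 3 * N b ^+ 2 + 3 * N e ^+ 2).
  by apply: ler_wpM2l; first exact: sqr_ge0.
have mono' : gamma * dotp (F u) (h - u) <= gamma * dotp (F h) (h - u).
  by apply: ler_wpM2l; first exact: ltW.
(* F h is g minus the two noises, and h - u passes through xp, yp and y *)
have dec : gamma * dotp (F h) (h - u) = gamma * dotp g (xp - u)
    + gamma * dotp gh (h - xp) + gamma * dotp (g - gh) (h - xp)
    + (- gamma * dotp xi (yp - u)) + gamma * dotp xi (yp - y)
    + gamma * dotp xi (y - h) + gamma * dotp b (u - h).
  have -> : F h = g - xi - b by rewrite xiE bE !opprB !subrKC.
  rewrite !dotpBl !dotpBr; clear.
  move: (dotp _ _) (dotp _ _) (dotp _ _) (dotp _ _) (dotp _ _).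
  move: (dotp _ _) (dotp _ _) (dotp _ _) (dotp _ _) (dotp _ _) (dotp _ _).
  move=> *; ring.
have r10' : gamma ^+ 2 * (N xi + N b + N e) ^+ 2 <=
   3 * gamma ^+ 2 * N xi ^+ 2 + 3 * gamma ^+ 2 * N b ^+ 2 + 3 * gamma ^+ 2 * N e ^+ 2.
  apply: (le_trans r10); clear; move: (N xi) (N b) (N e) => *.
  by rewrite le_eqVlt; apply/orP; left; apply/eqP; ring.
rewrite dec in mono'.
have nx0 : 0 <= gamma ^+ 2 * N xi ^+ 2 by apply: mulr_ge0; exact: sqr_ge0.
exact: (step_arith mono' r1 r2 r3 r4 r5 r7 r8 r9 r10' v1 v2 v3 nx0).
Qed.

End Path.

Section Trajectory.
Context (R : realType) (d : nat) (S : Type).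
Context (X : set 'rV[R]_d) (w : 'rV[R]_d -> \bar R) (dw : 'rV[R]_d -> 'rV[R]_d).
Context (F : 'rV[R]_d -> 'rV[R]_d) (Fo : 'rV[R]_d -> S -> 'rV[R]_d).
Context (gamma : R) (B M : nat) (x0 : 'rV[R]_d).
Implicit Types (zs : nat -> S) (js : nat -> nat) (t : nat).

Definition state zs js t := mirror_prox X w dw Fo gamma B M x0 zs js t.

Definition extrapolated zs js t := half_step X w dw Fo gamma B zs (state zs js t).

Definition level_mean zs js t j := level_batch X w dw Fo gamma B zs (state zs js t) j.

Definition top_level := trunc_log 2 M.

(** The reference is the mean over the largest admissible batch, so that the noise
averages to zero over the random level. *)
Definition level_noise zs js t j :=
  mlmc_estimator X w dw Fo gamma B M zs (state zs js t) j
    - level_mean zs js t top_level.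

Definition top_noise zs js t := level_mean zs js t top_level - F (extrapolated zs js t).

Definition step_noise zs js t :=
  batch Fo zs (state zs js t).1 (state zs js t).2 B - F (state zs js t).1.

(** This sequence stands in for the comparison point u, which depends on the
noise; its value at time t does not depend on the level drawn at time t. *)
Fixpoint ghost zs js t := if t is t'.+1
  then prox X w dw (ghost zs js t') (- gamma *: level_noise zs js t' (js t'))
  else x0.

(** The biased part of the noise is multiplied by T, the centered part is not;
2 T bounds the coefficient 3 + T / 2 of one step. *)
Definition step_cost q T zs js t :=
  4 * gamma ^+ 2 * pnorm q (level_noise zs js t (js t)) ^+ 2
  + 2 * T%:R * gamma ^+ 2 * pnorm q (top_noise zs js t) ^+ 2
  + 3 * gamma ^+ 2 * pnorm q (step_noise zs js t) ^+ 2
  + gamma * dotp (level_noise zs js t (js t)) (ghost zs js t - extrapolated zs js t).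

End Trajectory.

Lemma convex_set_mean (R : realType) (d : nat) (X : set 'rV[R]_d)
    (f : nat -> 'rV[R]_d) n : @convex_set R _ X -> (forall t, X (f t)) ->
  X (n.+1%:R^-1 *: \sum_(t < n.+1) f t).
Proof.
move=> cX Xf; elim: n => [|n IH].
  by rewrite big_ord_recr big_ord0 /= add0r invr1 scale1r.
rewrite big_ord_recr /= scalerDr.
have a01 : 0 <= (n.+1%:R / n.+2%:R : R) <= 1.
  by rewrite divr_ge0 //= ler_pdivrMr ?ltr0n // mul1r ler_nat.
have := convex_set_mem cX IH (Xf n.+1) a01.
rewrite scalerA.
have -> : n.+1%:R / n.+2%:R * n.+1%:R^-1 = n.+2%:R^-1 :> R.
  by rewrite mulrAC mulfV ?mul1r // pnatr_eq0.
have -> : 1 - n.+1%:R / n.+2%:R = n.+2%:R^-1 :> R.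
  have {1}-> : 1 = n.+2%:R / n.+2%:R :> R by rewrite mulfV // pnatr_eq0.
  by rewrite -mulrBl -natrB // subSnn mul1r.
by [].
Qed.

Lemma telescope_arith (R : realType) (s a b v0 u0 x1 x2 y1 y2 n D e g2 nb T z1 z2 z3 : R) :
  s <= (v0 - x1) + (u0 - y1) + n * D + e ->
  a <= (x1 - x2) + (y1 - y2) + D + (z1 + (3 + T / 2) * g2 * nb + z2 + z3) ->
  3 + T / 2 <= 2 * T -> 0 <= g2 * nb ->
  b = z1 + 2 * T * g2 * nb + z2 + z3 ->
  s + a <= (v0 - x2) + (u0 - y2) + (1 + n) * D + (e + b).
Proof.
move=> h1 h2 h3 h4 ->; have := ler_wpM2r h4 h3; rewrite !mulrA => h5.
have {}h2 := le_trans h2 (lerD (lexx _) (lerD (lerD (lerD (lexx _) h5) (lexx _)) (lexx _))).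
lra.
Qed.

Lemma telescope_end (R : realType) (a b x y : R) : a <= b -> 0 <= x -> 0 <= y ->
  a - x + (a - y) + b <= 3 * b.
Proof. by move=> *; lra. Qed.

Lemma half_plus_three (R : realType) (t : R) : 2 <= t -> 3 + t / 2 <= 2 * t.
Proof. by move=> *; lra. Qed.

Section TrajectoryBound.
Context (R : realType) (d : nat) (p q : R).
Hypothesis hp : 1 <= p <= 2.
Hypothesis q1 : 1 <= q.
Hypothesis hpq : forall y z : 'rV[R]_d, dotp y z <= pnorm q y * pnorm p z.
Context (X : set 'rV[R]_d) (w : 'rV[R]_d -> \bar R) (dw : 'rV[R]_d -> 'rV[R]_d).
Hypotheses (hXcompact : compact X) (hXconvex : @convex_set R _ X).
Hypothesis (hw : distance_generating p X w dw).
Context (F : 'rV[R]_d -> 'rV[R]_d) (L gamma : R).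
Hypotheses (hL : 0 < L) (hlip : lipschitz_pnorm_on p L X F).
Hypothesis hmono : monotone_on X F.
Hypotheses (hgamma : 0 < gamma) (hgammaL : gamma <= 1 / (2 * L)).
Context (S : Type) (Fo : 'rV[R]_d -> S -> 'rV[R]_d) (B M : nat) (x0 : 'rV[R]_d).
Hypothesis hx0 : X x0.
Context (zs : nat -> S) (js : nat -> nat).
Local Notation V := (bregman w dw).
Local Notation D2 := (bregman_diam2 X w dw).
Local Notation st := (state X w dw Fo gamma B M x0 zs js).
Local Notation hs := (extrapolated X w dw Fo gamma B M x0 zs js).
Local Notation ys := (ghost X w dw Fo gamma B M x0 zs js).

Lemma state_in t : X (st t).1.
Proof. by elim: t => [|t IH] //=; exact: (prox_in hXcompact hw). Qed.

Lemma extrapolated_in t : X (hs t).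
Proof. exact: (prox_in hXcompact hw _ (state_in t)). Qed.

Lemma ghost_in t : X (ys t).
Proof. by elim: t => [|t IH] //=; exact: (prox_in hXcompact hw). Qed.

Lemma average_in T : (0 < T)%N ->
  X (mirror_prox_average X w dw Fo gamma B M x0 zs js T).
Proof.
by case: T => // n _; apply: (convex_set_mean n hXconvex extrapolated_in).
Qed.

(** The steps telescope. The three copies of the diameter come from the
divergences at x0 of the iterates and of the auxiliary sequence, and from T times
the share D2 / T of each step. *)
Lemma trajectory_regret T u : (2 <= T)%N -> X u ->
  gamma * T%:R * dotp (F u) (mirror_prox_average X w dw Fo gamma B M x0 zs js T - u)
    <= 3 * D2 + \sum_(t < T) step_cost X w dw F Fo gamma B M x0 q T zs js t.
Proof.
move=> T2 Xu; have T0 : 0 < (T%:R : R) by rewrite ltr0n (ltn_trans _ T2).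
have TN0 : T%:R != 0 :> R by rewrite gt_eqF.
have T3 : 3 + T%:R / 2 <= 2 * (T%:R : R).
  by apply: half_plus_three; rewrite ler_nat.
pose c t := step_cost X w dw F Fo gamma B M x0 q T zs js t.
have tele n : \sum_(t < n) gamma * dotp (F u) (hs t - u) <=
    (V x0 u - V (st n).1 u) + (V x0 u - V (ys n) u)
    + n%:R * (D2 / T%:R) + \sum_(t < n) c t.
  elim: n => [|n IH]; first by rewrite !big_ord0 /= !subrr mul0r !addr0.
  rewrite !big_ord_recr /=.
  have st1 := mirror_prox_step_bound hp q1 hpq hXcompact hXconvex hw hL hlip
    hmono hgamma hgammaL (state_in n) (ghost_in n) Xu T0 erefl erefl erefl erefl.
  have {}st1 := st1 (batch Fo zs (st n).1 (st n).2 B)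
    (mlmc_estimator X w dw Fo gamma B M zs (st n) (js n))
    (level_mean X w dw Fo gamma B M x0 zs js n (top_level M)).
  have gn0 : 0 <= gamma ^+ 2 * pnorm q (top_noise X w dw F Fo gamma B M x0 zs js n) ^+ 2.
    by apply: mulr_ge0; exact: sqr_ge0.
  rewrite -[n.+1%:R]nat1r.
  exact: (telescope_arith IH st1 T3 gn0 erefl).
have -> : gamma * T%:R * dotp (F u) (mirror_prox_average X w dw Fo gamma B M x0 zs js T - u)
   = \sum_(t < T) gamma * dotp (F u) (hs t - u).
  rewrite -mulr_sumr -mulrA; congr (_ * _).
  under eq_bigr do rewrite dotpBr.
  rewrite big_split /= sumrN sumr_const card_ord dotpBr mulrBr (mulr_natl (dotp (F u) u)).
  congr (_ - _); rewrite /mirror_prox_average dotpZr mulVKf //.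
  by rewrite dotpC dotp_suml; apply: eq_bigr => t _; rewrite dotpC.
apply: (le_trans (tele T)); rewrite lerD2r.
have v1 : V x0 u <= D2 := bregman_le_diam2 hXcompact hw hx0 Xu.
have v2 := bregman_ge0 hXconvex hw (state_in T) Xu.
have v3 := bregman_ge0 hXconvex hw (ghost_in T) Xu.
rewrite [T%:R * _]mulrC divfK //.
exact: telescope_end.
Qed.

(** Nonnegativity and the upper bound make the error function bounded along all
trajectories, hence integrable. *)
Lemma err_vi_trajectory T : (2 <= T)%N ->
  let err := err_vi X F (mirror_prox_average X w dw Fo gamma B M x0 zs js T) in
  (0 <= err) /\ gamma * T%:R * err <=
    3 * D2 + \sum_(t < T) step_cost X w dw F Fo gamma B M x0 q T zs js t.
Proof.
move=> T2; set xa := mirror_prox_average _ _ _ _ _ _ _ _ _ _ _.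
set K := 3 * D2 + _ => err.
have gT : 0 < gamma * T%:R by rewrite mulr_gt0 // ltr0n (ltn_trans _ T2).
have ub : ubound [set dotp (F u) (xa - u) | u in X] (K / (gamma * T%:R)).
  by move=> _ [u Xu <-]; rewrite ler_pdivlMr // mulrC; exact: trajectory_regret.
have Xa : X xa by apply: average_in; apply: ltn_trans T2.
split.
  apply: ub_le_sup; first by exists (K / (gamma * T%:R)).
  by exists xa => //; rewrite subrr dotpC dotp0l.
rewrite mulrC -ler_pdivlMr //; apply: ge_sup ub.
by exists (dotp (F xa) (xa - xa)); exists xa.
Qed.

End TrajectoryBound.

#[local] Transparent dotp pnorm dual_pnorm bregman prox bregman_diam2.

(** * Integrals of bounded functions *)

Section Bounded.
Context (T : Type) (R : realType).
Implicit Types f g : T -> R.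

Definition bounded_by_const f := exists c : R, forall x, `|f x| <= c.

Lemma bounded_by_constD f g : bounded_by_const f -> bounded_by_const g ->
  bounded_by_const (fun x => f x + g x).
Proof.
move=> [a fa] [b gb]; exists (a + b) => x.
by apply: (le_trans (ler_normD _ _)); exact: lerD.
Qed.

Lemma bounded_by_constM f g : bounded_by_const f -> bounded_by_const g ->
  bounded_by_const (fun x => f x * g x).
Proof.
move=> [a fa] [b gb]; exists (a * b) => x.
by rewrite normrM; exact: ler_pM.
Qed.

Lemma bounded_by_const_cst (k : R) : bounded_by_const (fun=> k).
Proof. by exists `|k|. Qed.

End Bounded.

Section BoundedIntegral.
Context (dT : measure_display) (T : measurableType dT) (R : realType).
Context (mu : {measure set T -> \bar R}).
Hypothesis mu_fin : (mu setT < +oo)%E.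
Implicit Types (f g : T -> R) (D : set T).

Definition bounded_measurable f := measurable_fun setT f /\ bounded_by_const f.

Lemma bounded_measurable_cst (k : R) : bounded_measurable (fun=> k).
Proof. by split; [exact: measurable_cst|exact: bounded_by_const_cst]. Qed.

Lemma bounded_measurableD f g : bounded_measurable f -> bounded_measurable g ->
  bounded_measurable (fun x => f x + g x).
Proof.
by move=> [mf bf] [mg bg]; split; [exact: measurable_funD|exact: bounded_by_constD].
Qed.

Lemma bounded_measurableM f g : bounded_measurable f -> bounded_measurable g ->
  bounded_measurable (fun x => f x * g x).
Proof.
by move=> [mf bf] [mg bg]; split; [exact: measurable_funM|exact: bounded_by_constM].
Qed.

Lemma bounded_measurableZ (k : R) f : bounded_measurable f ->
  bounded_measurable (fun x => k * f x).
Proof. by apply: bounded_measurableM; exact: bounded_measurable_cst. Qed.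

Lemma bounded_measurableB f g : bounded_measurable f -> bounded_measurable g ->
  bounded_measurable (fun x => f x - g x).
Proof.
move=> hf hg; have := bounded_measurableD hf (bounded_measurableZ (-1) hg).
by congr bounded_measurable; apply/funext => x; rewrite mulN1r.
Qed.

Lemma bounded_measurable_sum (I : Type) (r : seq I) (P : pred I) (F : I -> T -> R) :
  (forall i, P i -> bounded_measurable (F i)) ->
  bounded_measurable (fun x => \sum_(i <- r | P i) F i x).
Proof.
move=> h; elim: r => [|i r IH].
  by under eq_fun do rewrite big_nil; exact: bounded_measurable_cst.
under eq_fun do rewrite big_cons; case Pi: (P i) => //.
by apply: bounded_measurableD => //; exact: h.
Qed.

Lemma bounded_measurable_integrable D f : measurable D -> bounded_measurable f ->
  mu.-integrable D (EFin \o f).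
Proof.
move=> mD [mf [c fc]]; apply: measurable_bounded_integrable => //.
- by apply: le_lt_trans mu_fin; apply: le_measure; rewrite ?inE.
- exact: measurable_funTS.
- exists c; split; first exact: num_real.
  by move=> M cM x _; apply: le_trans (fc x) (ltW cM).
Qed.

Local Notation I D f := (\int[mu]_(x in D) f x).

Lemma bintD D f g : measurable D -> bounded_measurable f -> bounded_measurable g ->
  I D (fun x => f x + g x) = I D f + I D g.
Proof. by move=> mD hf hg; apply: RintegralD => //; exact: bounded_measurable_integrable. Qed.

Lemma bintB D f g : measurable D -> bounded_measurable f -> bounded_measurable g ->
  I D (fun x => f x - g x) = I D f - I D g.
Proof. by move=> mD hf hg; apply: RintegralB => //; exact: bounded_measurable_integrable. Qed.

Lemma bintZ D (k : R) f : measurable D -> bounded_measurable f ->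
  I D (fun x => k * f x) = k * I D f.
Proof. by move=> mD hf; apply: RintegralZl => //; exact: bounded_measurable_integrable. Qed.

Lemma bint_cst D (k : R) : measurable D -> I D (fun=> k) = k * fine (mu D).
Proof. by move=> mD; exact: Rintegral_cst. Qed.

Lemma bint_sum D (J : Type) (r : seq J) (P : pred J) (F : J -> T -> R) :
  measurable D -> (forall i, P i -> bounded_measurable (F i)) ->
  I D (fun x => \sum_(i <- r | P i) F i x) = \sum_(i <- r | P i) I D (F i).
Proof.
move=> mD h; elim: r => [|i r IH].
  rewrite big_nil; under eq_Rintegral do rewrite big_nil.
  by rewrite bint_cst // mul0r.
rewrite big_cons; under eq_Rintegral do rewrite big_cons.
case Pi: (P i) => //; rewrite bintD // ?IH //; first exact: h.
exact: bounded_measurable_sum.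
Qed.

Lemma bint_le D f g : measurable D -> bounded_measurable f -> bounded_measurable g ->
  (forall x, D x -> f x <= g x) -> I D f <= I D g.
Proof. by move=> mD hf hg; apply: le_Rintegral => //; exact: bounded_measurable_integrable. Qed.

Lemma bint_indic D A : measurable D -> measurable A ->
  I D (fun x => \1_A x) = fine (mu (A `&` D)).
Proof. by move=> mD mA; rewrite /Rintegral integral_indic. Qed.

Lemma bounded_measurable_indic A : measurable A -> bounded_measurable (\1_A : T -> R).
Proof.
move=> mA; split; first exact: measurable_indic.
by exists 1 => x; rewrite indicE; case: (x \in A); rewrite ?normr1 ?normr0.
Qed.

(** Countable additivity over the level sets of an integer-valued function. *)
Lemma bint_partition_ge0 (c : T -> nat) D f : measurable D ->
  measurable_fun setT c -> bounded_measurable f ->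
  (forall k, 0 <= I (D `&` c @^-1` [set k]) f) -> 0 <= I D f.
Proof.
move=> mD mc hf h.
pose A k := D `&` c @^-1` [set k].
have mA k : measurable (A k).
  by apply: measurableI => //; rewrite -[X in measurable X]setTI; exact: mc.
have DA : D = \bigcup_k A k.
  apply/seteqP; split=> [x Dx|x [k _ [Dx _]]] //.
  by exists (c x).
have tA : trivIset setT A.
  by move=> i j _ _ [x [[_ /= <-] [_ /= <-]]].
have iD : mu.-integrable (\bigcup_k A k) (EFin \o f).
  by rewrite -DA; exact: bounded_measurable_integrable.
rewrite /Rintegral DA (integral_bigcup tA mA iD); apply: fine_ge0.
apply: nneseries_ge0 => k _ _.
have /fineK <- : (\int[mu]_(x in A k) (EFin \o f) x)%E \is a fin_num.
  apply: integrable_fin_num => //; exact: bounded_measurable_integrable.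
by rewrite lee_fin; exact: h.
Qed.

End BoundedIntegral.

(** Positive linear functionals on bounded functions. Integrals against the law
of a random element, against a transition kernel, and against iterates of a
kernel are all of this kind, and are compared through their point masses. *)
Section Functionals.
Context (S : choiceType) (R : realType).
Implicit Types (phi psi : S -> R) (I : (S -> R) -> R).

Definition bounded_functional I :=
  [/\ forall phi psi, bounded_by_const phi -> bounded_by_const psi ->
        I (fun x => phi x + psi x) = I phi + I psi,
      forall (k : R) phi, bounded_by_const phi -> I (fun x => k * phi x) = k * I phi &
      forall phi, bounded_by_const phi -> (forall x, 0 <= phi x) -> 0 <= I phi].

Definition at_point (a x : S) : R := (x == a)%:R.

Lemma point_bounded a : bounded_by_const (at_point a).
Proof. by exists 1 => x; rewrite /at_point; case: eqP; rewrite ?normr1 ?normr0. Qed.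

Lemma bounded_functional_le I phi psi : bounded_functional I ->
  bounded_by_const phi -> bounded_by_const psi -> (forall x, phi x <= psi x) ->
  I phi <= I psi.
Proof.
move=> [Iadd Iscal Ipos] bp bq h.
have bn : bounded_by_const (fun x => -1 * phi x).
  by apply: bounded_by_constM => //; exact: bounded_by_const_cst.
have := Ipos (fun x => psi x + -1 * phi x); rewrite Iadd // Iscal // mulN1r subr_ge0.
apply; first exact: bounded_by_constD.
by move=> x; rewrite mulN1r subr_ge0.
Qed.

Lemma bounded_functional_abs I phi psi : bounded_functional I ->
  bounded_by_const phi -> bounded_by_const psi -> (forall x, `|phi x| <= psi x) ->
  `|I phi| <= I psi.
Proof.
move=> hI bp bq h; have [_ Iscal _] := hI.
rewrite ler_norml -mulN1r -Iscal //; apply/andP; split;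
  apply: bounded_functional_le => //.
- by apply: bounded_by_constM => //; exact: bounded_by_const_cst.
- by move=> x; rewrite mulN1r; have := h x; rewrite ler_norml => /andP[].
- by move=> x; exact: le_trans (ler_norm _) (h x).
Qed.

Lemma bounded_functional_sum I (J : Type) (r : seq J) (F : J -> S -> R) :
  bounded_functional I -> (forall i, bounded_by_const (F i)) ->
  I (fun x => \sum_(i <- r) F i x) = \sum_(i <- r) I (F i) /\
  bounded_by_const (fun x => \sum_(i <- r) F i x).
Proof.
move=> hI h; have [Iadd Iscal _] := hI; elim: r => [|i r [IH bs]].
  have E : (fun x => \sum_(i <- [::]) F i x) = (fun=> 0) :> (S -> R).
    by apply/funext => x; rewrite big_nil.
  rewrite E big_nil; split; last exact: bounded_by_const_cst.
  rewrite -[RHS](mul0r (I (fun=> 0))) -Iscal; last exact: bounded_by_const_cst.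
  by congr I; apply/funext => x; rewrite mul0r.
have E : (fun x => \sum_(j <- i :: r) F j x)
    = (fun x => F i x + \sum_(j <- r) F j x).
  by apply/funext => x; rewrite big_cons.
rewrite E big_cons (Iadd _ _ (h i) bs) IH.
by split => //; apply: bounded_by_constD => //; exact: h.
Qed.

Definition off (A : seq S) (x : S) : R := (x \notin A)%:R.

Lemma sum_point (A : seq S) (f : S -> R) x : uniq A ->
  \sum_(a <- A) f a * at_point a x = if x \in A then f x else 0.
Proof.
move=> uA; case: ifPn => [xA|xA].
  rewrite (bigD1_seq x) //= /at_point eqxx mulr1 big1 ?addr0 // => a ax.
  by rewrite eq_sym (negPf ax) mulr0.
rewrite big1_seq // => a /andP[_ aA]; rewrite /at_point.
by case: eqP => [xa|_]; rewrite ?mulr0 //; rewrite xa aA in xA.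
Qed.

Lemma off_bounded A : bounded_by_const (off A).
Proof. by exists 1 => x; rewrite /off; case: (_ \notin _); rewrite ?normr1 ?normr0. Qed.

Lemma functional_off I A : bounded_functional I -> uniq A ->
  I (fun=> 1) = \sum_(a <- A) I (at_point a) + I (off A).
Proof.
move=> hI uA; have [Iadd _ _] := hI.
have [h1 h2] := bounded_functional_sum A hI point_bounded.
rewrite -h1 -Iadd //; last exact: off_bounded.
congr I; apply/funext => x; have := sum_point (fun=> 1) x uA.
under eq_bigr do rewrite mul1r.
by move=> ->; rewrite /off; case: (x \in A); rewrite ?addr0 ?add0r.
Qed.

(** Only the mass that the second functional leaves outside A enters: equality of
the total masses bounds that of the first one by it and by the discrepancy on A. *)
Lemma functional_distance I1 I2 A phi (c : R) :
  bounded_functional I1 -> bounded_functional I2 -> I1 (fun=> 1) = I2 (fun=> 1) ->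
  uniq A -> 0 <= c -> (forall x, `|phi x| <= c) ->
  `|I1 phi - I2 phi|
    <= c * (2 * (\sum_(a <- A) `|I1 (at_point a) - I2 (at_point a)|) + 2 * I2 (off A)).
Proof.
move=> h1 h2 m uA c0 pc.
have bp : bounded_by_const phi by exists c.
pose rest x := phi x * off A x.
have br : bounded_by_const rest by apply: bounded_by_constM => //; exact: off_bounded.
have bpa a : bounded_by_const (fun x => phi a * at_point a x).
  by apply: bounded_by_constM; [exact: bounded_by_const_cst|exact: point_bounded].
have dec I : bounded_functional I ->
    I phi = \sum_(a <- A) phi a * I (at_point a) + I rest.
  move=> hI; have [Iadd Iscal _] := hI.
  have [e1 e2] := bounded_functional_sum A hI bpa.
  have -> : \sum_(a <- A) phi a * I (at_point a) =
      \sum_(a <- A) I (fun x => phi a * at_point a x).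
    by apply: eq_bigr => a _; rewrite Iscal //; exact: point_bounded.
  rewrite -e1 -Iadd //; congr I; apply/funext => x.
  rewrite sum_point // /rest /off; case: (x \in A); rewrite ?mulr0 ?addr0 //=.
  by rewrite mulr1 add0r.
have restle I : bounded_functional I -> `|I rest| <= c * I (off A).
  move=> hI; have [_ Iscal _] := hI; rewrite -Iscal; last exact: off_bounded.
  apply: bounded_functional_abs => //.
    by apply: bounded_by_constM; [exact: bounded_by_const_cst|exact: off_bounded].
  move=> x; rewrite /rest normrM; have -> : `|off A x| = off A x.
    by rewrite ger0_norm // /off ler0n.
  by rewrite ler_wpM2r // /off ler0n.
rewrite (dec _ h1) (dec _ h2).
set D := \sum_(a <- A) `|_ - _|.
have o1 := functional_off h1 uA; have o2 := functional_off h2 uA.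
have off1 : I1 (off A) <= I2 (off A) + D.
  have : \sum_(a <- A) I2 (at_point a) - \sum_(a <- A) I1 (at_point a) <= D.
    rewrite -sumrB; apply: ler_sum => a _; rewrite distrC; exact: ler_norm.
  by move: m; rewrite o1 o2; clearbody D; clear; lra.
have sumle : `|\sum_(a <- A) phi a * I1 (at_point a) - \sum_(a <- A) phi a * I2 (at_point a)|
    <= c * D.
  rewrite -sumrB mulr_sumr; apply: (le_trans (ler_norm_sum _ _ _)).
  by apply: ler_sum => a _; rewrite -mulrBr normrM ler_wpM2r.
have r1 := restle _ h1; have r2 := restle _ h2.
have r3 : c * I1 (off A) <= c * (I2 (off A) + D) by rewrite ler_wpM2l.
rewrite opprD addrACA; apply: (le_trans (ler_normD _ _)).
apply: (le_trans (lerD sumle (ler_normB _ _))).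
have arith (x y u v e : R) : x <= c * u -> y <= c * v -> c * u <= c * (v + e) ->
  c * e + (x + y) <= c * (2 * e + 2 * v) by clear; move=> *; lra.
exact: arith r1 r2 r3.
Qed.

End Functionals.

(** * Transition operators on a countable space *)

Section DiscreteSpace.
Context (R : realType) (dS : measure_display) (S : measurableType dS).
Hypotheses (hScount : countable [set: S]) (hSmeas : forall z : S, measurable [set z]).
Implicit Types (phi psi : S -> R).

Lemma discrete_measurable (A : set S) : measurable A.
Proof.
apply: countable_measurable => //.
by apply: sub_countable hScount; exact: subset_card_le.
Qed.

Lemma discrete_measurable_fun d' (U : measurableType d') (f : S -> U) :
  measurable_fun setT f.
Proof. by move=> _ Y mY; exact: discrete_measurable. Qed.

Lemma discrete_bounded_measurable phi : bounded_by_const phi ->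
  bounded_measurable phi.
Proof. by split=> //; exact: discrete_measurable_fun. Qed.

Lemma measure_functional (mu : {measure set S -> \bar R}) : (mu setT < +oo)%E ->
  bounded_functional (fun phi => \int[mu]_y phi y).
Proof.
move=> mufin; split.
- move=> f g bf bg.
  by apply: (bintD mufin) => //; exact: discrete_bounded_measurable.
- by move=> k f bf; apply: (bintZ mufin) => //; exact: discrete_bounded_measurable.
- by move=> f bf f0; apply: Rintegral_ge0.
Qed.

Lemma pointE (a : S) : at_point R a = \1_[set a] :> (S -> R).
Proof. by apply/funext => x; rewrite indicE /at_point in_set1. Qed.

Lemma measure_point (mu : {measure set S -> \bar R}) (a : S) :
  \int[mu]_y at_point R a y = fine (mu [set a]).
Proof. by rewrite pointE bint_indic // ?setIT. Qed.

(** A countable set is exhausted by finite sets, and the mass of the complements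
decreases to zero. *)
Lemma measure_tight (mu : {measure set S -> \bar R}) (e : R) :
  (mu setT < +oo)%E -> 0 < e -> exists2 A : seq S, uniq A & \int[mu]_y off R A y <= e.
Proof.
move=> mufin e0; have /countable_injP[code codeI] := hScount.
pose F n : set S := [set z | (n <= code z)%N].
have F0 : \bigcap_n F n = set0.
  by apply/seteqP; split=> // z /(_ (code z).+1 I) /=; rewrite /F /= ltnn.
have := @nonincreasing_cvg_mu _ _ _ mu F.
rewrite F0 measure0 => h.
have /fine_cvgP[_ /cvgrPdist_lt/(_ _ e0)[n _ hn]] : mu (F n) @[n --> \oo] --> 0%E.
  apply: h.
  - by apply: le_lt_trans mufin; apply: le_measure; rewrite ?inE //; exact: discrete_measurable.
  - by move=> i; exact: discrete_measurable.
  - exact: measurable0.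
  - move=> i j ij; apply/subsetPset => z; rewrite /F /=.
    exact: leq_trans.
have finA : finite_set (~` F n).
  pose g k := xget point [set z | code z = k].
  apply: (@sub_finite_set _ _ (g @` `I_n)); last exact/finite_image/finite_II.
  move=> z; rewrite /F /= => /negP; rewrite -ltnNge => zn.
  exists (code z) => //; rewrite /g; case: xgetP => [y _ yz|/(_ z) /= nz]; last by case: nz.
  by apply: codeI; rewrite ?inE.
have /finite_seqP[A AE] := finA.
exists (undup A); first exact: undup_uniq.
have -> : off R (undup A) = \1_(F n) :> (S -> R).
  apply/funext => x; rewrite indicE /off mem_undup.
  have -> : (x \in A) = (x \in ~` F n) by rewrite AE; apply/idP/idP; rewrite inE.
  by rewrite in_setC negbK.
rewrite bint_indic // ?setIT; last exact: discrete_measurable.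
have := hn n (leqnn n); rewrite sub0r normrN => /ltW; apply: le_trans.
exact: ler_norm.
Qed.

(** Point masses determine a functional on finitely supported functions only;
tightness of one functional excludes that mass escapes to infinity, and the equal
total mass transfers it to the other one. *)
Lemma functional_ext (I1 I2 : (S -> R) -> R) phi :
  bounded_functional I1 -> bounded_functional I2 -> I1 (fun=> 1) = I2 (fun=> 1) ->
  (forall a, I1 (at_point R a) = I2 (at_point R a)) ->
  (forall e, 0 < e -> exists2 A : seq S, uniq A & I2 (off R A) <= e) ->
  bounded_by_const phi -> I1 phi = I2 phi.
Proof.
move=> h1 h2 m pts tight [c pc].
apply/eqP; rewrite -subr_eq0 -normr_le0; apply/ler_addgt0Pr => e e0; rewrite add0r.
have c0 : 0 < `|c| + 1 by rewrite ltr_wpDl.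
have e1 : 0 < e / (2 * (`|c| + 1)) by rewrite divr_gt0 // mulr_gt0.
have [A uA hA] := tight _ e1.
have pc' x : `|phi x| <= `|c| + 1.
  by apply: (le_trans (pc x)); apply: (le_trans (ler_norm c)); rewrite lerDl.
apply: (le_trans (functional_distance h1 h2 m uA (ltW c0) pc')).
rewrite big1 => [|a _]; last by rewrite pts subrr normr0.
rewrite mulr0 add0r mulrA -ler_pdivlMl ?mulr_gt0 //.
by apply: (le_trans hA); rewrite [leRHS]mulrC [in leRHS](mulrC _ 2).
Qed.

Section Kernel.
Context (Q : R.-pker S ~> S).

Definition transition phi : S -> R := fun z => \int[Q z]_y phi y.

Lemma kernel_mass z : (Q z setT < +oo)%E.
Proof. by rewrite prob_kernel ltry. Qed.

Lemma transition_functional z : bounded_functional (fun phi => transition phi z).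
Proof. exact: measure_functional (kernel_mass z). Qed.

Lemma transition_cst (c : R) : transition (fun=> c) = fun=> c.
Proof.
apply/funext => z; rewrite /transition bint_cst // prob_kernel /= mulr1 //.
Qed.

Lemma transition_bound phi (c : R) : (forall x, `|phi x| <= c) ->
  forall z, `|transition phi z| <= c.
Proof.
move=> pc z; rewrite -[leRHS](congr1 (fun h => h z) (transition_cst c)).
apply: (bounded_functional_abs (transition_functional z)) => //; first by exists c.
exact: bounded_by_const_cst.
Qed.

Lemma iter_transition_bound k phi (c : R) : (forall x, `|phi x| <= c) ->
  forall z, `|iter k transition phi z| <= c.
Proof. by move=> pc; elim: k => [|k IH] //=; exact: transition_bound. Qed.

Lemma iter_transition_cst k (c : R) : iter k transition (fun=> c) = fun=> c.
Proof. by elim: k => //= k ->; exact: transition_cst. Qed.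

Lemma iter_transition_functional k z :
  bounded_functional (fun phi => iter k transition phi z).
Proof.
have bk phi j : bounded_by_const phi -> bounded_by_const (iter j transition phi).
  by move=> [c pc]; exists c; exact: iter_transition_bound.
elim: k z => [|k IH] z.
  by split=> //= phi _; exact.
split=> /=.
- move=> phi psi bp bq; have [add _ _] := transition_functional z.
  rewrite -add; [|exact: bk|exact: bk]; congr (transition _ z).
  by apply/funext => x; have [addk _ _] := IH x; rewrite addk.
- move=> c phi bp; have [_ scal _] := transition_functional z.
  rewrite -scal; last exact: bk.
  congr (transition _ z).
  by apply/funext => x; have [_ scalk _] := IH x; rewrite scalk.
- move=> phi bp phi0; have [_ _ pos] := transition_functional z.
  by apply: pos; [exact: bk|move=> x; have [_ _ posk] := IH x; exact: posk].
Qed.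

(** The powers of the kernel, given by their masses, are the iterates of the
transition operator on functions. *)
Lemma tstepE k z (a : S) :
  tstep Q k z [set a] = (iter k transition (at_point R a) z)%:E.
Proof.
elim: k z => [|k IH] z /=.
  by rewrite diracE /at_point in_set1.
rewrite (eq_integral (EFin \o iter k transition (at_point R a))) => [|y _]; last first.
  by rewrite /= IH.
rewrite /transition /Rintegral fineK //; apply: integrable_fin_num => //.
apply: (bounded_measurable_integrable (kernel_mass z)) => //.
apply: discrete_bounded_measurable; exists 1; apply: iter_transition_bound => x.
by rewrite /at_point; case: eqP; rewrite ?normr1 ?normr0.
Qed.

Section Invariant.
Context (pi : probability S R).
Hypothesis hinv : invariant_distribution Q pi.

(** Invariance on events passes to functions through the point masses. *)
Lemma invariant_expectation phi : bounded_by_const phi ->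
  \int[pi]_z transition phi z = \int[pi]_z phi z.
Proof.
have pifin : (pi setT < +oo)%E by rewrite probability_setT ltry.
have hp := measure_functional pifin.
apply: (@functional_ext (fun f => \int[pi]_z transition f z) (fun f => \int[pi]_z f z)).
- have [add scal pos] := hp; split.
  + move=> f g [a fa] [b gb]; rewrite -add.
    * by congr Rintegral; apply/funext => z; have [tadd _ _] := transition_functional z;
        rewrite tadd; [|exists a|exists b].
    * by exists a; exact: transition_bound.
    * by exists b; exact: transition_bound.
  + move=> k f [a fa]; rewrite -scal; last by exists a; exact: transition_bound.
    by congr Rintegral; apply/funext => z; have [_ tscal _] := transition_functional z;
      rewrite tscal //; exists a.
  + move=> f [a fa] f0; apply: pos; first by exists a; exact: transition_bound.
    by move=> z; have [_ _ tpos] := transition_functional z; apply: tpos => //; exists a.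
- exact: hp.
- by rewrite transition_cst.
- move=> a; rewrite [RHS]measure_point //.
  transitivity (fine (\int[pi]_z Q z [set a])%E); last by rewrite hinv.
  congr fine.
  apply: eq_integral => z _; rewrite /= /transition measure_point fineK //.
  have zfin : (Q z [set a] <= Q z setT)%E by apply: le_measure; rewrite ?inE.
  by rewrite ge0_fin_numE // (le_lt_trans zfin) // kernel_mass.
- by move=> e e0; exact: measure_tight.
Qed.

Lemma iter_invariant_expectation k phi : bounded_by_const phi ->
  \int[pi]_z iter k transition phi z = \int[pi]_z phi z.
Proof.
move=> [c pc]; elim: k => //= k IH.
by rewrite invariant_expectation //; exists c; exact: iter_transition_bound.
Qed.

End Invariant.
End Kernel.

(** Uniform convergence of the point masses gives contraction in total variation
over a number of steps of order tau, with a factor that depends on pi: only a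
finite set carrying most of the mass of pi matters, and outside of it the mass
of the transition probabilities is controlled by complementation. *)
Lemma ergodic_contraction (pi : probability S R) (C0 : R) : 0 < C0 ->
  exists2 kappa : R, 0 < kappa & forall (Q : R.-pker S ~> S) (tau : R), 1 <= tau ->
    geometrically_ergodic Q pi C0 tau ->
    exists b : nat, [/\ (0 < b)%N, b%:R <= kappa * tau &
      forall phi (c : R) z, 0 <= c -> (forall x, `|phi x| <= c) ->
        \int[pi]_x phi x = 0 -> `|iter b (transition Q) phi z| <= c / 2].
Proof.
move=> C00; have pifin : (pi setT < +oo)%E by rewrite probability_setT ltry.
(* mass 1/8 outside A and 1/8 of discrepancy on A add up to the factor 1/2 *)
have e0 : 0 < 1 / 8 :> R by [].
have [A uA hA] := measure_tight pifin e0.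
(* k tau steps bring each of the size A discrepancies below C0 / 2 ^ k *)
pose s : R := (size A)%:R * C0 * 8.
have s0 : 0 <= s by rewrite /s !mulr_ge0 // ltW.
pose k := (Num.truncn s).+1.
have sk : s <= 2 ^+ k.
  have := ltW (real_truncnS_gt (ger0_real s0)); rewrite -/k => /le_trans; apply.
  by rewrite -natrX ler_nat ltnW // ltn_expl.
exists (k.+1%:R) => // Q tau tau1 erg.
have tau0 : 0 < tau by exact: lt_le_trans tau1.
pose b := (Num.truncn (k%:R * tau)).+1.
have kt0 : 0 <= k%:R * tau by rewrite mulr_ge0 // ltW.
have kb : k%:R * tau <= b%:R := ltW (real_truncnS_gt (ger0_real kt0)).
exists b; split => //.
  have := truncn_le (k%:R * tau); rewrite kt0 => bt.
  by rewrite -[b%:R]natr1 -[k.+1%:R]natr1 mulrDl mul1r; apply: lerD.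
move=> phi c z c0 pc phi0.
have hQ := iter_transition_functional Q b z.
have hp := measure_functional pifin.
have mass : iter b (transition Q) (fun=> 1) z = \int[pi]_x (fun=> 1) x.
  rewrite iter_transition_cst bint_cst // mul1r.
  by transitivity (fine (pi setT)); first by rewrite probability_setT.
have := functional_distance hQ hp mass uA c0 pc; rewrite phi0 subr0.
move=> /le_trans; apply; rewrite ler_wpM2l //.
have each : \sum_(a <- A)
    `|iter b (transition Q) (at_point R a) z - \int[pi]_x at_point R a x| <= 1 / 8.
  apply: (@le_trans _ _ (\sum_(a <- A) C0 * (2 ^+ k)^-1)).
    apply: ler_sum => a _; have := erg b z a isT.
    rewrite tstepE /= -measure_point => /le_trans; apply.
    rewrite ler_wpM2l ?(ltW C00) //.
    apply: (@le_trans _ _ (2^-1 `^ k%:R)).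
      apply: ger_powR; first by rewrite invr_gt0 ltr0n /= invf_le1 ?ler1n.
      by rewrite ler_pdivlMr.
    by rewrite powR_mulrn // exprVn.
  have -> : \sum_(a <- A) C0 * (2 ^+ k)^-1 = (size A)%:R * C0 / 2 ^+ k.
    by rewrite big_const_seq count_predT iter_addr_0 -[LHS]mulr_natl mulrA.
  rewrite ler_pdivrMr ?exprn_gt0 //.
  have : s / 8 <= 2 ^+ k / 8 by rewrite ler_pM2r.
  by rewrite /s mulfK // div1r [X in _ <= X]mulrC.
have arith (x y : R) : x <= 1 / 8 -> y <= 1 / 8 -> 2 * x + 2 * y <= 2^-1.
  by move=> *; lra.
exact: arith.
Qed.

End DiscreteSpace.

(** * Histories of the chain and of the levels *)

Definition agree (T : Type) n (f g : nat -> T) := forall i, (i < n)%N -> f i = g i.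

Lemma agreeC (T : Type) n (f g : nat -> T) : agree n f g -> agree n g f.
Proof. by move=> h i /h. Qed.

Lemma agree_trans (T : Type) n (f g h : nat -> T) :
  agree n f g -> agree n g h -> agree n f h.
Proof. by move=> fg gh i ni; rewrite fg // gh. Qed.

Lemma agree_le (T : Type) m n (f g : nat -> T) : (m <= n)%N ->
  agree n f g -> agree m f g.
Proof. by move=> mn h i im; apply: h; exact: leq_trans mn. Qed.

Lemma agree_mkseq (T : eqType) n (f g : nat -> T) : mkseq f n = mkseq g n -> agree n f g.
Proof.
move=> h i ni; have := congr1 (fun s => nth (f 0%N) s i) h.
by rewrite !nth_mkseq.
Qed.

Lemma mkseq_agree (T : eqType) n (f g : nat -> T) : agree n f g -> mkseq f n = mkseq g n.
Proof. by move=> h; apply/eq_in_map => i; rewrite mem_iota /= add0n; exact: h. Qed.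

Definition set_at (T : Type) k (x : T) (f : nat -> T) : nat -> T :=
  fun i => if i == k then x else f i.

Lemma set_at_agree (T : Type) k (x : T) (f : nat -> T) : agree k (set_at k x f) f.
Proof. by move=> i ik; rewrite /set_at ltn_eqF. Qed.

Section Histories.
Context (R : realType) (dS : measure_display) (S : measurableType dS).
Hypotheses (hScount : countable [set: S]) (hSmeas : forall z : S, measurable [set z]).
Context (Q : R.-pker S ~> S).
Context (dO : measure_display) (Omega : measurableType dO) (P : probability Omega R).
Context (Z : nat -> {RV P >-> S}) (J : nat -> {RV P >-> nat}).
Hypotheses (hZ : markov_chain Q Z) (hJ : geometric_half J) (hJZ : independent_levels Z J).
Implicit Types (zs : nat -> S) (js : nat -> nat).

Definition path o : nat -> S := fun i => Z i o.
Definition levels o : nat -> nat := fun i => J i o.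

(** Conditioning on the past is replaced by integration over such an event, of
positive probability or not. *)
Definition history t n js zs : set Omega :=
  [set o | agree t (levels o) js /\ agree n (path o) zs].

Local Notation E D f := (\int[P]_(o in D) f o).
Local Notation pr D := (fine (P D)).

Lemma P_fin : (P setT < +oo)%E.
Proof. by rewrite probability_setT ltry. Qed.

Lemma path_cylinder_measurable n zs : measurable [set o | agree n (path o) zs].
Proof.
have -> : [set o | agree n (path o) zs] = \bigcap_(i in `I_n) (Z i @^-1` [set zs i]).
  by apply/seteqP; split=> o h i; exact: h.
apply: bigcap_measurableType => i _; rewrite -[X in measurable X]setTI.
exact: measurable_funPT.
Qed.

Lemma level_cylinder_measurable n js : measurable [set o | agree n (levels o) js].
Proof.
have -> : [set o | agree n (levels o) js] = \bigcap_(i in `I_n) (J i @^-1` [set js i]).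
  by apply/seteqP; split=> o h i; exact: h.
apply: bigcap_measurableType => i _; rewrite -[X in measurable X]setTI.
exact: measurable_funPT.
Qed.

Lemma history_measurable t n js zs : measurable (history t n js zs).
Proof.
apply: measurableI; [exact: level_cylinder_measurable|exact: path_cylinder_measurable].
Qed.

(** Independence of the levels and the chain, stated for families of the same
length, applies after padding the shorter family with sure events. *)
Lemma history_prob t n js zs : P (history t n js zs) =
  (P [set o | agree n (path o) zs] * \prod_(i < t) P [set o | J i o = js i])%E.
Proof.
pose n0 := maxn t n.
pose A i : set S := [set s | (i < n)%N -> s = zs i].
have mA i : measurable (A i) by exact: (discrete_measurable hScount hSmeas).
have := hJZ n0 (fun i => [set j | (i < t)%N -> j = js i]) mA.
have -> : [set o | forall i, (i < n0)%N -> A i (Z i o) /\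
    [set j | (i < t)%N -> j = js i] (J i o)] = history t n js zs.
  apply/seteqP; split=> o /= h.
    split=> i hi.
    - have i0 : (i < n0)%N by rewrite leq_max hi.
      exact: (h i i0).2 hi.
    - have i0 : (i < n0)%N by rewrite leq_max hi orbT.
      exact: (h i i0).1 hi.
  by move=> i _; split=> hi; [exact: (h.2 i hi)|exact: (h.1 i hi)].
have -> : [set o | forall i, (i < n0)%N -> A i (Z i o)] = [set o | agree n (path o) zs].
  apply/seteqP; split=> o /= h i hi; last by move=> hi'; exact: h.
  have hi0 : (i < n0)%N by rewrite leq_max hi orbT.
  exact: h i hi0 hi.
move=> ->; congr (_ * _)%E.
rewrite (big_ord_widen n0 (fun i => P [set o | J i o = js i])) ?leq_maxl //.
rewrite [RHS]big_mkcond; apply: eq_bigr => i _; case: ifPn => it.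
  by congr (P _); apply/seteqP; split=> o /=; [exact|move=> ->].
rewrite -[RHS](@probability_setT _ _ _ P); congr (P _).
by apply/seteqP; split=> o //= _ it'; rewrite it' in it.
Qed.

Lemma history_extend_path t n js zs : P (history t n.+2 js zs) =
  (P (history t n.+1 js zs) * Q (zs n) [set zs n.+1])%E.
Proof.
rewrite !history_prob (_ : P [set o | agree n.+2 (path o) zs] =
  P [set o | agree n.+1 (path o) zs] * Q (zs n) [set zs n.+1])%E.
  by rewrite -!muleA; congr (_ * _)%E; rewrite muleC.
exact: hZ n zs.
Qed.

Lemma history_extend_level t n js zs : P (history t.+1 n js zs) =
  (P (history t n js zs) * P [set o | J t o = js t])%E.
Proof. by rewrite !history_prob big_ord_recr /= muleA. Qed.

(** The index of the history that contains o: histories are countably many, and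
an integer code makes the partition into histories measurable. *)
Definition history_code (code : S -> nat) t (n : (nat -> nat) -> nat) o : nat :=
  choice.pickle (mkseq (levels o) t, mkseq (fun i => code (path o i)) (n (levels o))).

(** The number of samples that belong to the past at time t varies with the levels
drawn before, which fix where the batches of a step start. *)
Definition depth t (n : (nat -> nat) -> nat) :=
  forall js js', agree t js js' -> n js = n js'.

Section Code.
Context (code : S -> nat).
Hypothesis codeI : injective code.
Context (t : nat) (n : (nat -> nat) -> nat).
Hypothesis hn : depth t n.

Lemma history_codeP o o' : history_code code t n o = history_code code t n o' <->
  history t (n (levels o')) (levels o') (path o') o.
Proof.
split=> [/(pcan_inj choice.pickleK) [/agree_mkseq h1 h2]|[h1 h2]].
  split=> //; rewrite (hn h1) in h2.
  by move: h2 => /agree_mkseq h2 i /h2; exact: codeI.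
rewrite /history_code (hn h1) (mkseq_agree h1); congr (choice.pickle (_, _)).
by apply: mkseq_agree => i /h2 ->.
Qed.

Lemma history_code_measurable : measurable_fun setT (history_code code t n).
Proof.
move=> _ Y _; rewrite setTI.
have -> : history_code code t n @^-1` Y =
    \bigcup_(k in Y) (history_code code t n @^-1` [set k]).
  apply/seteqP; split; last by move=> u [k Yk /= ->].
  by move=> u Yu; exists (history_code code t n u).
apply: bigcup_measurable => k _.
have [[u ok]|no] := pselect (exists u, history_code code t n u = k); last first.
  rewrite (_ : _ @^-1` _ = set0); first exact: measurable0.
  by apply/seteqP; split=> // o /= ok; case: no; exists o.
rewrite (_ : _ @^-1` _ = history t (n (levels u)) (levels u) (path u)).
  exact: history_measurable.
by apply/seteqP; split=> o' /=; rewrite -ok => /history_codeP.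
Qed.

End Code.

Lemma exists_code : exists code : S -> nat, injective code.
Proof.
have /countable_injP[code codeI] := hScount.
by exists code => x y; apply: codeI; rewrite inE.
Qed.

Definition adapted (U : Type) t (n : (nat -> nat) -> nat)
    (f : (nat -> S) -> (nat -> nat) -> U) :=
  forall zs zs' js js', agree t js js' -> agree (n js) zs zs' -> f zs js = f zs' js'.

(** Such a function factors through the integer code of the history. *)
Lemma adapted_measurable t n (f : (nat -> S) -> (nat -> nat) -> R) :
  depth t n -> adapted t n f -> measurable_fun setT (fun o => f (path o) (levels o)).
Proof.
move=> hn hf; have [code codeI] := exists_code.
pose psi k := f (path (xget point [set o | history_code code t n o = k]))
  (levels (xget point [set o | history_code code t n o = k])).
have -> : (fun o => f (path o) (levels o)) = psi \o history_code code t n.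
  apply/funext => o; rewrite /psi /=; case: xgetP => [v _ /= ov|/(_ o)/(_ erefl)//].
  have [h1 h2] := (history_codeP codeI hn _ _).1 ov.
  apply: hf; first exact: agreeC h1.
  exact: agreeC h2.
by apply: measurableT_comp => //; exact: history_code_measurable.
Qed.

Lemma adapted_bounded_measurable t n (f : (nat -> S) -> (nat -> nat) -> R) :
  depth t n -> adapted t n f -> (exists c : R, forall zs js, `|f zs js| <= c) ->
  bounded_measurable (fun o => f (path o) (levels o)).
Proof.
move=> hn hf [c fc]; split; last by exists c.
exact: adapted_measurable hn hf.
Qed.

(** The event D is a countable disjoint union of histories of depth n. *)
Lemma history_split_ge0 t n D f : depth t n -> measurable D -> bounded_measurable f ->
  (forall o, D o -> history t (n (levels o)) (levels o) (path o) `<=` D /\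
     0 <= E (history t (n (levels o)) (levels o) (path o)) f) ->
  0 <= E D f.
Proof.
move=> hn mD hf h; have [code codeI] := exists_code.
apply: (bint_partition_ge0 P_fin mD (history_code_measurable codeI hn) hf) => k.
have [[u [Do ok]]|no] := pselect (exists o, D o /\ history_code code t n o = k); last first.
  rewrite (_ : _ `&` _ = set0); first by rewrite Rintegral_set0.
  by apply/seteqP; split=> // o /= [Do ok]; case: no; exists o.
have [sub ge] := h u Do.
rewrite (_ : _ `&` _ = history t (n (levels u)) (levels u) (path u)) //.
apply/seteqP; split=> o' /=; first by case=> _; rewrite -ok => /(history_codeP codeI hn).
by move=> ho; split; [exact: sub|rewrite -ok; apply/(history_codeP codeI hn)].
Qed.

Lemma history_split_le t n D f g : depth t n -> measurable D ->
  bounded_measurable f -> bounded_measurable g ->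
  (forall o, D o -> history t (n (levels o)) (levels o) (path o) `<=` D /\
     E (history t (n (levels o)) (levels o) (path o)) f <=
     E (history t (n (levels o)) (levels o) (path o)) g) ->
  E D f <= E D g.
Proof.
move=> hn mD hf hg h; rewrite -subr_ge0 -(bintB P_fin) //.
apply: (history_split_ge0 hn mD); first exact: bounded_measurableB.
move=> o Do; have [sub le] := h o Do; split=> //.
by rewrite (bintB P_fin) // ?subr_ge0 //; exact: history_measurable.
Qed.

Lemma global_split_le t n f g : depth t n -> bounded_measurable f -> bounded_measurable g ->
  (forall js zs, E (history t (n js) js zs) f <= E (history t (n js) js zs) g) ->
  E setT f <= E setT g.
Proof.
move=> hn hf hg h; apply: (history_split_le hn) => // o _; split=> //; exact: h.
Qed.

Lemma path_split_le t n n' js zs f g : (n <= n')%N ->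
  bounded_measurable f -> bounded_measurable g ->
  (forall zs', agree n zs' zs ->
     E (history t n' js zs') f <= E (history t n' js zs') g) ->
  E (history t n js zs) f <= E (history t n js zs) g.
Proof.
move=> nn' hf hg h.
have hn : depth t (fun=> n') by [].
apply: (history_split_le hn) => //; first exact: history_measurable.
move=> o [h1 h2].
have -> : history t n' (levels o) (path o) = history t n' js (path o).
  apply/seteqP; split=> o' [h3 h4]; split=> //.
    exact: agree_trans h3 h1.
  exact: agree_trans h3 (agreeC h1).
split; last exact: h.
move=> o' [h3 h4]; split => //; apply: agree_trans h2; exact: agree_le h4.
Qed.

Lemma path_split_eq t n n' js zs f g : (n <= n')%N ->
  bounded_measurable f -> bounded_measurable g ->
  (forall zs', agree n zs' zs ->
     E (history t n' js zs') f = E (history t n' js zs') g) ->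
  E (history t n js zs) f = E (history t n js zs) g.
Proof.
move=> nn' hf hg h; apply/eqP; rewrite eq_le.
by apply/andP; split; apply: (path_split_le nn') => // zs' /h ->.
Qed.

Lemma sample_bounded_measurable phi k : bounded_by_const phi ->
  bounded_measurable (fun o => phi (Z k o) : R).
Proof.
move=> [c pc]; split; last by exists c.
by apply: measurableT_comp => //; exact: (discrete_measurable_fun hScount hSmeas).
Qed.

(** The Markov property, given on cylinders, is extended from point masses to all
bounded functions. *)
Lemma next_sample t n js zs phi : bounded_by_const phi ->
  E (history t n.+1 js zs) (fun o => phi (Z n.+1 o))
    = pr (history t n.+1 js zs) * transition Q phi (zs n).
Proof.
move=> bp; have mH := history_measurable t n.+1 js zs.
have [tadd tscal tpos] := transition_functional hScount hSmeas Q (zs n).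
have pr0 : 0 <= pr (history t n.+1 js zs) by rewrite fine_ge0.
apply: (@functional_ext _ _ S (fun f => E (history t n.+1 js zs) (fun o => f (Z n.+1 o)))
  (fun f => pr (history t n.+1 js zs) * transition Q f (zs n))) => //.
- split.
  + by move=> f g bf bg; apply: (bintD P_fin) => //; exact: sample_bounded_measurable.
  + by move=> k f bf; apply: (bintZ P_fin) => //; exact: sample_bounded_measurable.
  + by move=> f bf f0; apply: Rintegral_ge0.
- split.
  + by move=> f g bf bg; rewrite tadd // mulrDr.
  + by move=> k f bf; rewrite tscal // mulrCA.
  + by move=> f bf f0; rewrite mulr_ge0 // tpos.
- by rewrite transition_cst // bint_cst // mul1r mulr1.
- move=> a; rewrite /transition measure_point //.
  transitivity (E (history t n.+1 js zs) (\1_(Z n.+1 @^-1` [set a]))).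
    apply: eq_Rintegral => o _; rewrite /at_point indicE.
    rewrite (_ : (o \in _) = (Z n.+1 o == a)) //.
    by apply/idP/eqP; rewrite inE.
  rewrite bint_indic //; last first.
    by rewrite -[X in measurable X]setTI; exact: measurable_funPT.
  have h := history_extend_path t n js (set_at n.+1 a zs).
  have -> : Z n.+1 @^-1` [set a] `&` history t n.+1 js zs
      = history t n.+2 js (set_at n.+1 a zs).
    apply/seteqP; split=> o /=.
      move=> [Za [h1 h2]]; split=> // i; rewrite ltnS leq_eqVlt => /predU1P[->|hi].
        by rewrite /set_at eqxx.
      by rewrite h2 // set_at_agree.
    move=> [h1 h2]; split; first by have := h2 n.+1 (ltnSn _); rewrite /set_at eqxx.
    split=> // i hi; rewrite h2 ?(ltn_trans hi) //; exact: set_at_agree.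
  apply: (etrans (congr1 fine h)); rewrite fineM.
  + congr (pr _ * fine (Q _ _)).
    * by apply/seteqP; split=> o [h1 h2]; split=> //; apply: agree_trans h2 _;
        [|apply: agreeC]; exact: set_at_agree.
    * by rewrite set_at_agree.
    * by rewrite /set_at eqxx.
  + by rewrite fin_num_measure //; exact: history_measurable.
  + have zfin : (Q (set_at n.+1 a zs n) [set (set_at n.+1 a zs n.+1)] <=
        Q (set_at n.+1 a zs n) setT)%E by apply: le_measure; rewrite ?inE.
    by rewrite ge0_fin_numE // (le_lt_trans zfin) // kernel_mass.
- move=> e e0; pose c := pr (history t n.+1 js zs) + 1.
  have c0 : 0 < c by rewrite /c ltr_wpDl.
  have [A uA hA] := measure_tight hScount hSmeas (kernel_mass Q (zs n)) (divr_gt0 e0 c0).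
  exists A => //; rewrite /transition.
  have o0 : 0 <= \int[Q (zs n)]_y off R A y by apply: Rintegral_ge0 => y _; rewrite /off.
  move: hA; rewrite ler_pdivlMr // mulrC; apply: le_trans.
  by rewrite ler_wpM2r // /c lerDl.
Qed.

(** One step at a time: the history is refined by the intermediate samples, on
each of which the next transition is known. *)
Lemma later_sample t n k js zs phi : bounded_by_const phi ->
  E (history t n.+1 js zs) (fun o => phi (Z (n + k) o))
    = pr (history t n.+1 js zs) * iter k (transition Q) phi (zs n).
Proof.
move=> bp; have [c pc] := bp.
elim: k phi bp pc => [|k IH] phi bp pc.
  rewrite addn0 /= mulrC -(bint_cst P) //; last exact: history_measurable.
  apply: eq_Rintegral => o; rewrite inE => -[_ h]; by rewrite -[zs n]h.
have tb := transition_bound hScount hSmeas Q pc.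
rewrite iterSr -IH //; last by exists c.
apply: (@path_split_eq t n.+1 (n + k).+1); rewrite ?ltnS ?leq_addr //.
- exact: sample_bounded_measurable.
- by apply: sample_bounded_measurable; exists c.
move=> zs' _; rewrite addnS next_sample // mulrC -(bint_cst P) //; last exact: history_measurable.
by apply: eq_Rintegral => o; rewrite inE => -[_ h]; rewrite -[zs' _]h.
Qed.

End Histories.

(** * Averaging over a random level *)

Lemma le_inv_expr2_le0 (R : realType) (x : R) : (forall n, x <= 2^-1 ^+ n) -> x <= 0.
Proof.
move=> h; rewrite leNgt; apply/negP => x0.
have xi : 0 <= x^-1 by rewrite invr_ge0 ltW.
have := h (Num.truncn x^-1).+1; rewrite exprVn -[x in x <= _]invrK lef_pV2 ?posrE ?invr_gt0 ?exprn_gt0 //.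
apply/negP; rewrite -ltNge; apply: lt_le_trans (real_truncnS_gt (ger0_real xi)) _.
by rewrite -natrX ler_nat ltnW // ltn_expl.
Qed.

Section LevelRule.
Context (R : realType) (dS : measure_display) (S : measurableType dS).
Hypotheses (hScount : countable [set: S]) (hSmeas : forall z : S, measurable [set z]).
Context (dO : measure_display) (Omega : measurableType dO) (P : probability Omega R).
Context (Z : nat -> {RV P >-> S}) (J : nat -> {RV P >-> nat}).
Hypotheses (hJ : geometric_half J) (hJZ : independent_levels Z J).
Implicit Types (zs : nat -> S) (js : nat -> nat).

Local Notation E D f := (\int[P]_(o in D) f o).
Local Notation pr D := (fine (P D)).
Local Notation history := (history Z J).
Local Notation path := (path Z).
Local Notation levels := (levels J).

Lemma level_event_measurable t a : measurable [set o | J t o = a].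
Proof.
rewrite (_ : [set o | _] = J t @^-1` [set a]) // -[X in measurable X]setTI.
exact: measurable_funPT.
Qed.

Lemma level_prob t a : (0 < a)%N -> P [set o | J t o = a] = (2^-1 ^+ a)%:E.
Proof. by move=> a0; rewrite -(hJ t a0). Qed.

Lemma level_bounded_measurable t a :
  bounded_measurable (fun o => ((J t o == a)%:R : R)).
Proof.
have -> : (fun o => ((J t o == a)%:R : R)) = \1_[set o | J t o = a].
  apply/funext => o; rewrite indicE; rewrite (_ : (o \in _) = (J t o == a)) //.
  by apply/idP/eqP; rewrite inE.
apply: bounded_measurable_indic; exact: level_event_measurable.
Qed.

Lemma level_int D t a : measurable D ->
  E D (fun o => ((J t o == a)%:R : R)) = pr ([set o | J t o = a] `&` D).
Proof.
move=> mD; rewrite -bint_indic //; last exact: level_event_measurable.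
apply: eq_Rintegral => o _; rewrite indicE; rewrite (_ : (o \in _) = (J t o == a)) //.
by apply/idP/eqP; rewrite inE.
Qed.

Lemma geometric_sum n : \sum_(1 <= a < n.+1) (2^-1 : R) ^+ a = 1 - 2^-1 ^+ n.
Proof.
elim: n => [|n IH]; first by rewrite big_geq // expr0 subrr.
by rewrite big_nat_recr //= IH exprS; move: (_ ^+ n) => x; lra.
Qed.

(** The masses 2^-i of the positive levels add up to one. *)
Lemma level_prob0 t : pr [set o | J t o = 0%N] = 0.
Proof.
apply/eqP; rewrite eq_le fine_ge0 // andbT.
apply: le_inv_expr2_le0 => n.
have hb a : bounded_measurable (fun o => ((J t o == a)%:R : R)).
  exact: level_bounded_measurable.
have := bint_sum (P_fin P) (index_iota 0 n.+1) measurableT (fun a (_ : true) => hb a).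
have -> : \sum_(0 <= a < n.+1) E setT (fun o => ((J t o == a)%:R : R)) =
    pr [set o | J t o = 0%N] + (1 - 2^-1 ^+ n).
  rewrite big_nat_recl // -geometric_sum level_int // setIT; congr (_ + _).
  rewrite [RHS]big_add1 /=; apply: eq_bigr => a _.
  by rewrite level_int // setIT level_prob.
move=> h.
have : E setT (fun o => \sum_(0 <= a < n.+1) ((J t o == a)%:R : R)) <= 1.
  apply: (@le_trans _ _ (E setT (fun=> 1 : R))).
    apply: (bint_le (P_fin P)) => //.
    - exact: bounded_measurable_sum.
    - exact: bounded_measurable_cst.
    - move=> o _; have [jn|jn] := ltnP (J t o) n.+1.
        rewrite (bigD1_seq (J t o : nat)) ?mem_index_iota ?iota_uniq //= eqxx big1 ?addr0 //.
        by move=> a /negPf; rewrite eq_sym => ->.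
      rewrite big1_seq // => a; rewrite mem_index_iota => /andP[_ /andP[_ an]].
      by rewrite gtn_eqF // (leq_trans an).
  rewrite bint_cst // mul1r.
  have -> : pr setT = 1 :> R by rewrite probability_setT.
  by [].
by rewrite h => h2; lra.
Qed.

Lemma history_level t n js zs a :
  pr ([set o | J t o = a] `&` history t n js zs) =
    pr (history t n js zs) * (if a == 0%N then 0 else 2^-1 ^+ a).
Proof.
have -> : [set o | J t o = a] `&` history t n js zs = history t.+1 n (set_at t a js) zs.
  apply/seteqP; split=> o /=.
    move=> [Ja [h1 h2]]; split=> // i; rewrite ltnS leq_eqVlt => /predU1P[->|hi].
      by rewrite /set_at eqxx.
    by rewrite h1 // set_at_agree.
  move=> [h1 h2]; split; first by have := h1 t (ltnSn _); rewrite /set_at eqxx.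
  split=> // i hi; rewrite h1 ?(ltn_trans hi) //; exact: set_at_agree.
apply: (etrans (congr1 fine (history_extend_level hScount hSmeas hJZ t n _ zs))).
have -> : history t n (set_at t a js) zs = history t n js zs.
  by apply/seteqP; split=> o [h1 h2]; split=> //; apply: agree_trans h1 _;
    [|apply: agreeC]; exact: set_at_agree.
rewrite fineM.
- congr (_ * _); rewrite /set_at eqxx; case: eqP => [->|/eqP a0].
    exact: level_prob0.
  by rewrite -[RHS]/(fine (2^-1 ^+ a)%:E) -(level_prob t) // lt0n.
- by rewrite fin_num_measure //; exact: history_measurable.
- by rewrite fin_num_measure //; exact: level_event_measurable.
Qed.

(** As Phi is constant beyond m, the mean over infinitely many levels is this
constant plus finitely many corrections. *)
Lemma next_level t n m js zs (Phi : nat -> R) :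
  (forall j, (m < j)%N -> Phi j = Phi m.+1) ->
  E (history t n js zs) (fun o => Phi (J t o)) = pr (history t n js zs) *
    (Phi m.+1 + \sum_(1 <= a < m.+1) 2^-1 ^+ a * (Phi a - Phi m.+1)).
Proof.
move=> hPhi; have mH : measurable (history t n js zs) by exact: history_measurable.
have -> : E (history t n js zs) (fun o => Phi (J t o)) =
  E (history t n js zs) (fun o => Phi m.+1 +
      \sum_(0 <= a < m.+1) (Phi a - Phi m.+1) * (J t o == a)%:R).
  apply: eq_Rintegral => o _; have [jn|jn] := ltnP (J t o) m.+1.
    rewrite (bigD1_seq (J t o : nat)) ?mem_index_iota ?iota_uniq //= eqxx mulr1.
    rewrite big1 ?addr0 ?subrKC // => a /negPf; rewrite eq_sym => ->.
    by rewrite mulr0.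
  rewrite big1_seq ?addr0 ?hPhi // => a; rewrite mem_index_iota => /andP[_ /andP[_ an]].
  by rewrite gtn_eqF ?mulr0 // (leq_trans an).
have hb a : bounded_measurable (fun o => (Phi a - Phi m.+1) * ((J t o == a)%:R : R)).
  by apply: bounded_measurableZ; exact: level_bounded_measurable.
rewrite (bintD (P_fin P)) //; [|exact: bounded_measurable_cst|exact: bounded_measurable_sum].
rewrite bint_cst // (bint_sum (P_fin P)) // mulrDr mulrC; congr (_ + _).
rewrite mulr_sumr big_nat_recl //.
have step a : E (history t n js zs) (fun o => (Phi a - Phi m.+1) * ((J t o == a)%:R : R)) =
    (Phi a - Phi m.+1) * (pr (history t n js zs) * (if a == 0%N then 0 else 2^-1 ^+ a)).
  rewrite (bintZ (P_fin P)) //; last exact: level_bounded_measurable.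
  by rewrite level_int // history_level.
rewrite step /= !mulr0 add0r [RHS]big_add1 /=; apply: eq_bigr => a _.
by rewrite step /= mulrC -mulrA.
Qed.

Lemma adapted_on_history (U : Type) t n (f : (nat -> S) -> (nat -> nat) -> U) js zs o :
  adapted t n f -> history t (n js) js zs o -> f (path o) (levels o) = f zs js.
Proof. by move=> hf [h1 h2]; symmetry; apply: hf; exact: agreeC. Qed.

(** On each history of depth n the function j |-> G j is deterministic, while the
level drawn at time t is independent of the history. *)
Lemma level_average t n m (G : nat -> (nat -> S) -> (nat -> nat) -> R) (c : R) :
  depth t n -> (forall j, adapted t n (G j)) -> (forall j zs js, `|G j zs js| <= c) ->
  (forall j, (m < j)%N -> G j = G m.+1) ->
  E setT (fun o => G (J t o) (path o) (levels o)) =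
  E setT (fun o => G m.+1 (path o) (levels o) + \sum_(1 <= a < m.+1)
     2^-1 ^+ a * (G a (path o) (levels o) - G m.+1 (path o) (levels o))).
Proof.
move=> hn hG bG hm.
have bmG j : bounded_measurable (fun o => G j (path o) (levels o)).
  by apply: (adapted_bounded_measurable hScount hSmeas Z J hn (hG j)); exists c.
have bm1 : bounded_measurable (fun o => G (J t o) (path o) (levels o)).
  have hn' : depth t.+1 n by move=> js js' /(agree_le (leqnSn t)); exact: hn.
  have hG' : adapted t.+1 n (fun zs js => G (js t) zs js).
    move=> zs zs' js js' h1 h2; rewrite (h1 t (ltnSn t)); apply: hG => //.
    exact: agree_le h1.
  by apply: (adapted_bounded_measurable hScount hSmeas Z J hn' hG'); exists c.
have bm2 : bounded_measurable (fun o => G m.+1 (path o) (levels o) +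
    \sum_(1 <= a < m.+1)
     2^-1 ^+ a * (G a (path o) (levels o) - G m.+1 (path o) (levels o))).
  apply: bounded_measurableD => //; apply: bounded_measurable_sum => a _.
  by apply: bounded_measurableZ; exact: bounded_measurableB.
suff h js zs : E (history t (n js) js zs) (fun o => G (J t o) (path o) (levels o)) =
  E (history t (n js) js zs) (fun o => G m.+1 (path o) (levels o) +
     \sum_(1 <= a < m.+1)
      2^-1 ^+ a * (G a (path o) (levels o) - G m.+1 (path o) (levels o))).
  apply/eqP; rewrite eq_le.
  apply/andP; split.
    by apply: (global_split_le (Z := Z) (J := J) hScount hSmeas hn bm1 bm2) => js zs; rewrite (h js zs).
  by apply: (global_split_le (Z := Z) (J := J) hScount hSmeas hn bm2 bm1) => js zs; rewrite (h js zs).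
transitivity (E (history t (n js) js zs) (fun o => G (J t o) zs js)).
  by apply: eq_Rintegral => o; rewrite inE => ho; exact: adapted_on_history (hG _) ho.
rewrite (@next_level t _ m _ _ (fun j => G j zs js)) => [|j mj]; last by rewrite hm.
rewrite mulrC -(bint_cst P) //; last exact: history_measurable.
apply: eq_Rintegral => o; rewrite inE => ho; rewrite (adapted_on_history (hG _) ho).
by congr (_ + _); apply: eq_bigr => a _; rewrite (adapted_on_history (hG _) ho).
Qed.

End LevelRule.

(** * Mean square of a sum along the chain *)

(** Along one residue class modulo b, the samples are those of the b-step chain. *)
Lemma sum_residues (V : nmodType) (a : nat -> V) b K :
  \sum_(i < K * b) a i = \sum_(r < b) \sum_(k < K) a (r + k * b)%N.
Proof.
elim: K => [|K IH].
  by rewrite mul0n big_ord0 big1 // => r _; rewrite big_ord0.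
rewrite mulSnr big_split_ord /= IH -big_split /=; apply: eq_bigr => r _.
by rewrite big_ord_recr /= addnC.
Qed.

Lemma sqr_sum_le (R : realType) n (x : 'I_n -> R) :
  (\sum_(i < n) x i) ^+ 2 <= n%:R * \sum_(i < n) x i ^+ 2.
Proof.
elim: n x => [|n IH] x; first by rewrite !big_ord0 mulr0 expr0n.
rewrite !big_ord_recl.
have h := IH (fun i => x (lift ord0 i)).
have : 2 * (x ord0 * \sum_(i < n) x (lift ord0 i)) <=
    n%:R * x ord0 ^+ 2 + \sum_(i < n) x (lift ord0 i) ^+ 2.
  have -> : n%:R * x ord0 ^+ 2 = \sum_(i < n) x ord0 ^+ 2.
    by rewrite sumr_const card_ord mulr_natl.
  rewrite !mulr_sumr -big_split /=.
  apply: ler_sum => i _; have := sqr_ge0 (x ord0 - x (lift ord0 i)).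
  by move: (x ord0) (x _) => u v; rewrite !expr2; lra.
rewrite -[n.+1%:R]nat1r; move: h; set A := \sum_(i < n) x _; set B := \sum_(i < n) _.
clearbody A B; move: (x ord0) (n%:R : R) => u m.
by rewrite !expr2; lra.
Qed.

Lemma pnorm_sum (R : realType) d (q : R) (I : Type) (l : seq I) (A : pred I)
    (f : I -> 'rV[R]_d) : 1 <= q ->
  pnorm q (\sum_(i <- l | A i) f i) <= \sum_(i <- l | A i) pnorm q (f i).
Proof.
move=> q1; have q0 : 0 < q by apply: lt_le_trans q1.
elim/big_rec2: _ => [|i u v _ IH]; first by rewrite pnorm0.
by apply: (le_trans (pnorm_triangle _ _ q1)); rewrite lerD2l.
Qed.

Lemma mul_inv_expr2_le1 (R : realType) n : n%:R * 2^-1 ^+ n <= 1 :> R.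
Proof.
by rewrite exprVn ler_pdivrMr ?exprn_gt0 // mul1r -natrX ler_nat ltnW // ltn_expl.
Qed.

Lemma blocks_and_rest_arith (R : realType) (x y z r b l s : R) :
  0 <= x -> x <= y + r * s -> y ^+ 2 <= b * z ->
  r * r * s ^+ 2 <= b * l * s ^+ 2 ->
  x ^+ 2 <= 2 * (b * z) + 2 * (b * (l * s ^+ 2)).
Proof.
move=> x0 xy yz rb; have h0 := le_trans x0 xy.
have h1 : x ^+ 2 <= (y + r * s) ^+ 2 by apply: lerXn2r; rewrite ?nnegrE.
have h2 := sqr_ge0 (y - r * s).
by apply: (le_trans h1); rewrite !expr2 in h2 yz rb *; lra.
Qed.

Lemma chain_variance_arith (R : realType) (q b l p t K e : R) :
  2 <= q -> 0 <= b -> 0 <= l -> 0 <= p -> 0 <= t -> K * b <= l ->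
  e <= b * (p * (601 * q * K * t)) ->
  2 * (b * e) + 2 * (b * (l * t)) * p <= p * (1203 * q * b * l * t).
Proof.
move=> q2 b0 l0 p0 t0 Kb he; have q0 : 0 <= q by apply: le_trans q2.
have w0 : 0 <= q * (b * (p * t)) by rewrite !mulr_ge0.
have h1 : K * b * (q * (b * (p * t))) <= l * (q * (b * (p * t))) by rewrite ler_wpM2r.
have h2 : b * e <= b * (b * (p * (601 * q * K * t))) by rewrite ler_wpM2l.
have h3 : 2 * (b * (l * (p * t))) <= q * (b * (l * (p * t))).
  by rewrite ler_wpM2r // !mulr_ge0.
lra.
Qed.

Section Variance.
Context (R : realType) (dS : measure_display) (S : measurableType dS).
Hypotheses (hScount : countable [set: S]) (hSmeas : forall z : S, measurable [set z]).
Context (Q : R.-pker S ~> S) (pi : probability S R).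
Hypothesis hinv : invariant_distribution Q pi.
Context (b : nat).
Hypothesis b0 : (0 < b)%N.
Hypothesis hb : forall (phi : S -> R) (c : R) z, 0 <= c -> (forall x, `|phi x| <= c) ->
  \int[pi]_x phi x = 0 -> `|iter b (transition Q) phi z| <= c / 2.
Context (d : nat) (q : R).
Hypothesis q2 : 2 <= q.
Local Notation N := (@pnorm R d q).
Implicit Types (h : S -> 'rV[R]_d).

Let q1 : 1 <= q. Proof. by apply: le_trans q2; rewrite ler1n. Qed.
Let q0 : 0 < q. Proof. by apply: lt_le_trans q1. Qed.

Definition block_transition h : S -> 'rV[R]_d :=
  fun z => \row_j iter b (transition Q) (fun y => h y ord0 j) z.

Lemma coord_bounded h (c : R) j : (forall z, N (h z) <= c) ->
  bounded_by_const (fun y => h y ord0 j).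
Proof. by move=> hc; exists c => y; apply: le_trans (hc y); exact: abs_le_pnorm. Qed.

Lemma dotp_bounded h (c : R) v : (forall z, N (h z) <= c) ->
  bounded_by_const (fun y => dotp v (h y)).
Proof.
move=> hc; exists (\sum_(i < d) `|v ord0 i| * c) => y.
apply: (le_trans (ler_norm_sum _ _ _)); apply: ler_sum => i _.
by rewrite normrM ler_wpM2l //; apply: le_trans (hc y); exact: abs_le_pnorm.
Qed.

Lemma dotp_block_transition h (c : R) v z : (forall z, N (h z) <= c) ->
  dotp v (block_transition h z) = iter b (transition Q) (fun y => dotp v (h y)) z.
Proof.
move=> hc; have hI := iter_transition_functional hScount hSmeas Q b z.
have [_ scal _] := hI.
have bi i : bounded_by_const (fun y => v ord0 i * h y ord0 i).
  by apply: bounded_by_constM; [exact: bounded_by_const_cst|exact: coord_bounded hc].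
have [e _] := bounded_functional_sum (index_enum 'I_d) hI bi.
rewrite [RHS]e; apply: eq_bigr => i _; rewrite mxE scal //.
exact: coord_bounded hc.
Qed.

(** Scalar estimates on the transition operator pass to vectors through a norming
functional. *)
Lemma norming_at (x : 'rV[R]_d) : exists v, (forall y, `|dotp v y| <= N y) /\ dotp v x = N x.
Proof.
have [v [v1 v2 _]] := pnorm_sqr_smooth x q2; exists v; split=> // y.
by rewrite ler_norml v1 andbT lerNl -dotpNr; apply: (le_trans (v1 _)); rewrite pnormN.
Qed.

Lemma block_transition_bound h (c : R) z : (forall z, N (h z) <= c) ->
  N (block_transition h z) <= c.
Proof.
move=> hc; have [v [v1 <-]] := norming_at (block_transition h z).
rewrite (dotp_block_transition _ _ hc); apply: (le_trans (ler_norm _)).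
apply: (iter_transition_bound hScount hSmeas) => x; exact: le_trans (v1 _) (hc x).
Qed.

Definition centered h := forall v, \int[pi]_z dotp v (h z) = 0.

Lemma block_transition_contract h (c : R) z : centered h -> (forall z, N (h z) <= c) ->
  N (block_transition h z) <= c / 2.
Proof.
move=> ch hc; have c0 : 0 <= c by apply: le_trans (hc z); exact: pnorm_ge0.
have [v [v1 <-]] := norming_at (block_transition h z).
rewrite (dotp_block_transition _ _ hc); apply: (le_trans (ler_norm _)).
by apply: hb => // x; exact: le_trans (v1 _) (hc x).
Qed.

Lemma block_transition_centered h (c : R) : centered h -> (forall z, N (h z) <= c) ->
  centered (block_transition h).
Proof.
move=> ch hc v; rewrite -[RHS](ch v).
rewrite -(iter_invariant_expectation hScount hSmeas hinv b (dotp_bounded v hc)).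
by congr Rintegral; apply/funext => z; rewrite (dotp_block_transition _ _ hc).
Qed.

Lemma iter_block_transition k h (c : R) : centered h -> (forall z, N (h z) <= c) ->
  centered (iter k block_transition h) /\
  forall z, N (iter k block_transition h z) <= c * 2^-1 ^+ k.
Proof.
move=> ch hc; elim: k => [|k [IH1 IH2]]; first by split=> //= z; rewrite mulr1.
split; first exact: block_transition_centered IH1 IH2.
move=> z; apply: (le_trans (block_transition_contract z IH1 IH2)).
by rewrite exprSr mulrA.
Qed.

(** Truncated solution of the Poisson equation for the b-step chain. With K terms
the remainder is of size 2^-K, so that K samples accumulate a bounded error. *)
Definition poisson K h : S -> 'rV[R]_d := fun z => \sum_(i < K) iter i block_transition h z.

Lemma poisson_bound K h (c : R) z : centered h -> (forall z, N (h z) <= c) ->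
  N (poisson K h z) <= 2 * c.
Proof.
move=> ch hc; have c0 : 0 <= c by apply: le_trans (hc z); exact: pnorm_ge0.
apply: (@le_trans _ _ (\sum_(i < K) c * 2^-1 ^+ i)).
  apply: (le_trans (pnorm_sum _ _ _ q1)); apply: ler_sum => i _.
  by have [_] := iter_block_transition i ch hc; exact.
have -> : \sum_(i < K) c * 2^-1 ^+ i = 2 * c * (1 - 2^-1 ^+ K).
  elim: K => [|K IH]; first by rewrite big_ord0 expr0 subrr mulr0.
  rewrite big_ord_recr /= IH exprS; move: (_ ^+ K) => x; lra.
rewrite ler_piMr ?mulr_ge0 // gerBl exprn_ge0 //.
Qed.

Lemma poisson_equation K h (c : R) z : centered h -> (forall z, N (h z) <= c) ->
  h z = poisson K h z - block_transition (poisson K h) z + iter K block_transition h z.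
Proof.
move=> ch hc.
have hI := iter_transition_functional hScount hSmeas Q b z.
have -> : block_transition (poisson K h) z = \sum_(i < K) iter i.+1 block_transition h z.
  apply/rowP => j; rewrite mxE summxE.
  have bi (i : 'I_K) : bounded_by_const (fun y => iter i block_transition h y ord0 j).
    by have [_ hi] := iter_block_transition i ch hc; exact: coord_bounded hi.
  have [e _] := bounded_functional_sum (index_enum 'I_K) hI bi.
  transitivity (iter b (transition Q) (fun y => \sum_(i < K) iter i block_transition h y ord0 j) z).
    congr (iter b _ _ z); apply/funext => y; by rewrite /poisson summxE.
  by rewrite [LHS]e; apply: eq_bigr => i _; rewrite /= mxE.
rewrite /poisson; elim: K => [|K IH]; first by rewrite !big_ord0 subrr add0r.
by rewrite !big_ord_recr /= opprD addrA addrNK addrAC; exact: IH.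
Qed.

Context (dO : measure_display) (Omega : measurableType dO) (P : probability Omega R).
Context (Z : nat -> {RV P >-> S}) (J : nat -> {RV P >-> nat}).
Hypotheses (hZ : markov_chain Q Z) (hJZ : independent_levels Z J).
Local Notation E D f := (\int[P]_(o in D) f o).
Local Notation pr D := (fine (P D)).
Local Notation history := (history Z J).
Local Notation path := (path Z).

Lemma path_bounded_measurable m (f : (nat -> S) -> R) (c : R) :
  (forall zs zs', agree m zs zs' -> f zs = f zs') -> (forall zs, `|f zs| <= c) ->
  bounded_measurable (fun o => f (path o)).
Proof.
move=> hf fc.
have hd : depth 0 (fun=> m) by [].
apply: (adapted_bounded_measurable hScount hSmeas Z J (f := fun zs _ => f zs) hd).
  by move=> zs zs' js js' _; exact: hf.
by exists c.
Qed.

Lemma norm_sqr_bound (x : 'rV[R]_d) (c : R) : N x <= c -> `|N x ^+ 2| <= c ^+ 2.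
Proof.
move=> xc; rewrite ger0_norm ?sqr_ge0 // ler_pXn2r ?nnegrE ?pnorm_ge0 //.
by apply: le_trans xc; exact: pnorm_ge0.
Qed.

Definition martingale (g : S -> 'rV[R]_d) u K (zs : nat -> S) : 'rV[R]_d :=
  \sum_(k < K) (g (zs (u + k.+1 * b)%N) - block_transition g (zs (u + k * b)%N)).

(** Orthogonality of martingale increments in a 2-smooth norm: the linear term
of the smoothness inequality vanishes on each history. *)
Lemma martingale_bound g (G : R) t n js zs u K : (forall z, N (g z) <= G) -> (n <= u)%N ->
  E (history t n.+1 js zs) (fun o => N (martingale g u K (path o)) ^+ 2)
    <= pr (history t n.+1 js zs) * (K%:R * (18 * q * (2 * G) ^+ 2)).
Proof.
move=> gG nu; set c := 18 * q * (2 * G) ^+ 2.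
have mH m zs' : measurable (history t m js zs') by exact: history_measurable.
have incN x y : N (g x - block_transition g y) <= 2 * G.
  apply: (le_trans (pnorm_triangle _ _ q1)); rewrite pnormN mulr_natl mulr2n.
  by apply: lerD; [exact: gG|exact: block_transition_bound].
have martN k zs' : N (martingale g u k zs') <= k%:R * (2 * G).
  apply: (le_trans (pnorm_sum _ _ _ q1)); rewrite mulr_natl -[k in leRHS]card_ord -sumr_const.
  by apply: ler_sum => i _; exact: incN.
have martA k zs' zs'' : agree (u + k * b).+1 zs' zs'' ->
    martingale g u k zs' = martingale g u k zs''.
  move=> h; apply: eq_bigr => i _; have ik : (i.+1 * b <= k * b)%N by rewrite leq_mul2r ltn_ord orbT.
  by rewrite !h // ltnS leq_add2l // (leq_trans _ ik) // leq_mul2r leqnSn orbT.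
have bm k : bounded_measurable (fun o => N (martingale g u k (path o)) ^+ 2).
  apply: (@path_bounded_measurable (u + k * b).+1 (fun zs => N (martingale g u k zs) ^+ 2)).
    by move=> zs1 zs2 /martA ->.
  by move=> zs'; exact: norm_sqr_bound (martN k zs').
elim: K => [|K IH].
  rewrite mul0r mulr0 /martingale.
  rewrite (_ : (fun o => _) = fun=> 0); first by rewrite bint_cst // mul0r.
  by apply/funext => o; rewrite big_ord0 pnorm0 // expr0n.
rewrite -[K.+1%:R]natr1 mulrDl mul1r mulrDr.
apply: le_trans (lerD IH (lexx _)).
rewrite [pr _ * c]mulrC -(bint_cst P) // -(bintD (P_fin P)) //; last exact: bounded_measurable_cst.
have nuK : (n.+1 <= (u + K * b).+1)%N by rewrite ltnS (leq_trans nu) // leq_addr.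
apply: (path_split_le hScount hSmeas nuK) => //.
  by apply: bounded_measurableD => //; exact: bounded_measurable_cst.
move=> zs' _; set H := history t _ js zs'.
have cst o : H o -> martingale g u K (path o) = martingale g u K zs'.
  by move=> [_ h]; apply: martA.
have [v [v1 _ v2]] := pnorm_sqr_smooth (martingale g u K zs') q2.
pose w0 := block_transition g (zs' (u + K * b)%N).
have [k0 k0E] : exists k0, k0 = 2 * N (martingale g u K zs') by eexists.
have bmD : bounded_measurable (fun o => dotp v (g (Z (u + K.+1 * b)%N o))).
  exact: (sample_bounded_measurable hScount hSmeas Z _ (dotp_bounded v gG)).
have mean0 : E H (fun o => k0 * (dotp v (g (Z (u + K.+1 * b)%N o)) - dotp v w0)) = 0.
  have bc := bounded_measurable_cst Omega (dotp v w0).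
  apply: (etrans (bintZ (P_fin P) k0 (mH _ _) (bounded_measurableB bmD bc))).
  rewrite (bintB (P_fin P) (mH _ _) bmD bc).
  rewrite bint_cst // mulSnr addnA.
  rewrite (later_sample hScount hSmeas hZ hJZ t _ b js zs' (dotp_bounded v gG)).
  by rewrite /w0 (dotp_block_transition _ _ gG) [X in _ - X]mulrC subrr mulr0.
have bmL : bounded_measurable (fun o => N (martingale g u K (path o)) ^+ 2 + c).
  by apply: bounded_measurableD => //; exact: bounded_measurable_cst.
have bmZ : bounded_measurable
    (fun o => k0 * (dotp v (g (Z (u + K.+1 * b)%N o)) - dotp v w0)).
  apply: bounded_measurableZ; apply: bounded_measurableB => //.
  exact: bounded_measurable_cst.
have bmR := bounded_measurableD bmL bmZ.
apply: (@le_trans _ _ (E H (fun o => (N (martingale g u K (path o)) ^+ 2 + c) +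
   k0 * (dotp v (g (Z (u + K.+1 * b)%N o)) - dotp v w0)))).
  apply: (bint_le (P_fin P)).
  - exact: mH.
  - exact: bm K.+1.
  - exact: bmR.
  - move=> o Ho; have Ho' := Ho; move: Ho' => [_ hz].
    have -> : martingale g u K.+1 (path o) = martingale g u K zs' +
        (g (Z (u + K.+1 * b)%N o) - w0).
      rewrite -(cst o Ho) /w0 -(hz (u + K * b)%N (ltnSn _)).
      by rewrite /martingale big_ord_recr.
    rewrite cst // -dotpBr k0E; apply: (le_trans (v2 _)).
    rewrite -[leRHS]addrA [c + _]addrC addrA lerD2l /c ler_wpM2l //.
      by rewrite mulr_ge0 // ltW.
    have xg := incN (Z (u + K.+1 * b)%N o) (zs' (u + K * b)%N).
    by have := norm_sqr_bound xg; rewrite ger0_norm // sqr_ge0.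
by rewrite (bintD (P_fin P) (mH _ _) bmL bmZ) mean0 addr0.
Qed.

Lemma telescoped_sum (g : S -> 'rV[R]_d) u K zs :
  \sum_(k < K) (g (zs (u + k * b)%N) - block_transition g (zs (u + k * b)%N)) =
    g (zs u) - g (zs (u + K * b)%N) + martingale g u K zs.
Proof.
elim: K => [|K IH].
  by rewrite /martingale !big_ord0 mul0n addn0 subrr addr0.
rewrite big_ord_recr /= IH /martingale big_ord_recr /=.
have zm (a y m z x : 'rV[R]_d) : a - y + m + (y - z) = a - x + (m + (x - z)).
  by apply/rowP => j; rewrite !mxE; ring.
exact: zm.
Qed.

Section Centered.
Context (f : S -> 'rV[R]_d) (s : R).
Hypotheses (fc : centered f) (fs : forall z, N (f z) <= s).

Let s0 : 0 <= s. Proof. by apply: le_trans (fs point); exact: pnorm_ge0. Qed.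

(** By the Poisson equation the sum is a martingale plus boundary terms, at most
2 s each, and the remainder, at most s; hence 50 = 2 * 5 ^ 2. *)
Lemma residue_norm u K zs :
  N (\sum_(k < K) f (zs (u + k * b)%N)) ^+ 2 <=
    50 * s ^+ 2 + 2 * N (martingale (poisson K f) u K zs) ^+ 2.
Proof.
pose g := poisson K f.
have gs z : N (g z) <= 2 * s by exact: poisson_bound.
have dec : \sum_(k < K) f (zs (u + k * b)%N) =
    (g (zs u) - g (zs (u + K * b)%N) + martingale g u K zs)
    + \sum_(k < K) iter K block_transition f (zs (u + k * b)%N).
  rewrite -telescoped_sum -big_split /=; apply: eq_bigr => k _.
  exact: poisson_equation fc fs.
have err : N (\sum_(k < K) iter K block_transition f (zs (u + k * b)%N)) <= s.
  apply: (@le_trans _ _ (\sum_(k < K) s * 2^-1 ^+ K)).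
    apply: (le_trans (pnorm_sum _ _ _ q1)); apply: ler_sum => k _.
    by have [_] := iter_block_transition K fc fs; exact.
  rewrite sumr_const card_ord -[leLHS]mulr_natl mulrCA ler_piMr // mul_inv_expr2_le1 //.
have tot : N (\sum_(k < K) f (zs (u + k * b)%N)) <= 5 * s + N (martingale g u K zs).
  rewrite dec; apply: (le_trans (pnorm_triangle _ _ q1)).
  apply: (le_trans (lerD (pnorm_triangle _ _ q1) err)).
  have h : N (g (zs u) - g (zs (u + K * b)%N)) <= 4 * s.
    apply: (le_trans (pnorm_triangle _ _ q1)); rewrite pnormN.
    by apply: (le_trans (lerD (gs _) (gs _))); lra.
  by move: h; move: (N _) (N _) => x y; lra.
rewrite -/g; have := pnorm_ge0 q (\sum_(k < K) f (zs (u + k * b)%N)).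
move: (N _) (N _) tot => y x tot x0.
have y0 := le_trans x0 tot.
have h1 : x ^+ 2 <= (5 * s + y) ^+ 2 by apply: lerXn2r; rewrite ?nnegrE.
have h2 := sqr_ge0 (5 * s - y).
by apply: (le_trans h1); rewrite !expr2 in h2 *; lra.
Qed.

Lemma sum_bounded_measurable n (I : finType) (k : I -> nat) (A : pred I) :
  (forall i, (k i < n)%N) ->
  bounded_measurable (fun o => N (\sum_(i | A i) f (Z (k i) o)) ^+ 2).
Proof.
move=> kn.
apply: (@path_bounded_measurable n (fun zs => N (\sum_(i | A i) f (zs (k i))) ^+ 2)
  ((\sum_(i | A i) s) ^+ 2)).
  by move=> zs zs' h; under eq_bigr do rewrite h //.
move=> zs; apply: norm_sqr_bound; apply: (le_trans (pnorm_sum _ _ _ q1)).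
by apply: ler_sum => i _; exact: fs.
Qed.

(** The martingale contributes 2 * 18 q (2 * 2 s) ^ 2 = 576 q s ^ 2 per sample, and
50 s ^ 2 is at most 25 q K s ^ 2. *)
Lemma residue_variance t n js zs u K : (n <= u)%N ->
  E (history t n.+1 js zs) (fun o => N (\sum_(k < K) f (Z (u + k * b)%N o)) ^+ 2)
    <= pr (history t n.+1 js zs) * (601 * q * K%:R * s ^+ 2).
Proof.
move=> nu; have mH : measurable (history t n.+1 js zs) by exact: history_measurable.
have [p pE] : exists p, p = pr (history t n.+1 js zs) by eexists.
have p0 : 0 <= p by rewrite pE fine_ge0.
have cstE c : E (history t n.+1 js zs) (fun=> c) = c * p by rewrite pE; exact: bint_cst.
rewrite -pE.
case: K => [|K].
  rewrite (_ : (fun o => _) = fun=> 0).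
    rewrite cstE [X in X <= _]mul0r; apply: mulr_ge0; first exact: p0.
    apply: mulr_ge0; last exact: sqr_ge0.
    apply: mulr_ge0; last exact: ler0n.
    by apply: mulr_ge0; [exact: ler0n|exact: ltW].
  by apply/funext => o; rewrite big_ord0 pnorm0 // expr0n.
have bmM : bounded_measurable
    (fun o => N (martingale (poisson K.+1 f) u K.+1 (path o)) ^+ 2).
  apply: (@path_bounded_measurable (u + K.+1 * b).+1
     (fun zs => N (martingale (poisson K.+1 f) u K.+1 zs) ^+ 2)
     ((K.+1%:R * (4 * s)) ^+ 2)).
    move=> zs1 zs2 h; congr (N _ ^+ 2); apply: eq_bigr => k _.
    have ik : (k.+1 * b <= K.+1 * b)%N by rewrite leq_mul2r ltn_ord orbT.
    by rewrite !h // ltnS leq_add2l // (leq_trans _ ik) // leq_mul2r leqnSn orbT.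
  move=> zs'; apply: norm_sqr_bound; apply: (le_trans (pnorm_sum _ _ _ q1)).
  rewrite [leRHS]mulr_natl -[K.+1 in leRHS]card_ord -sumr_const; apply: ler_sum => k _.
  have gs z : N (poisson K.+1 f z) <= 2 * s by exact: poisson_bound.
  apply: (le_trans (pnorm_triangle _ _ q1)); rewrite pnormN.
  by apply: (le_trans (lerD (gs _) (block_transition_bound _ gs))); lra.
have bmL : bounded_measurable (fun o => N (\sum_(k < K.+1) f (Z (u + k * b)%N o)) ^+ 2).
  apply: (@sum_bounded_measurable (u + K.+1 * b)) => k.
  by rewrite ltn_add2l ltn_mul2r b0 ltn_ord.
have bmc := bounded_measurable_cst Omega (50 * s ^+ 2).
apply: (@le_trans _ _ (E (history t n.+1 js zs) (fun o => 50 * s ^+ 2 +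
    2 * N (martingale (poisson K.+1 f) u K.+1 (path o)) ^+ 2))).
  apply: (bint_le (P_fin P)) => //.
    by apply: bounded_measurableD => //; exact: bounded_measurableZ.
  by move=> o _; exact: (residue_norm u K.+1 (path o)).
rewrite (bintD (P_fin P) mH bmc (bounded_measurableZ 2 bmM)) (bintZ (P_fin P) 2 mH bmM).
rewrite cstE.
have gs z : N (poisson K.+1 f z) <= 2 * s by exact: poisson_bound.
have := martingale_bound t js zs K.+1 gs nu; rewrite -pE; move: (Rintegral _ _ _) => e mb.
have qK : 50 <= 25 * q * K.+1%:R.
  have K1 : 1 <= K.+1%:R :> R by rewrite ler1n.
  by move: q2; move: (K.+1%:R : R) K1 => k k1 qq; nra.
have ps : 0 <= p * s ^+ 2 by rewrite mulr_ge0 ?sqr_ge0.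
have h1 : 50 * (p * s ^+ 2) <= 25 * q * K.+1%:R * (p * s ^+ 2) by rewrite ler_wpM2r.
move: mb h1; rewrite !expr2; move: (K.+1%:R : R) => k mb h1; lra.
Qed.

(** Splitting the samples by residue modulo b reduces to the block chain; the
square of a sum of b terms costs one factor b, so that the total is of order b l
and not of order b ^ 2 l. The constant is 2 * 601 + 1, where 1 accounts for the
fewer than b samples left over. *)
Lemma chain_variance t n js zs l :
  E (history t n.+1 js zs) (fun o => N (\sum_(i < l) f (Z (n.+1 + i)%N o)) ^+ 2)
    <= pr (history t n.+1 js zs) * (1203 * q * b%:R * l%:R * s ^+ 2).
Proof.
have mH : measurable (history t n.+1 js zs) by exact: history_measurable.
have [p pE] : exists p, p = pr (history t n.+1 js zs) by eexists.
have p0 : 0 <= p by rewrite pE fine_ge0.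
have cstE c : E (history t n.+1 js zs) (fun=> c) = c * p by rewrite pE; exact: bint_cst.
rewrite -pE.
have [K [r [lE rl rb Kl]]] : exists K r : nat,
    [/\ l = (K * b + r)%N, (r <= l)%N, (r <= b)%N & (K * b <= l)%N].
  exists (l %/ b)%N, (l %% b)%N; split; [exact: divn_eq|exact: leq_mod| |exact: leq_divM].
  by rewrite ltnW // ltn_mod.
pose Y c o := \sum_(k < K) f (Z (n.+1 + c + k * b)%N o).
have pw o : N (\sum_(i < l) f (Z (n.+1 + i)%N o)) ^+ 2 <=
    2 * (b%:R * \sum_(c < b) N (Y c o) ^+ 2) + 2 * (b%:R * (l%:R * s ^+ 2)).
  have dec : \sum_(i < l) f (Z (n.+1 + i)%N o) =
      \sum_(c < b) Y c o + \sum_(i < r) f (Z (n.+1 + (K * b + i))%N o).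
    have gen l' : l' = (K * b + r)%N -> \sum_(i < l') f (Z (n.+1 + i)%N o) =
        \sum_(i < K * b + r) f (Z (n.+1 + i)%N o) by move=> ->.
    rewrite (gen _ lE) big_split_ord /=; congr (_ + _).
    rewrite (sum_residues (fun i => f (Z (n.+1 + i)%N o))).
    by apply: eq_bigr => c _; apply: eq_bigr => k _; rewrite addnA.
  have nr : N (\sum_(i < r) f (Z (n.+1 + (K * b + i))%N o)) <= r%:R * s.
    apply: (le_trans (pnorm_sum _ _ _ q1)).
    rewrite [leRHS]mulr_natl -[r in leRHS]card_ord -sumr_const.
    by apply: ler_sum => i _; exact: fs.
  have ny : N (\sum_(c < b) Y c o) <= \sum_(c < b) N (Y c o) by exact: pnorm_sum.
  have sq : (\sum_(c < b) N (Y c o)) ^+ 2 <= b%:R * \sum_(c < b) N (Y c o) ^+ 2.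
    exact: sqr_sum_le.
  have y0 : 0 <= \sum_(c < b) N (Y c o) by apply: sumr_ge0 => c _; exact: pnorm_ge0.
  have tot : N (\sum_(i < l) f (Z (n.+1 + i)%N o)) <=
      \sum_(c < b) N (Y c o) + r%:R * s.
    by rewrite dec; apply: (le_trans (pnorm_triangle _ _ q1)); exact: lerD.
  have x0 := pnorm_ge0 q (\sum_(i < l) f (Z (n.+1 + i)%N o)).
  have rbl : r%:R * r%:R * s ^+ 2 <= b%:R * l%:R * s ^+ 2.
    by rewrite -!natrM ler_wpM2r ?sqr_ge0 // ler_nat leq_mul.
  exact: (blocks_and_rest_arith x0 tot sq rbl).
have bmY (c : 'I_b) : bounded_measurable (fun o => N (Y c o) ^+ 2).
  apply: (@sum_bounded_measurable (n.+1 + c + K * b)) => k.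
  by rewrite ltn_add2l ltn_mul2r b0 ltn_ord.
have bmS := bounded_measurable_sum (index_enum 'I_b) (P := predT) (fun c _ => bmY c).
have bmc := bounded_measurable_cst Omega (2 * (b%:R * (l%:R * s ^+ 2))).
have bmL : bounded_measurable (fun o => N (\sum_(i < l) f (Z (n.+1 + i)%N o)) ^+ 2).
  by apply: (@sum_bounded_measurable (n.+1 + l)) => k; rewrite ltn_add2l.
have bmR := bounded_measurableD (bounded_measurableZ 2 (bounded_measurableZ b%:R bmS)) bmc.
apply: (le_trans (bint_le (P_fin P) mH bmL bmR (fun o _ => pw o))).
rewrite (bintD (P_fin P) mH (bounded_measurableZ 2 (bounded_measurableZ b%:R bmS)) bmc).
rewrite (bintZ (P_fin P) 2 mH (bounded_measurableZ b%:R bmS)) (bintZ (P_fin P) b%:R mH bmS).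
rewrite cstE (bint_sum (P_fin P) _ mH (fun c _ => bmY c)).
have each (c : 'I_b) : E (history t n.+1 js zs) (fun o => N (Y c o) ^+ 2) <=
    p * (601 * q * K%:R * s ^+ 2).
  by rewrite pE; apply: residue_variance; rewrite -addSnnS leq_addr || (rewrite addSn -addnS leq_addr).
have sumE : \sum_(c < b) E (history t n.+1 js zs) (fun o => N (Y c o) ^+ 2) <=
    b%:R * (p * (601 * q * K%:R * s ^+ 2)).
  rewrite mulr_natl -[b in leRHS]card_ord -sumr_const.
  by apply: ler_sum => c _; exact: each.
have Kb : K%:R * b%:R <= (l%:R : R) by rewrite -natrM ler_nat.
exact: (chain_variance_arith q2 (ler0n R b) (ler0n R l) p0 (sqr_ge0 s) Kb sumE).
Qed.

End Centered.
End Variance.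

(** * Iterates and noises as functions of a history *)

Section Dependence.
Context (R : realType) (d : nat) (S : Type).
Context (X : set 'rV[R]_d) (w : 'rV[R]_d -> \bar R) (dw : 'rV[R]_d -> 'rV[R]_d).
Context (F : 'rV[R]_d -> 'rV[R]_d) (Fo : 'rV[R]_d -> S -> 'rV[R]_d).
Context (gamma : R) (B M : nat) (x0 : 'rV[R]_d).
Implicit Types (zs : nat -> S) (js : nat -> nat).
Local Notation st := (state X w dw Fo gamma B M x0).
Local Notation ext := (extrapolated X w dw Fo gamma B M x0).
Local Notation lmean := (level_mean X w dw Fo gamma B M x0).
Local Notation lnoise := (level_noise X w dw Fo gamma B M x0).
Local Notation gh := (ghost X w dw Fo gamma B M x0).
Local Notation top := (top_level M).

(** The index N_t, which depends on the levels only. *)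
Definition clock js t := (\sum_(i < t) (B + 2 ^ js i * B))%N.

(** Enough samples for the batches of every admissible level at time t, so that the
noises at all levels are functions of one history; the successor accounts for
Z_0, which no batch reads. *)
Definition horizon t js := (clock js t + (B + 2 ^ top * B)).+1.

Lemma clockS js t : clock js t.+1 = (clock js t + (B + 2 ^ js t * B))%N.
Proof. by rewrite /clock big_ord_recr. Qed.

Lemma state_clock zs js t : (st zs js t).2 = clock js t.
Proof.
elim: t => [|t IH]; first by rewrite /clock big_ord0.
by rewrite clockS -IH addnA.
Qed.

Lemma clock_depth t k : depth t (fun js => (clock js t + k).+1).
Proof.
move=> js js' h; congr (_ + _).+1; apply: eq_bigr => i _; by rewrite h.
Qed.

Lemma horizon_depth t : depth t (horizon t).
Proof. exact: clock_depth. Qed.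

Lemma clock_agree t js js' : agree t js js' -> clock js t = clock js' t.
Proof. by move=> h; apply: eq_bigr => i _; rewrite h. Qed.

Lemma batch_agree zs zs' x n l : agree (n + l).+1 zs zs' ->
  batch Fo zs x n l = batch Fo zs' x n l.
Proof.
move=> h; congr (_ *: _); apply: eq_big_nat => i /andP[_ il].
by rewrite h // ltnS leq_add2l -ltnS.
Qed.

Lemma half_step_agree zs zs' s : agree (s.2 + B).+1 zs zs' ->
  half_step X w dw Fo gamma B zs s = half_step X w dw Fo gamma B zs' s.
Proof. by move=> h; rewrite /half_step (batch_agree _ h). Qed.

Lemma level_batch_agree zs zs' s j : agree (s.2 + (B + 2 ^ j * B)).+1 zs zs' ->
  level_batch X w dw Fo gamma B zs s j = level_batch X w dw Fo gamma B zs' s j.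
Proof.
move=> h; rewrite /level_batch (@half_step_agree zs zs'); last first.
  by apply: agree_le h; rewrite ltnS leq_add2l leq_addr.
by apply: batch_agree; rewrite -addnA.
Qed.

(** The bound k serves two purposes: it is 2 ^ j when j is the level drawn, and the
largest admissible power of two when j ranges over all levels. *)
Lemma mlmc_estimator_agree zs zs' s j k : (1 <= k)%N -> ((2 ^ j <= M)%N -> (2 ^ j <= k)%N) ->
  agree (s.2 + (B + k * B)).+1 zs zs' ->
  mlmc_estimator X w dw Fo gamma B M zs s j = mlmc_estimator X w dw Fo gamma B M zs' s j.
Proof.
move=> k1 jk h; rewrite /mlmc_estimator.
have lev i : (2 ^ i <= k)%N ->
    level_batch X w dw Fo gamma B zs s i = level_batch X w dw Fo gamma B zs' s i.
  move=> ik; apply: level_batch_agree; apply: agree_le h.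
  by rewrite ltnS !leq_add2l leq_mul2r ik orbT.
rewrite (lev 0%N) //; case: ifPn => // /jk jk'.
rewrite (lev j) // (lev j.-1) //; apply: leq_trans jk'.
by rewrite leq_exp2l // leq_pred.
Qed.

Lemma state_agree t zs zs' js js' : agree t js js' -> agree (clock js t).+1 zs zs' ->
  st zs js t = st zs' js' t.
Proof.
elim: t => [|t IH] // hj hz.
have hj' := agree_le (leqnSn t) hj.
have hz' : agree (clock js t).+1 zs zs' by apply: agree_le hz; rewrite ltnS clockS leq_addr.
have e := IH hj' hz'.
rewrite /state /= -/(st zs js t) -/(st zs' js' t) -e -(hj t) // /mirror_prox_step.
rewrite (@mlmc_estimator_agree zs zs' _ _ (2 ^ js t)) //; first by rewrite expn_gt0.
by rewrite state_clock -clockS.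
Qed.

Lemma extrapolated_agree t zs zs' js js' : agree t js js' ->
  agree (clock js t + B).+1 zs zs' -> ext zs js t = ext zs' js' t.
Proof.
move=> hj hz; rewrite /extrapolated (@state_agree t zs zs' js js') //; last first.
  by apply: agree_le hz; rewrite ltnS leq_addr.
by apply: half_step_agree; rewrite state_clock -(clock_agree hj).
Qed.

Lemma level_mean_agree t j zs zs' js js' : agree t js js' ->
  agree (clock js t + (B + 2 ^ j * B)).+1 zs zs' ->
  lmean zs js t j = lmean zs' js' t j.
Proof.
move=> hj hz; rewrite /level_mean (@state_agree t zs zs' js js') //; last first.
  by apply: agree_le hz; rewrite ltnS leq_addr.
by apply: level_batch_agree; rewrite state_clock -(clock_agree hj).
Qed.

Lemma le_top_level j : (2 ^ j <= M)%N -> (2 ^ j <= 2 ^ top)%N.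
Proof. by move=> h; rewrite leq_exp2l // trunc_log_max. Qed.

Lemma level_noise_agree t j zs zs' js js' : agree t js js' ->
  agree (horizon t js) zs zs' -> lnoise zs js t j = lnoise zs' js' t j.
Proof.
move=> hj hz; rewrite /level_noise (level_mean_agree hj hz); congr (_ - _).
rewrite (@state_agree t zs zs' js js') //; last first.
  by apply: agree_le hz; rewrite ltnS leq_addr.
apply: (@mlmc_estimator_agree _ _ _ _ (2 ^ top)); first by rewrite expn_gt0.
  exact: le_top_level.
by rewrite state_clock -(clock_agree hj).
Qed.

Lemma ghost_agree t zs zs' js js' : agree t js js' ->
  agree (horizon t js) zs zs' -> gh zs js t = gh zs' js' t.
Proof.
elim: t => [|t IH] hj hz; first by [].
have hj' := agree_le (leqnSn t) hj.
have hz' : agree (horizon t js) zs zs'.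
  by apply: agree_le hz; rewrite ltnS leq_add2r clockS leq_addr.
rewrite [LHS]/= [RHS]/= (IH hj' hz') -(hj t (ltnSn t)).
by rewrite (level_noise_agree (js t) hj' hz').
Qed.

Lemma average_agree T zs zs' js js' : agree T js js' -> agree (horizon T js) zs zs' ->
  mirror_prox_average X w dw Fo gamma B M x0 zs js T =
  mirror_prox_average X w dw Fo gamma B M x0 zs' js' T.
Proof.
move=> hj hz; congr (_ *: _); apply: eq_bigr => t _.
apply: (extrapolated_agree (t := t)); first by apply: agree_le hj; exact: ltnW.
apply: agree_le hz; rewrite ltnS; apply: leq_trans (leq_addr _ _).
apply: (@leq_trans (clock js t.+1)); first by rewrite clockS leq_add2l leq_addr.
have mono a b : (a <= b)%N -> (clock js a <= clock js b)%N.
  elim: b => [|b IH]; first by rewrite leqn0 => /eqP ->.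
  rewrite leq_eqVlt => /predU1P[->//|]; rewrite ltnS => /IH /leq_trans; apply.
  by rewrite clockS leq_addr.
exact: mono.
Qed.

End Dependence.

(** * The noise of the estimators *)

Lemma sqr_four_arith (R : realType) (x a b k c e : R) :
  0 <= x -> x <= a + b + k * (c + e) ->
  x ^+ 2 <= 4 * (a ^+ 2 + b ^+ 2) + 4 * (k * k) * (c ^+ 2 + e ^+ 2).
Proof.
move=> x0 xle; have y0 := le_trans x0 xle.
have h1 : x ^+ 2 <= (a + b + k * (c + e)) ^+ 2 by apply: lerXn2r; rewrite ?nnegrE.
have h := sqr_sum_le (fun i : 'I_4 => nth 0 [:: a; b; k * c; k * e] i).
rewrite !big_ord_recr !big_ord0 /= !add0r in h.
apply: (le_trans h1); rewrite mulrDr addrA; apply: (le_trans h).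
by rewrite le_eqVlt; apply/orP; left; apply/eqP; ring.
Qed.

Lemma sqr_two_arith (R : realType) (x a b : R) : 0 <= x -> x <= a + b ->
  x ^+ 2 <= 4 * (a ^+ 2 + b ^+ 2).
Proof.
move=> x0 xle; have := @sqr_four_arith R x a b 0 0 0 x0.
by rewrite !mul0r mulr0 mul0r !addr0; apply.
Qed.

Section NoiseBounds.
Context (R : realType) (d : nat) (S : Type).
Context (X : set 'rV[R]_d) (w : 'rV[R]_d -> \bar R) (dw : 'rV[R]_d -> 'rV[R]_d).
Context (F : 'rV[R]_d -> 'rV[R]_d) (Fo : 'rV[R]_d -> S -> 'rV[R]_d).
Context (gamma : R) (B M : nat) (x0 : 'rV[R]_d).
Hypotheses (hB : (0 < B)%N) (hM : (0 < M)%N).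
Context (q s : R).
Hypothesis q1 : 1 <= q.
Hypothesis hs : forall x z, pnorm q (Fo x z - F x) <= s.
Context (zs : nat -> S) (js : nat -> nat) (t : nat).
Local Notation N := (pnorm q).
Local Notation st := (state X w dw Fo gamma B M x0 zs js t).
Local Notation ext := (extrapolated X w dw Fo gamma B M x0 zs js t).
Local Notation lmean := (level_mean X w dw Fo gamma B M x0 zs js t).
Local Notation lnoise := (level_noise X w dw Fo gamma B M x0 zs js t).
Local Notation top := (top_level M).

Definition level_error j := lmean j - F ext.

Let q0 : 0 < q. Proof. by apply: lt_le_trans q1. Qed.

Lemma batch_error x n l : (0 < l)%N ->
  batch Fo zs x n l - F x = l%:R^-1 *: \sum_(i < l) (Fo x (zs (n.+1 + i)%N) - F x).
Proof.
move=> l0; rewrite sumrB sumr_const card_ord scalerBr -[F x *+ l]scaler_nat scalerA.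
rewrite mulVf ?pnatr_eq0 -?lt0n // scale1r; congr (_ *: _ - _).
rewrite big_add1 /= big_mkord; apply: eq_bigr => i _; by rewrite addSnnS.
Qed.

Lemma batch_error_norm x n l : (0 < l)%N -> N (batch Fo zs x n l - F x) <= s.
Proof.
move=> l0; rewrite batch_error // pnormZ // ger0_norm ?invr_ge0 //.
rewrite ler_pdivrMl ?ltr0n //; apply: (le_trans (pnorm_sum _ _ _ q1)).
rewrite [leRHS]mulr_natl -[l in leRHS]card_ord -sumr_const.
by apply: ler_sum => i _; exact: hs.
Qed.

Lemma level_error_norm j : N (level_error j) <= s.
Proof. by apply: batch_error_norm; rewrite muln_gt0 expn_gt0. Qed.

(** Both noises are expressed through the errors of batches evaluated at the same
point, in which F cancels. *)
Lemma level_noiseE j : lnoise j = level_error 0 - level_error top +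
  (if (j <= top)%N then 2 ^+ j *: (level_error j - level_error j.-1) else 0).
Proof.
rewrite /level_noise /mlmc_estimator /level_error.
have -> : (2 ^ j <= M)%N = (j <= top)%N.
  apply/idP/idP; first exact: trunc_log_max.
  move=> jt; apply: (@leq_trans (2 ^ top)); first by rewrite leq_exp2l.
  exact: trunc_logP.
rewrite !opprB !addrA !subrK; case: ifP => _; last by rewrite addr0.
by rewrite [RHS]addrAC; congr (_ + _ - _).
Qed.

Lemma level_noise_above j : (top < j)%N -> lnoise j = lnoise top.+1.
Proof. by move=> tj; rewrite !level_noiseE ltnn leqNgt tj. Qed.

(** The left-hand side is the mean over a geometric level. The probability 2^-a
cancels the weight 2^a of the correction at level a, and the differences of
consecutive batch errors telescope to the term subtracted from all levels. *)
Lemma level_noise_mean :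
  lnoise top.+1 +
    \sum_(1 <= a < top.+1) (2^-1 : R) ^+ a *: (lnoise a - lnoise top.+1) = 0.
Proof.
have -> : \sum_(1 <= a < top.+1) (2^-1 : R) ^+ a *: (lnoise a - lnoise top.+1)
    = \sum_(1 <= a < top.+1) (level_error a - level_error a.-1).
  apply: eq_big_nat => a /andP[_ at1]; rewrite !level_noiseE ltnn -ltnS at1 addr0.
  by rewrite addrAC subrr add0r scalerA -exprMn mulVf ?expr1n ?scale1r // pnatr_eq0.
rewrite level_noiseE ltnn addr0 big_add1 /=.
by rewrite telescope_sumr // addrC subrKA subrr.
Qed.

Lemma level_noise_sqr j : N (lnoise j) ^+ 2 <=
  4 * (N (level_error 0) ^+ 2 + N (level_error top) ^+ 2) +
  (if (j <= top)%N then
     4 * (2 ^+ j * 2 ^+ j) * (N (level_error j) ^+ 2 + N (level_error j.-1) ^+ 2) else 0).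
Proof.
have h0 := pnorm_ge0 q (level_error 0); have h1 := pnorm_ge0 q (level_error top).
have tri (a b : 'rV[R]_d) : N (a - b) <= N a + N b.
  by apply: (le_trans (pnorm_triangle _ _ q1)); rewrite pnormN.
rewrite level_noiseE; case: ifP => _.
  have h2 : N (level_error 0 - level_error top +
        2 ^+ j *: (level_error j - level_error j.-1)) <=
      N (level_error 0) + N (level_error top) +
      2 ^+ j * (N (level_error j) + N (level_error j.-1)).
    apply: (le_trans (pnorm_triangle _ _ q1)); apply: lerD; first exact: tri.
    by rewrite pnormZ // ger0_norm ?exprn_ge0 // ler_wpM2l ?exprn_ge0.
  exact: (sqr_four_arith (pnorm_ge0 _ _) h2).
rewrite !addr0; exact: (sqr_two_arith (pnorm_ge0 _ _) (tri _ _)).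
Qed.

End NoiseBounds.

(** * Expected regret *)

Lemma top_bound_arith (R : realType) (a c u v k : R) :
  a <= v -> c <= v -> u <= 4 * k * (v + v) -> 4 * (a + c) + u <= 8 * v + 8 * k * v.
Proof. by move=> *; lra. Qed.

Lemma mixture_arith (R : realType) (u v i g y : R) :
  v <= (1 - i) * y + u -> i * g <= i * y -> g + (v - (1 - i) * g) <= y + u.
Proof. by move=> *; lra. Qed.

Lemma adjacent_levels_arith (R : realType) (k u v l : R) :
  2 * k * u <= l -> k * v <= l -> 4 * (2 * k) * (u + v) <= 12 * l.
Proof. by move=> *; lra. Qed.

Lemma level_total_arith (R : realType) (u l x y m : R) :
  u <= m * (12 * l) -> y <= l -> x <= l -> 4 * (y + x) + u <= (8 + 12 * m) * l.
Proof. by move=> *; lra. Qed.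

Lemma level_weight_arith (R : realType) (i k u : R) : i * k = 1 ->
  i * (4 * (k * k) * u) = 4 * k * u.
Proof.
move=> ik; have -> : i * (4 * (k * k) * u) = (i * k) * (4 * k * u) by ring.
by rewrite ik mul1r.
Qed.

Lemma abs_le_half_sqr (R : realType) (u n c a e : R) :
  `|u| <= n * c -> n ^+ 2 <= a -> c ^+ 2 / 2 <= e -> `|u| <= a / 2 + e.
Proof. by move=> h1 h2 h3; have := mul_le_sqr_half n c; lra. Qed.

Section Expectations.
Context (R : realType) (dS : measure_display) (S : measurableType dS).
Hypotheses (hScount : countable [set: S]) (hSmeas : forall z : S, measurable [set z]).
Context (Q : R.-pker S ~> S) (pi : probability S R).
Hypothesis hinv : invariant_distribution Q pi.
Context (b : nat).
Hypothesis b0 : (0 < b)%N.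
Hypothesis hb : forall (phi : S -> R) (c : R) z, 0 <= c -> (forall x, `|phi x| <= c) ->
  \int[pi]_x phi x = 0 -> `|iter b (transition Q) phi z| <= c / 2.
Context (d : nat) (p q : R).
Hypothesis hp : 1 <= p <= 2.
Hypothesis q2 : 2 <= q.
Hypothesis hpq : forall y z : 'rV[R]_d, dotp y z <= pnorm q y * pnorm p z.
Context (X : set 'rV[R]_d) (w : 'rV[R]_d -> \bar R) (dw : 'rV[R]_d -> 'rV[R]_d).
Hypotheses (hXcompact : compact X) (hXconvex : @convex_set R _ X).
Hypothesis (hw : distance_generating p X w dw).
Context (F : 'rV[R]_d -> 'rV[R]_d) (Fo : 'rV[R]_d -> S -> 'rV[R]_d) (s : R).
Hypothesis hs : forall x z, pnorm q (Fo x z - F x) <= s.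
Hypothesis hcent : forall x, centered pi (fun z => Fo x z - F x).
Context (dO : measure_display) (Omega : measurableType dO) (P : probability Omega R).
Context (Z : nat -> {RV P >-> S}) (J : nat -> {RV P >-> nat}).
Hypotheses (hZ : markov_chain Q Z) (hJ : geometric_half J) (hJZ : independent_levels Z J).
Context (gamma : R) (B M : nat) (x0 : 'rV[R]_d).
Hypotheses (hB : (0 < B)%N) (hM : (0 < M)%N) (hx0 : X x0).

Local Notation N := (@pnorm R d q).
Local Notation E D f := (\int[P]_(o in D) f o).
Local Notation pr D := (fine (P D)).
Local Notation history := (history Z J).
Local Notation path := (path Z).
Local Notation levels := (levels J).
Local Notation top := (top_level M).
Local Notation st := (state X w dw Fo gamma B M x0).
Local Notation ext := (extrapolated X w dw Fo gamma B M x0).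
Local Notation err := (level_error X w dw F Fo gamma B M x0).
Local Notation xi := (level_noise X w dw Fo gamma B M x0).
Local Notation gh := (ghost X w dw Fo gamma B M x0).
Local Notation D2 := (bregman_diam2 X w dw).

Let q1 : 1 <= q. Proof. by apply: le_trans q2; rewrite ler1n. Qed.
Let q0 : 0 < q. Proof. by apply: lt_le_trans q1. Qed.
Let s0 : 0 <= s. Proof. by apply: le_trans (hs 0 point); exact: pnorm_ge0. Qed.

(** Upper bound on l times the mean square of the error of a batch of size l. *)
Definition variance_proxy := 1203 * q * b%:R * s ^+ 2.
Local Notation lam := variance_proxy.

Lemma variance_proxy_ge0 : 0 <= lam.
Proof.
rewrite /variance_proxy; apply: mulr_ge0; last exact: sqr_ge0.
apply: mulr_ge0; last exact: ler0n.
by apply: mulr_ge0; [exact: ler0n|exact: ltW].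
Qed.

Lemma expectation_cst (k : R) : E setT (fun=> k) = k.
Proof.
rewrite bint_cst //; have -> : pr setT = 1 :> R by rewrite probability_setT.
by rewrite mulr1.
Qed.

(** The evaluation point and the starting index of the batch are constant on each
history of depth N_t + k + 1, so that the variance bound of the chain applies with
a fixed function. *)
Lemma batch_variance t k l (xf : (nat -> S) -> (nat -> nat) -> 'rV[R]_d) :
  (0 < l)%N -> adapted t (fun js => (clock B js t + k).+1) xf ->
  bounded_measurable (fun o => N (batch Fo (path o) (xf (path o) (levels o))
     (clock B (levels o) t + k) l - F (xf (path o) (levels o))) ^+ 2) /\
  E setT (fun o => N (batch Fo (path o) (xf (path o) (levels o))
     (clock B (levels o) t + k) l - F (xf (path o) (levels o))) ^+ 2) <= lam / l%:R.
Proof.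
move=> l0 hx; set f := (fun o => _).
have bmf : bounded_measurable f.
  apply: (adapted_bounded_measurable hScount hSmeas Z J (t := t)
    (n := fun js => (clock B js t + (k + l)).+1)
    (f := fun zs js => N (batch Fo zs (xf zs js) (clock B js t + k) l - F (xf zs js)) ^+ 2)).
  - exact: clock_depth.
  - move=> zs zs' js js' hj hz.
    have -> : xf zs js = xf zs' js'.
      by apply: hx => //; apply: agree_le hz; rewrite ltnS leq_add2l leq_addr.
    rewrite -(clock_agree B hj) (@batch_agree _ _ _ Fo zs zs') //.
    by rewrite -addnA.
  - exists (s ^+ 2) => zs js; apply: norm_sqr_bound.
    exact: (batch_error_norm q1 hs).
split=> //; rewrite -[leRHS]expectation_cst.
have bmc := bounded_measurable_cst Omega (lam / l%:R).
apply: (global_split_le (Z := Z) (J := J) hScount hSmeas (@clock_depth B t k) bmf bmc).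
move=> js zs; set H := history _ _ _ _.
have mH : measurable H by exact: history_measurable.
pose x := xf zs js; pose n := (clock B js t + k)%N.
pose V o := N (\sum_(i < l) (Fo x (Z (n.+1 + i)%N o) - F x)) ^+ 2.
have bmV : bounded_measurable V.
  have ki (i : 'I_l) : (n.+1 + i < n.+1 + l)%N by rewrite ltn_add2l.
  exact: (sum_bounded_measurable hScount hSmeas q2 Z J (f := fun z => Fo x z - F x)
    (hs x) predT ki).
have -> : E H f = E H (fun o => (l%:R ^- 2) * V o).
  apply: eq_Rintegral => o; rewrite inE => -[h1 h2]; rewrite /f.
  have -> : xf (path o) (levels o) = x by symmetry; apply: hx; exact: agreeC.
  rewrite (clock_agree B h1) -/n batch_error // pnormZ // exprMn ger0_norm ?invr_ge0 //.
  by rewrite exprVn.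
rewrite (bintZ (P_fin P) _ mH bmV) bint_cst //.
have l1 : 0 < (l%:R : R) by rewrite ltr0n.
have cv := chain_variance hScount hSmeas hinv b0 hb q2 hZ hJZ (hcent x) (hs x) t n js zs l.
rewrite ler_pdivrMl ?exprn_gt0 //; apply: (le_trans cv).
rewrite le_eqVlt; apply/orP; left; apply/eqP; rewrite /variance_proxy.
move: (s ^+ 2) (fine _) (b%:R : R) (q : R) => ss pp bb qq.
have lN : l%:R != 0 :> R by rewrite gt_eqF.
by move: (l%:R : R) lN => ll lN; field.
Qed.

Lemma step_noise_variance t :
  bounded_measurable (fun o => N (step_noise X w dw F Fo gamma B M x0 (path o) (levels o) t) ^+ 2) /\
  E setT (fun o => N (step_noise X w dw F Fo gamma B M x0 (path o) (levels o) t) ^+ 2)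
    <= lam / B%:R.
Proof.
have hx : adapted t (fun js => (clock B js t + 0).+1) (fun zs js => (st zs js t).1).
  by move=> zs zs' js js' hj; rewrite addn0 => hz; rewrite (state_agree X w dw Fo gamma M x0 hj hz).
have [h1 h2] := batch_variance hB hx.
have e : (fun o => N (step_noise X w dw F Fo gamma B M x0 (path o) (levels o) t) ^+ 2) =
    (fun o => N (batch Fo (path o) (st (path o) (levels o) t).1
       (clock B (levels o) t + 0) B - F (st (path o) (levels o) t).1) ^+ 2).
  by apply/funext => o; rewrite /step_noise state_clock addn0.
rewrite e; exact: (conj h1 h2).
Qed.

Lemma level_error_variance t j :
  bounded_measurable (fun o => N (err (path o) (levels o) t j) ^+ 2) /\
  E setT (fun o => N (err (path o) (levels o) t j) ^+ 2) <= lam / (2 ^+ j * B%:R).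
Proof.
have hx : adapted t (fun js => (clock B js t + B).+1) (fun zs js => ext zs js t).
  by move=> zs zs' js js' hj hz; exact: extrapolated_agree hj hz.
have l0 : (0 < 2 ^ j * B)%N by rewrite muln_gt0 expn_gt0.
have [h1 h2] := batch_variance l0 hx; rewrite natrM natrX in h2.
have e : (fun o => N (err (path o) (levels o) t j) ^+ 2) =
    (fun o => N (batch Fo (path o) (ext (path o) (levels o) t)
       (clock B (levels o) t + B) (2 ^ j * B) - F (ext (path o) (levels o) t)) ^+ 2).
  by apply/funext => o; rewrite /level_error /level_mean /level_batch state_clock.
rewrite e; exact: (conj h1 h2).
Qed.

Lemma level_noise_bound zs js t j :
  N (xi zs js t j) ^+ 2 <= 8 * s ^+ 2 + 8 * (2 ^+ top * 2 ^+ top) * s ^+ 2.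
Proof.
have e2 i : N (err zs js t i) ^+ 2 <= s ^+ 2.
  by apply: lerXn2r; rewrite ?nnegrE ?pnorm_ge0 //; exact: level_error_norm.
have k0 : 0 <= 2 ^+ top * 2 ^+ top :> R by rewrite mulr_ge0 ?exprn_ge0.
apply: (le_trans (level_noise_sqr X w dw F Fo gamma B x0 hM q1 zs js t j)).
have hj : (if (j <= top)%N then 4 * (2 ^+ j * 2 ^+ j) *
     (N (err zs js t j) ^+ 2 + N (err zs js t j.-1) ^+ 2) else 0)
   <= 4 * (2 ^+ top * 2 ^+ top) * (s ^+ 2 + s ^+ 2).
  case: ifP => jt; last by rewrite mulr_ge0 ?addr_ge0 ?sqr_ge0 // mulr_ge0.
  apply: ler_pM; rewrite ?addr_ge0 ?sqr_ge0 ?mulr_ge0 ?exprn_ge0 //; last exact: lerD.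
  by rewrite ler_wpM2l // ler_pM ?exprn_ge0 // ler_weXn2l // ler1n.
have h0 := e2 0%N; have h1 := e2 top.
exact: top_bound_arith h0 h1 hj.
Qed.

Lemma level_noise_adapted t j : adapted t (horizon B M t) (fun zs js => xi zs js t j).
Proof. by move=> zs zs' js js'; exact: level_noise_agree. Qed.

(** Level a is drawn with probability 2^-a, its correction carries the square
weight 4^a and the two batches have mean squares of order 2^-a: every level up to
the top one contributes 12 lam / B. *)
Lemma level_noise_variance t :
  bounded_measurable (fun o => N (xi (path o) (levels o) t (levels o t)) ^+ 2) /\
  E setT (fun o => N (xi (path o) (levels o) t (levels o t)) ^+ 2)
    <= (8 + 12 * top%:R) * (lam / B%:R).
Proof.
pose G j zs js := N (xi zs js t j) ^+ 2.
have hG j : adapted t (horizon B M t) (G j).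
  by move=> zs zs' js js' hj hz; rewrite /G (level_noise_adapted j hj hz).
pose c := 8 * s ^+ 2 + 8 * (2 ^+ top * 2 ^+ top) * s ^+ 2.
have bG j zs js : `|G j zs js| <= c.
  by rewrite ger0_norm ?sqr_ge0 //; exact: level_noise_bound.
have Gtop j : (top < j)%N -> G j = G top.+1.
  by move=> tj; apply/funext => zs; apply/funext => js; rewrite /G level_noise_above.
have bm1 : bounded_measurable (fun o => N (xi (path o) (levels o) t (levels o t)) ^+ 2).
  apply: (adapted_bounded_measurable hScount hSmeas Z J (t := t.+1) (n := horizon B M t)
    (f := fun zs js => G (js t) zs js)).
  - by move=> js js' /(agree_le (leqnSn t)); exact: horizon_depth.
  - move=> zs zs' js js' h1 h2; rewrite (h1 t (ltnSn t)); apply: hG => //.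
    exact: agree_le h1.
  - by exists c.
split=> //.
have := level_average hScount hSmeas hJ hJZ (@horizon_depth B M t) hG bG Gtop.
rewrite [X in X = _ -> _](_ : _ =
  E setT (fun o => N (xi (path o) (levels o) t (levels o t)) ^+ 2)) // => ->.
pose e j o := N (err (path o) (levels o) t j) ^+ 2.
have be j : bounded_measurable (e j) by have [] := level_error_variance t j.
have Ee j : E setT (e j) <= lam / (2 ^+ j * B%:R) by have [] := level_error_variance t j.
have bmG j : bounded_measurable (fun o => G j (path o) (levels o)).
  by apply: (adapted_bounded_measurable hScount hSmeas Z J (@horizon_depth B M t) (hG j)); exists c.
have pw o : G top.+1 (path o) (levels o) + \sum_(1 <= a < top.+1)
     2^-1 ^+ a * (G a (path o) (levels o) - G top.+1 (path o) (levels o)) <=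
   4 * (e 0%N o + e top o) + \sum_(1 <= a < top.+1) 4 * 2 ^+ a * (e a o + e a.-1 o).
  have split : \sum_(1 <= a < top.+1)
       2^-1 ^+ a * (G a (path o) (levels o) - G top.+1 (path o) (levels o)) =
     \sum_(1 <= a < top.+1) 2^-1 ^+ a * G a (path o) (levels o)
     - (1 - 2^-1 ^+ top) * G top.+1 (path o) (levels o).
    rewrite -geometric_sum mulr_suml -sumrB.
    by apply: eq_bigr => a _; rewrite mulrBr.
  have top1 : G top.+1 (path o) (levels o) <= 4 * (e 0%N o + e top o).
    by have := level_noise_sqr X w dw F Fo gamma B x0 hM q1 (path o) (levels o) t top.+1;
       rewrite ltnn addr0.
  have low : \sum_(1 <= a < top.+1) 2^-1 ^+ a * G a (path o) (levels o) <=
     (1 - 2^-1 ^+ top) * (4 * (e 0%N o + e top o)) +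
     \sum_(1 <= a < top.+1) 4 * 2 ^+ a * (e a o + e a.-1 o).
    rewrite -geometric_sum mulr_suml -big_split /= big_nat_cond [leRHS]big_nat_cond.
    apply: ler_sum => a /andP[/andP[_ at1] _].
    have h := level_noise_sqr X w dw F Fo gamma B x0 hM q1 (path o) (levels o) t a.
    rewrite -ltnS at1 in h.
    have p0 : 0 <= 2^-1 ^+ a :> R by rewrite exprn_ge0.
    apply: (le_trans (ler_wpM2l p0 h)); rewrite mulrDr lerD2l.
    have pa : 2^-1 ^+ a * 2 ^+ a = 1 :> R by rewrite -exprMn mulVf ?expr1n // pnatr_eq0.
    rewrite (level_weight_arith _ pa); exact: lexx.
  have i0 : 0 <= 2^-1 ^+ top :> R by rewrite exprn_ge0.
  rewrite split; exact: mixture_arith low (ler_wpM2l i0 top1).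
have bmL : bounded_measurable (fun o => G top.+1 (path o) (levels o) +
   \sum_(1 <= a < top.+1)
     2^-1 ^+ a * (G a (path o) (levels o) - G top.+1 (path o) (levels o))).
  apply: bounded_measurableD; first exact: bmG.
  apply: bounded_measurable_sum => a _.
  apply: bounded_measurableZ; exact: (bounded_measurableB (bmG a) (bmG top.+1)).
have bT := bounded_measurableZ 4 (bounded_measurableD (be 0%N) (be top)).
have bU a := bounded_measurableZ (4 * 2 ^+ a) (bounded_measurableD (be a) (be a.-1)).
have bS := bounded_measurable_sum (index_iota 1 top.+1) (P := predT) (fun a _ => bU a).
apply: (le_trans (bint_le (P_fin P) measurableT bmL (bounded_measurableD bT bS) (fun o _ => pw o))).
rewrite (bintD (P_fin P) measurableT bT bS) (bintZ (P_fin P) 4 measurableT (bounded_measurableD (be 0%N) (be top))).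
rewrite (bintD (P_fin P) measurableT (be 0%N) (be top)).
rewrite (bint_sum (P_fin P) _ measurableT (fun a _ => bU a)).
have B0 : 0 < (B%:R : R) by rewrite ltr0n.
have lB : 0 <= lam / B%:R by rewrite divr_ge0 ?variance_proxy_ge0 // ltW.
have Ee' j : 2 ^+ j * E setT (e j) <= lam / B%:R.
  rewrite -ler_pdivlMl ?exprn_gt0 //; apply: (le_trans (Ee j)).
  by rewrite invfM mulrCA.
have E1 j : E setT (e j) <= lam / B%:R.
  apply: (le_trans _ (Ee' j)); rewrite ler_peMl //.
    by apply: Rintegral_ge0 => o _; exact: sqr_ge0.
  by rewrite exprn_ege1 // ler1n.
have each a : (0 < a)%N -> E setT (fun o => 4 * 2 ^+ a * (e a o + e a.-1 o)) <= 12 * (lam / B%:R).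
  case: a => // a _; rewrite (bintZ (P_fin P) _ measurableT (bounded_measurableD (be _) (be _))).
  rewrite (bintD (P_fin P) measurableT (be _) (be _)) /=.
  have h1 := Ee' a.+1; have h2 := Ee' a.
  rewrite exprS in h1 *; exact: adjacent_levels_arith h1 h2.
have sumle : \sum_(1 <= a < top.+1) E setT (fun o => 4 * 2 ^+ a * (e a o + e a.-1 o))
    <= top%:R * (12 * (lam / B%:R)).
  apply: (@le_trans _ _ (\sum_(1 <= a < top.+1) 12 * (lam / B%:R))).
    rewrite big_nat_cond [leRHS]big_nat_cond; apply: ler_sum => a /andP[/andP[a1 _] _].
    exact: each.
  by rewrite sumr_const_nat subSS subn0 [leRHS]mulr_natl.
exact: level_total_arith sumle (E1 0%N) (E1 top).
Qed.

Lemma noise_direction_bounded zs js t j :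
  `|dotp (xi zs js t j) (gh zs js t - ext zs js t)| <=
     (8 * s ^+ 2 + 8 * (2 ^+ top * 2 ^+ top) * s ^+ 2) / 2 + D2.
Proof.
have Xg : X (gh zs js t) := ghost_in hXcompact hw gamma Fo B M hx0 zs js t.
have Xe : X (ext zs js t) := extrapolated_in hXcompact hw gamma Fo B M hx0 zs js t.
have hd : `|dotp (xi zs js t j) (gh zs js t - ext zs js t)| <=
    N (xi zs js t j) * pnorm p (gh zs js t - ext zs js t).
  rewrite ler_norml hpq andbT lerNl -dotpNl.
  by apply: (le_trans (hpq _ _)); rewrite pnormN.
apply: (abs_le_half_sqr hd (level_noise_bound zs js t j)).
exact: le_trans (bregman_ge hXconvex hw Xg Xe) (bregman_le_diam2 hXcompact hw Xg Xe).
Qed.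

(** Orthogonality: the direction of the auxiliary sequence is known before the
level is drawn, and the level noise averages to zero over the level whatever
the samples are. *)
Lemma noise_direction_mean t :
  bounded_measurable (fun o => dotp (xi (path o) (levels o) t (levels o t))
    (gh (path o) (levels o) t - ext (path o) (levels o) t)) /\
  E setT (fun o => dotp (xi (path o) (levels o) t (levels o t))
    (gh (path o) (levels o) t - ext (path o) (levels o) t)) = 0.
Proof.
pose G j zs js := dotp (xi zs js t j) (gh zs js t - ext zs js t).
have hG j : adapted t (horizon B M t) (G j).
  move=> zs zs' js js' hj hz; rewrite /G (level_noise_adapted j hj hz).
  rewrite (ghost_agree X w dw Fo gamma x0 hj hz).
  rewrite (extrapolated_agree X w dw Fo gamma M x0 hj (zs' := zs')) //.
  by apply: agree_le hz; rewrite ltnS leq_add2l leq_addr.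
pose c := (8 * s ^+ 2 + 8 * (2 ^+ top * 2 ^+ top) * s ^+ 2) / 2 + D2.
have bG j zs js : `|G j zs js| <= c by exact: noise_direction_bounded.
have Gtop j : (top < j)%N -> G j = G top.+1.
  move=> tj; apply/funext => zs; apply/funext => js.
  by rewrite /G (level_noise_above X w dw F Fo gamma B x0 hM zs js t tj).
split.
  apply: (adapted_bounded_measurable hScount hSmeas Z J (t := t.+1) (n := horizon B M t)
    (f := fun zs js => G (js t) zs js)).
  - by move=> js js' /(agree_le (leqnSn t)); exact: horizon_depth.
  - move=> zs zs' js js' h1 h2; rewrite (h1 t (ltnSn t)); apply: hG; last exact: h2.
    exact: agree_le (leqnSn t) h1.
  - by exists c => zs js; exact: bG.
apply: (etrans (level_average hScount hSmeas hJ hJZ (@horizon_depth B M t) hG bG Gtop)).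
apply: (etrans _ (expectation_cst 0)); congr Rintegral; apply/funext => o.
have := level_noise_mean X w dw F Fo gamma B x0 hM (path o) (levels o) t.
move=> /(congr1 (fun v => dotp v (gh (path o) (levels o) t - ext (path o) (levels o) t))).
rewrite dotp0l dotpDl dotp_suml => h; rewrite -[RHS]h; congr (_ + _).
by apply: eq_bigr => a _; rewrite dotpZl dotpBl.
Qed.

Definition cost_bound T : R :=
  4 * gamma ^+ 2 * ((8 + 12 * top%:R) * (lam / B%:R))
  + 2 * T%:R * gamma ^+ 2 * (lam / (2 ^+ top * B%:R))
  + 3 * gamma ^+ 2 * (lam / B%:R).

Lemma step_cost_mean T t :
  bounded_measurable (fun o => step_cost X w dw F Fo gamma B M x0 q T (path o) (levels o) t) /\
  E setT (fun o => step_cost X w dw F Fo gamma B M x0 q T (path o) (levels o) t)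
    <= cost_bound T.
Proof.
have [b1 e1] := level_noise_variance t; have [b2 e2] := level_error_variance t top.
have [b3 e3] := step_noise_variance t; have [b4 e4] := noise_direction_mean t.
have c1 := bounded_measurableZ (4 * gamma ^+ 2) b1.
have c2 := bounded_measurableZ (2 * T%:R * gamma ^+ 2) b2.
have c3 := bounded_measurableZ (3 * gamma ^+ 2) b3.
have c4 := bounded_measurableZ gamma b4.
have c12 := bounded_measurableD c1 c2; have c123 := bounded_measurableD c12 c3.
split; first exact: bounded_measurableD c123 c4.
apply: (@le_trans _ _ (4 * gamma ^+ 2 * E setT (fun o =>
      N (xi (path o) (levels o) t (levels o t)) ^+ 2)
   + 2 * T%:R * gamma ^+ 2 * E setT (fun o => N (err (path o) (levels o) t top) ^+ 2)
   + 3 * gamma ^+ 2 * E setT (fun o =>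
      N (step_noise X w dw F Fo gamma B M x0 (path o) (levels o) t) ^+ 2)
   + gamma * 0)).
  rewrite le_eqVlt; apply/orP; left; apply/eqP.
  apply: (etrans (bintD (P_fin P) measurableT c123 c4)); congr (_ + _).
    apply: (etrans (bintD (P_fin P) measurableT c12 c3)); congr (_ + _).
      apply: (etrans (bintD (P_fin P) measurableT c1 c2)); congr (_ + _).
        exact: (bintZ (P_fin P)).
      exact: (bintZ (P_fin P)).
    exact: (bintZ (P_fin P)).
  by apply: (etrans (bintZ (P_fin P) _ measurableT b4)); rewrite e4.
have g2 : 0 <= gamma ^+ 2 by exact: sqr_ge0.
rewrite mulr0 addr0; apply: lerD; first apply: lerD.
- by apply: (ler_wpM2l _ e1); apply: mulr_ge0.
- by apply: (ler_wpM2l _ e2); apply: mulr_ge0; first exact: mulr_ge0.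
- by apply: (ler_wpM2l _ e3); apply: mulr_ge0.
Qed.

Context (L : R).
Hypotheses (hL : 0 < L) (hlip : lipschitz_pnorm_on p L X F) (hmono : monotone_on X F).
Hypotheses (hgamma : 0 < gamma) (hgammaL : gamma <= 1 / (2 * L)).

Lemma expected_error T : (2 <= T)%N ->
  ('E_P[fun o => err_vi X F
            (mirror_prox_average X w dw Fo gamma B M x0 (path o) (levels o) T)]
   <= ((3 * D2 + T%:R * cost_bound T) / (gamma * T%:R))%:E)%E.
Proof.
move=> T2; have T0 : (0 < T)%N by apply: ltn_trans T2.
have gT : 0 < gamma * T%:R by rewrite mulr_gt0 // ltr0n.
pose f zs js := err_vi X F (mirror_prox_average X w dw Fo gamma B M x0 zs js T).
pose C o := \sum_(t < T) step_cost X w dw F Fo gamma B M x0 q T (path o) (levels o) t.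
have tb zs js := err_vi_trajectory hp q1 hpq hXcompact hXconvex hw hL hlip hmono
   hgamma hgammaL Fo B M hx0 zs js T2.
have bt (t : 'I_T) : bounded_measurable (fun o =>
    step_cost X w dw F Fo gamma B M x0 q T (path o) (levels o) t).
  by have [] := step_cost_mean T t.
have bC : bounded_measurable C := bounded_measurable_sum (index_enum 'I_T) (fun t _ => bt t).
pose k := 3 * D2.
have bk : bounded_measurable (fun o => (gamma * T%:R)^-1 * (k + C o)).
  apply: bounded_measurableZ; apply: bounded_measurableD; last exact: bC.
  exact: bounded_measurable_cst.
have fle o : 0 <= f (path o) (levels o) <= (gamma * T%:R)^-1 * (k + C o).
  have [h1 h2] := tb (path o) (levels o).
  apply/andP; split; first exact: h1.
  by rewrite ler_pdivlMl //; exact: h2.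
have bf : bounded_measurable (fun o => f (path o) (levels o)).
  split.
    apply: (adapted_measurable hScount hSmeas Z J (@horizon_depth B M T)).
    by move=> zs zs' js js' hj hz; rewrite /f (average_agree X w dw Fo gamma x0 hj hz).
  have [_ [c hc]] := bk; exists c => o; have /andP[h1 h2] := fle o.
  rewrite (ger0_norm h1); apply: (le_trans h2); apply: (le_trans _ (hc o)).
  exact: ler_norm.
have fE : ('E_P[fun o => f (path o) (levels o)] = (E setT (fun o => f (path o) (levels o)))%:E)%E.
  rewrite unlock /Rintegral fineK //; apply: integrable_fin_num => //.
  exact: (bounded_measurable_integrable (P_fin P)).
rewrite [X in (X <= _)%E]fE lee_fin.
apply: (@le_trans _ _ (E setT (fun o => (gamma * T%:R)^-1 * (k + C o)))).
  apply: (bint_le (P_fin P)) => // o _; by have /andP[] := fle o.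
have bk' := bounded_measurable_cst Omega k.
rewrite (bintZ (P_fin P) _ measurableT (bounded_measurableD bk' bC)).
rewrite (bintD (P_fin P) measurableT bk' bC) expectation_cst [leRHS]mulrC.
apply: ler_wpM2l; first by rewrite invr_ge0 ltW.
rewrite /k lerD2l (bint_sum (P_fin P) _ measurableT (fun t _ => bt t)).
have -> : T%:R * cost_bound T = \sum_(t < T) cost_bound T.
  by rewrite sumr_const card_ord [LHS]mulr_natl.
apply: ler_sum => t _; exact: (step_cost_mean T t).2.
Qed.

End Expectations.

(** * The rate *)

Lemma unbiased_centered (R : realType) (dS : measure_display) (S : measurableType dS)
    (hScount : countable [set: S]) (hSmeas : forall z : S, measurable [set z])
    (pi : probability S R) d (q s : R) (F : 'rV[R]_d -> 'rV[R]_d)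
    (Fo : 'rV[R]_d -> S -> 'rV[R]_d) (x : 'rV[R]_d) : 0 < q ->
  (forall i, 'E_pi[fun z => Fo x z ord0 i] = (F x ord0 i)%:E)%E ->
  (forall z, pnorm q (Fo x z - F x) <= s) ->
  centered pi (fun z => Fo x z - F x).
Proof.
move=> q0 unb hs v.
have pifin : (pi setT < +oo)%E by rewrite probability_setT ltry.
have bi i : bounded_measurable (fun z => Fo x z ord0 i : R).
  apply: (discrete_bounded_measurable hScount hSmeas); exists (s + `|F x ord0 i|) => z.
  have := abs_le_pnorm (Fo x z - F x) i q0; rewrite !mxE => h.
  rewrite -[X in `|X|](subrK (F x ord0 i)); apply: (le_trans (ler_normD _ _)).
  by rewrite lerD2r; exact: le_trans h (hs z).
have mean i : \int[pi]_z (Fo x z ord0 i) = F x ord0 i.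
  by have := unb i; rewrite unlock /Rintegral => ->.
have bt i : bounded_measurable (fun z => v ord0 i * (Fo x z - F x) ord0 i).
  apply: bounded_measurableZ.
  have -> : (fun z => (Fo x z - F x) ord0 i) = (fun z => Fo x z ord0 i - F x ord0 i).
    by apply/funext => z; rewrite !mxE.
  by apply: bounded_measurableB => //; exact: bounded_measurable_cst.
rewrite (bint_sum pifin _ measurableT (fun i _ => bt i)) big1 // => i _.
have bc := bounded_measurable_cst S (F x ord0 i).
have -> : (fun z => v ord0 i * (Fo x z - F x) ord0 i) =
    (fun z => v ord0 i * (Fo x z ord0 i - F x ord0 i)).
  by apply/funext => z; rewrite !mxE.
rewrite (bintZ pifin _ measurableT (bounded_measurableB (bi i) bc)).
rewrite (bintB pifin measurableT (bi i) bc) mean bint_cst //.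
have -> : fine (pi setT) = 1 :> R by rewrite probability_setT.
by rewrite mulr1 subrr mulr0.
Qed.

Lemma top_level_le_ln (R : realType) M : (0 < M)%N ->
  (top_level M)%:R <= 2 * ln (M%:R : R).
Proof.
move=> M0; have M1 : 0 < (M%:R : R) by rewrite ltr0n.
have h : (2 : R) ^+ top_level M <= M%:R by rewrite -natrX ler_nat; exact: trunc_logP.
have : ln ((2 : R) ^+ top_level M) <= ln M%:R by rewrite ler_ln ?posrE ?exprn_gt0.
rewrite lnXn // -[leLHS]mulr_natl => h2.
have l2 := ler_wpM2l (ler0n R (top_level M)) (ln2_ge_half R).
by move: h2 l2; move: (ln _) (ln _) ((top_level M)%:R : R) => x y z; lra.
Qed.

Lemma le_double_top_level (R : realType) M : M%:R <= 2 * (2 : R) ^+ top_level M.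
Proof. by rewrite -exprS -natrX ler_nat ltnW // trunc_log_ltn. Qed.

(** Constant multiples of the batch variance are absorbed by T / M + log M, which
is at least log 2 when M > 1 and equals T when M = 1. *)
Lemma one_le_batch_terms (R : realType) M T : (0 < M)%N -> (2 <= T)%N ->
  1 <= 2 * (T%:R * (M%:R)^-1 + ln (M%:R : R)).
Proof.
case: M => // -[|M] _ T2.
    rewrite invr1 mulr1 ln1 addr0; have h : (2%:R : R) <= T%:R by rewrite ler_nat.
  by move: h; move: (T%:R : R) => x; lra.
have l2 := ln2_ge_half R.
have lM : ln (2 : R) <= ln M.+2%:R by rewrite ler_ln ?posrE ?ltr0n // ler_nat.
have t0 : 0 <= (T%:R : R) * (M.+2%:R)^-1 by rewrite mulr_ge0 ?invr_ge0.
by move: (le_trans l2 lM) t0; move: (ln _) (T%:R * _) => x y; lra.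
Qed.

(** Dividing by g T leaves 35 + 48 m + 2 T / k; by m <= 2 lM, 1 / k <= 2 / M and the
lower bound on T / M + lM this is at most 70 + 100 times T / M + lM. *)
Lemma cost_arith (R : realType) (D g T B M l m k lM : R) :
  0 < g -> 0 < T -> 0 < B -> 0 < M -> 0 <= l -> 0 < k ->
  m <= 2 * lM -> M <= 2 * k -> 0 <= lM -> 1 <= 2 * (T * M^-1 + lM) ->
  (3 * D + T * (4 * g ^+ 2 * ((8 + 12 * m) * (l / B)) +
     2 * T * g ^+ 2 * (l / (k * B)) + 3 * g ^+ 2 * (l / B))) / (g * T)
  <= 3 * (D / (g * T)) + 170 * (g * (l / B) * (T * M^-1 + lM)).
Proof.
move=> g0 T0 B0 M0 l0 k0 mlM Mk lM0 W1.
have -> : (3 * D + T * (4 * g ^+ 2 * ((8 + 12 * m) * (l / B)) +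
     2 * T * g ^+ 2 * (l / (k * B)) + 3 * g ^+ 2 * (l / B))) / (g * T) =
   3 * (D / (g * T)) + g * (l / B) * (35 + 48 * m + 2 * (T * k^-1)).
  by field; rewrite !gt_eqF.
rewrite lerD2l [leRHS]mulrCA; apply: ler_wpM2l.
  by rewrite mulr_ge0 ?divr_ge0 // ltW.
have kM : k^-1 <= 2 * M^-1.
  by rewrite -[2]invrK -invfM lef_pV2 ?posrE ?mulr_gt0 ?invr_gt0 // ler_pdivrMl.
have TkM : T * k^-1 <= T * (2 * M^-1) by rewrite ler_wpM2l // ltW.
have TM : 0 <= T * M^-1 by rewrite mulr_ge0 ?invr_ge0 // ltW.
rewrite mulrCA in TkM.
by move: TkM TM W1 mlM lM0; move: (T * k^-1) (T * M^-1) => a c; lra.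
Qed.

(** The factor 8 in K collects s = 4 sg and q <= 2 (1 + ld); the outer factor 2
comes from 1 <= 2 lT. *)
Lemma rate_arith (R : realType) (A D K l q b s sg ld kap tau g Bi W lT : R) :
  0 <= D -> 0 <= kap -> 0 <= tau -> 0 <= g -> 0 <= Bi -> 0 <= W -> 0 <= ld ->
  0 <= A -> 1 / 2 <= lT -> 0 <= b -> 0 <= q ->
  l = A * q * b * s -> s = 4 * sg -> 0 <= sg ->
  q <= 2 * (1 + ld) -> b <= kap * tau ->
  K = A * 8 * kap ->
  3 * D + 170 * (g * (l * Bi) * W) <=
    2 * (3 + 170 * K) * (1 + ld) * lT * (D + g * tau * Bi * W * sg).
Proof.
move=> D0 kap0 tau0 g0 Bi0 W0 ld0 A0 lT0 b0 q0 -> -> sg0 qld bk ->.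
pose Y := g * tau * Bi * W * sg.
have Y0 : 0 <= Y by rewrite /Y !mulr_ge0.
have qb : q * b <= 2 * (1 + ld) * (kap * tau) by apply: ler_pM.
have h1 : g * (A * q * b * (4 * sg) * Bi) * W <= A * 8 * kap * (1 + ld) * Y.
  have -> : g * (A * q * b * (4 * sg) * Bi) * W = (4 * A * g * sg * Bi * W) * (q * b) by ring.
  have -> : A * 8 * kap * (1 + ld) * Y = (4 * A * g * sg * Bi * W) * (2 * (1 + ld) * (kap * tau)).
    by rewrite /Y; ring.
  by rewrite ler_wpM2l // !mulr_ge0.
have K0 : 0 <= A * 8 * kap by rewrite !mulr_ge0.
rewrite -/Y; clearbody Y; clear K; move: (A * 8 * kap) K0 h1 => K K0 h1.
have l1 : 1 <= 1 + ld by rewrite lerDl.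
have c0 : 0 <= 3 + 170 * K by rewrite addr_ge0 // mulr_ge0.
have h2 : 3 * D + 170 * (K * (1 + ld) * Y) <= (3 + 170 * K) * (1 + ld) * (D + Y).
  have e1 : 3 * D <= 3 * (1 + ld) * D by rewrite ler_wpM2r // ler_peMr.
  have e2 : 0 <= K * (1 + ld) * D by rewrite !mulr_ge0 // (le_trans ler01).
  have e3 : 0 <= (1 + ld) * Y by rewrite !mulr_ge0 // (le_trans ler01).
  have -> : (3 + 170 * K) * (1 + ld) * (D + Y) = 3 * (1 + ld) * D + 3 * ((1 + ld) * Y)
     + 170 * (K * (1 + ld) * D) + 170 * (K * (1 + ld) * Y) by ring.
  by move: e1 e2 e3; move: (3 * (1 + ld) * D) ((1 + ld) * Y) (K * (1 + ld) * D) (K * (1 + ld) * Y) => x y z t; lra.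
have h3 : 0 <= (3 + 170 * K) * (1 + ld) * (D + Y).
  by rewrite mulr_ge0 ?(addr_ge0 D0 Y0) ?mulr_ge0 ?(le_trans ler01 l1) ?c0.
have h4 : (3 + 170 * K) * (1 + ld) * (D + Y) <=
   2 * lT * ((3 + 170 * K) * (1 + ld) * (D + Y)) by rewrite ler_peMl //; lra.
have -> : 2 * (3 + 170 * K) * (1 + ld) * lT * (D + Y) =
   2 * lT * ((3 + 170 * K) * (1 + ld) * (D + Y)) by ring.
apply: (le_trans _ h4); apply: (le_trans _ h2); rewrite lerD2l ler_wpM2l //.
Qed.

Theorem theorem4 (R : realType) (dZ : measure_display) (S : measurableType dZ)
    (hScount : countable [set: S]) (hSmeas : forall z : S, measurable [set z])
    (pi : probability S R) (C0 : R) (hC0 : 0 < C0) :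
  exists C : R, 0 < C /\
  forall
    (d : nat) (p : R) (hp : 1 <= p <= 2)
    (X : set 'rV[R]_d) (hXcompact : compact X) (hXconvex : @convex_set R _ X)
    (w : 'rV[R]_d -> \bar R) (dw : 'rV[R]_d -> 'rV[R]_d)
    (hw : distance_generating p X w dw)
    (Q : R.-pker S ~> S) (hpi : unique_invariant_distribution Q pi)
    (tau : R) (htau : 1 <= tau) (hmix : geometrically_ergodic Q pi C0 tau)
    (F : 'rV[R]_d -> 'rV[R]_d) (Fo : 'rV[R]_d -> S -> 'rV[R]_d)
    (L : R) (hL : 0 < L) (hlip : lipschitz_pnorm_on p L X F)
    (hmono : monotone_on X F)
    (sigma : R)
    (horacle : unbiased_bounded_oracle p sigma pi F Fo)
    (dO : measure_display) (Omega : measurableType dO)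
    (P : probability Omega R)
    (Z : nat -> {RV P >-> S}) (hZ : stationary_markov_chain Q pi Z)
    (J : nat -> {RV P >-> nat}) (hJ : geometric_half J)
    (hJZ : independent_levels Z J)
    (B M : nat) (hB : (0 < B)%N) (hM : (0 < M)%N)
    (gamma : R) (hgamma : 0 < gamma) (hgammaL : gamma <= 1 / (2 * L))
    (x0 : 'rV[R]_d) (hx0 : X x0)
    (T : nat) (hT : (2 <= T)%N),
    ('E_P[fun o => err_vi X F
            (mirror_prox_average X w dw Fo gamma B M x0
               (fun i => Z i o) (fun t => J t o) T)]
     <= (C * (1 + ln d%:R) * ln T%:R *
          (bregman_diam2 X w dw / (gamma * T%:R)
           + gamma * tau * B%:R^-1 * (T%:R * M%:R^-1 + ln M%:R)
               * sigma ^+ 2))%:E)%E.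
Proof.
have [kappa kappa0 contraction] := ergodic_contraction hScount hSmeas pi hC0.
pose K : R := 1203 * 8 * kappa.
have pos n : 0 < (n.+1%:R : R) := ltr0Sn R n.
have K0 : 0 < K := mulr_gt0 (mulr_gt0 (pos 1202) (pos 7)) kappa0.
exists (2 * (3 + 170 * K)); split.
  exact: (mulr_gt0 (pos 1) (addr_gt0 (pos 2) (mulr_gt0 (pos 169) K0))).
move=> d p hp X hXcompact hXconvex w dw hw Q hpi tau htau hmix F Fo L hL hlip
  hmono sigma horacle dO Omega P Z hZ J hJ hJZ B M hB hM gamma hgamma hgammaL
  x0 hx0 T hT.
have p0 : 0 < p by have /andP[p1 _] := hp; apply: lt_le_trans p1.
have [q [q2 qld hpq qdual]] := smooth_surrogate d hp.
have q0 : 0 < q by apply: lt_le_trans q2.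
have [unb osc] := horacle.
pose s : R := 2 * `|sigma|.
have hs x z : pnorm q (Fo x z - F x) <= s.
  apply: (le_trans (qdual _)); rewrite /s ler_pM2l //.
  rewrite -(ler_pXn2r (n := 2)) ?nnegrE ?dual_pnorm_ge0 //.
  by rewrite real_normK ?num_real.
have hcent x := unbiased_centered hScount hSmeas q0 (unb x) (hs x).
have [b [b0 btau hb]] := contraction Q tau htau hmix.
have main := expected_error hScount hSmeas hpi.1 b0 hb hp q2 hpq hXcompact hXconvex
  hw hs hcent hZ.1 hJ hJZ hB hM hx0 hL hlip hmono hgamma hgammaL hT.
apply: (le_trans main); rewrite lee_fin.
have T0 : 0 < (T%:R : R) by rewrite ltr0n (ltn_trans _ hT).
have B0 : 0 < (B%:R : R) by rewrite ltr0n.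
have M0 : 0 < (M%:R : R) by rewrite ltr0n.
have D0 : 0 <= bregman_diam2 X w dw.
  by apply: le_trans (bregman_le_diam2 hXcompact hw hx0 hx0); exact: (bregman_ge0 hXconvex hw).
have k0 : 0 < (2 : R) ^+ top_level M by rewrite exprn_gt0.
have W1 := one_le_batch_terms R hM hT.
have lM0 := ln_nat_ge0 R M.
have W0 : 0 <= T%:R * M%:R^-1 + ln (M%:R : R).
  by rewrite addr_ge0 // mulr_ge0 ?invr_ge0.
have lam0 := variance_proxy_ge0 b q2 s.
apply: (le_trans (cost_arith (bregman_diam2 X w dw) hgamma T0 B0 M0 lam0 k0
  (top_level_le_ln R hM) (le_double_top_level R M) lM0 W1)).
have lT : 1 / 2 <= ln (T%:R : R).
  by apply: (le_trans (ln2_ge_half R)); rewrite ler_ln ?posrE // ler_nat.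
have s2 : s ^+ 2 = 4 * sigma ^+ 2.
  by rewrite /s exprMn real_normK ?num_real // -natrX.
have gT0 : 0 <= gamma * T%:R by rewrite mulr_ge0 // ltW.
exact: (rate_arith (divr_ge0 D0 gT0) (ltW kappa0) (le_trans ler01 htau) (ltW hgamma)
  (ltW (etrans (invr_gt0 _) B0)) W0 (ln_nat_ge0 R d) (ler0n R 1203) lT (ler0n R b) (ltW q0)
  erefl s2 (sqr_ge0 sigma) qld btau erefl).
Qed.
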